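(* Let $\mathcal T$ be a complete, subsequential, finally connected, finally aperiodic transducer with transition matrices $M_\varepsilon(y)$ (of the final component) for $\varepsilon\in\mathcal A_I$. Let $K\ge2$ be the size of the input alphabet $\mathcal A_I$ and $$f(x,y,z)=\det\Big(I-\frac zK\sum_{\varepsilon\in\mathcal A_I}x^{\varepsilon}M_\varepsilon(y)\Big).$$ Then $\mathsf{Input}(X_n)$ and $\mathsf{Output}(X_n)$ have the expected values, variances and covariance $$\mathbb E(\mathsf{Input}(X_n))=e_1n,\quad \mathbb E(\mathsf{Output}(X_n))=e_2n+\mathcal O(1),$$ $$\mathbb V(\mathsf{Input}(X_n))=v_1n,\quad \mathbb V(\mathsf{Output}(X_n))=v_2n+\mathcal O(1),\quad \mathrm{Cov}(\mathsf{Input}(X_n),\mathsf{Output}(X_n))=cn+\mathcal O(1)$$ with, all partial derivatives being evaluated at $\mathbf 1=(1,1,1)$, where $f_z(\mathbf 1)\neq0$, $$e_1=\frac{f_x}{f_z},\qquad e_2=\frac{f_y}{f_z},$$ $$v_1=\frac1{f_z^3}\big(f_x^2(f_{zz}+f_z)+f_z^2(f_{xx}+f_x)-2f_xf_zf_{xz}\big),$$ $$v_2=\frac1{f_z^3}\big(f_y^2(f_{zz}+f_z)+f_z^2(f_{yy}+f_y)-2f_yf_zf_{yz}\big),$$ $$c=\frac1{f_z^3}\big(f_xf_y(f_{zz}+f_z)+f_z^2f_{xy}-f_yf_zf_{xz}-f_xf_zf_{yz}\big).$$ The constants $e_1$ and $v_1$ can also be expressed as $$e_1=\frac1K\sum_{\varepsilon\in\mathcal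 A_I}\varepsilon,\qquad v_1=\frac1K\sum_{\varepsilon\in\mathcal A_I}\varepsilon^2-\Big(\frac1K\sum_{\varepsilon\in\mathcal A_I}\varepsilon\Big)^2.$$ The random vector $\boldsymbol\Omega_n=(\mathsf{Input}(X_n),\mathsf{Output}(X_n))^t$ is asymptotically jointly normally distributed if and only if the asymptotic variance-covariance matrix $\Sigma=\begin{pmatrix}v_1&c\\c&v_2\end{pmatrix}$ is regular. The transducer $\mathcal T$ is independent if and only if $$\big(f_xf_y(f_{zz}+f_z)+f_z^2f_{xy}-f_yf_zf_{xz}-f_xf_zf_{yz}\big)\big|_{\mathbf 1}=0$$ or, equivalently, $$\big(e_1f_y(f_{zz}+f_z)+f_zf_{xy}-f_yf_{xz}-e_1f_zf_{yz}\big)\big|_{\mathbf 1}=0.$$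
   Context: A transducer consists of a finite set of states $\{1,\dots,S\}$, a finite input alphabet $\mathcal A_I\subseteq\mathbb R$, an output alphabet $\mathcal A_O\subseteq\mathbb R$, a set of transitions $\mathcal E\subseteq\{1,\dots,S\}^2\times\mathcal A_I$, output labels $\delta\colon\mathcal E\to\mathcal A_O$, and the initial state $1$. A transition $e=(s,t,\varepsilon)$ goes from $s$ to $t$ and has input label $\varepsilon$ and output label $\delta(e)$. The underlying graph is the directed multigraph (loops and parallel edges allowed) whose vertices are the states and whose edges are the transitions. The transducer is deterministic if for every state $s$ and $\varepsilon\in\mathcal A_I$ there is at most one $t$ with $(s,t,\varepsilon)\in\mathcal E$; complete if for every $s$ and $\varepsilon$ there is some such $t$; subsequential if it is deterministic, every state is final, and it has a final output $a\colon\{1,\dots,S\}\to\mathcal A_O$. It is finally connected if some state can be reached from every other state; its final component is then the transducer induced by the set of all states which can be reached from every other state. A finally connected transducer is finally aperiodic if the underlying graph of the final component is aperiodic (the gcd of the lengths of all closed walks starting and ending at a given vertex is $1$). Let $N$ be the number of states of the final component. For $\varepsilon\in\mathcal A_I$, $M_\varepsilon(y)$ is the $N\times N$ matrix indexed by the states of the final component whose entry $(s,t)$ is $y^{\delta}$ if there is a transition from $s$ to $t$ in the final component with input $\varepsilon$ and output $\delta$, and $0$ otherwise. Exponents of $x$ and $y$ are real, and $f$ is considered for $x,y$ near $1$. Subscripts of $f$ denote partial derivatives. The output of the transducer on an input word is the sequence of output labels along the unique path starting at state $1$ whose input labels are the word (read in a fixed direction, from right to left), together with the final output label of the last state of this path.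 $X_n$ is uniformly distributed on $\mathcal A_I^n$; $\mathsf{Input}(X_n)$ is the sum of the letters of $X_n$ and $\mathsf{Output}(X_n)$ is the sum of its output sequence. Convergence in distribution of $\boldsymbol\Omega_n$ is understood for the standardized vector $(\boldsymbol\Omega_n-(e_1,e_2)^tn)/\sqrt n$. Asymptotically jointly normally distributed means that this standardized vector converges in distribution to a non-degenerate bivariate normal distribution (regular covariance matrix). A transducer is independent if $\boldsymbol\Omega_n$ (so standardized) converges in distribution to a random vector with two independent components; a degenerate (almost surely constant) random variable is independent of any other random variable. *)

(* Defs.v *)
From mathcomp Require Import all_boot all_order all_algebra finmap.
From mathcomp Require Import all_classical all_reals all_analysis.
Import Order.TTheory GRing.Theory Num.Theory.
Import numFieldNormedType.Exports.

Set Implicit Arguments.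
Unset Strict Implicit.
Unset Printing Implicit Defensive.

Local Open Scope classical_set_scope.
Local Open Scope ring_scope.

(** * Transducers *)

(* The states 1, ..., S are the elements of 'I_S with S = (tr_size T).+1, and
   the initial state 1 is [ord0]. The output label [tr_delta e] is only
   meaningful when [e \in tr_trans T]. *)
Record transducer (R : realType) := Transducer {
  tr_size : nat;
  tr_in : {fset R};
  tr_out : set R;
  tr_trans : {set 'I_tr_size.+1 * 'I_tr_size.+1 * tr_in};
  tr_delta : 'I_tr_size.+1 * 'I_tr_size.+1 * tr_in -> R;
  tr_delta_out : forall e, e \in tr_trans -> tr_out (tr_delta e) }.

Definition tr_state (R : realType) (T : transducer R) : finType :=
  'I_(tr_size T).+1.

Definition tr_letter (R : realType) (T : transducer R) : finType := tr_in T.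

Definition tr_edge (R : realType) (T : transducer R) : finType :=
  (tr_state T * tr_state T * tr_letter T)%type.

Definition tr_init (R : realType) (T : transducer R) : tr_state T := ord0.

Section Properties.
Variables (R : realType) (T : transducer R).
Implicit Types (s t : tr_state T) (eps : tr_letter T).

Definition deterministic : Prop := forall s eps t t',
  (s, t, eps) \in tr_trans T -> (s, t', eps) \in tr_trans T -> t = t'.

Definition complete_transducer : Prop :=
  forall s eps, exists t, (s, t, eps) \in tr_trans T.

(* The final output is defined on every state: every state is final. *)
Definition subsequential (a : tr_state T -> R) : Prop :=
  deterministic /\ forall s, tr_out T (a s).

Definition step : rel (tr_state T) :=
  fun s t => [exists eps, (s, t, eps) \in tr_trans T].

Definition final_states : {set tr_state T} :=
  [set t | [forall s, connect step s t]].

Definition finally_connected : Prop := exists t, t \in final_states.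

Definition final_trans : {set tr_edge T} :=
  [set e in tr_trans T | (e.1.1 \in final_states) && (e.1.2 \in final_states)].

(* [walk s p t]: the sequence of edges [p] is a walk from [s] to [t] in the
   underlying multigraph of the final component. *)
Fixpoint walk s (p : seq (tr_edge T)) t : bool :=
  if p is e :: p' then [&& e \in final_trans, e.1.1 == s & walk e.1.2 p' t]
  else s == t.

(* For every vertex, 1 is the only common divisor of the lengths of the closed
   walks at this vertex, i.e. their gcd is 1. *)
Definition finally_aperiodic : Prop := forall s, s \in final_states ->
  forall d : nat, (forall p, walk s p s -> (d %| size p)%N) -> d = 1%N.

(* The indices of the matrices are the states of the final component, through
   the enumeration [enum_val]. *)
Definition trans_mx eps (y : R) : 'M[R]_#|final_states| :=
  \matrix_(i, j)
    (let e : tr_edge T := (enum_val i, enum_val j, eps) in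
     if e \in final_trans then y `^ tr_delta e else 0).

Definition char_fun (x y z : R) : R :=
  \det (1%:M - (z / #|` tr_in T|%:R) *:
        \sum_(eps : tr_letter T) (x `^ val eps) *: trans_mx eps y).

(** ** Input and output of a word *)

(* The target state of the transition from [s] with input [eps]; it is the
   unique one if the transducer is deterministic and complete. *)
Definition next_state s eps : tr_state T :=
  odflt s [pick t | (s, t, eps) \in tr_trans T].

Fixpoint run (a : tr_state T -> R) s (w : seq (tr_letter T)) : seq R :=
  if w is eps :: w' then
    let t := next_state s eps in tr_delta (s, t, eps) :: run a t w'
  else [:: a s].

(* Words are read from right to left. *)
Definition output_seq (a : tr_state T -> R) (w : seq (tr_letter T)) : seq R :=
  run a (tr_init T) (rev w).

Definition input_sum (w : seq (tr_letter T)) : R := \sum_(eps <- w) val eps.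

Definition output_sum (a : tr_state T -> R) (w : seq (tr_letter T)) : R :=
  \sum_(d <- output_seq a w) d.

End Properties.

(** * Partial derivatives *)

Section Partial.
Variable R : realType.
Implicit Type f : R -> R -> R -> R.

Definition Dx f : R -> R -> R -> R :=
  fun x y z => derive1 (fun u : R => f u y z) x.
Definition Dy f : R -> R -> R -> R :=
  fun x y z => derive1 (fun u : R => f x u z) y.
Definition Dz f : R -> R -> R -> R :=
  fun x y z => derive1 (fun u : R => f x y u) z.

End Partial.

(** * Probability *)

(* [u n = v n + O(1)]; in particular all the [u n] are finite. *)
Definition eq_upto_O1 (R : realType) (u : nat -> \bar R) (v : nat -> R) : Prop :=
  exists2 r : nat -> R, r =O_\oo (fun=> 1 : R) &
    forall n, u n = (v n + r n)%:E.

(* The words of length [n] carry no sigma-algebra in the library: measurability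
   of [X n] is expressed for the discrete one. *)
Definition uniform_words (R : realType) (T : transducer R)
    (d : nat -> measure_display) (Om : forall n, measurableType (d n))
    (P : forall n, probability (Om n) R)
    (X : forall n, Om n -> n.-tuple (tr_letter T)) : Prop :=
  forall n (w : n.-tuple (tr_letter T)),
    measurable (X n @^-1` [set w]) /\
    P n (X n @^-1` [set w]) = ((#|` tr_in T|%:R ^+ n)^-1)%:E.

Definition standardized (R : realType) (d : nat -> measure_display)
    (Om : forall n, measurableType (d n)) (e1 e2 : R)
    (Y Z : forall n, Om n -> R) (n : nat) (o : Om n) : R * R :=
  ((Y n o - e1 * n%:R) / Num.sqrt n%:R, (Z n o - e2 * n%:R) / Num.sqrt n%:R).

Definition cvg_in_distribution (R : realType) (d : nat -> measure_display)
    (Om : forall n, measurableType (d n)) (P : forall n, probability (Om n) R)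
    (Z : forall n, Om n -> R * R)
    (d' : measure_display) (Om' : measurableType d') (Q : probability Om' R)
    (W : Om' -> R * R) : Prop :=
  forall g : R * R -> R, continuous g -> bounded_fun g ->
    ('E_(P n)[fun o => g (Z n o)])%E @[n --> \oo]
      --> ('E_Q[fun o => g (W o)])%E.

Definition independent_rv (R : realType) (d : measure_display)
    (Om : measurableType d) (Q : probability Om R) (U V : {RV Q >-> R}) : Prop :=
  forall A B : set R, measurable A -> measurable B ->
    Q (U @^-1` A `&` V @^-1` B) = (Q (U @^-1` A) * Q (V @^-1` B))%E.

(* Density of the normal distribution with mean [m] and covariance [G]. *)
Definition binormal_pdf (R : realType) (m : R * R) (G : 'M[R]_2) (w : R * R) : R :=
  let v : 'cV[R]_2 := \col_i (if i == ord0 then w.1 - m.1 else w.2 - m.2) in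
  expR (- ((v^T *m invmx G *m v) ord0 ord0) / 2) / (2 * pi * Num.sqrt (\det G)).

Definition covariance_mx (R : realType) (G : 'M[R]_2) : Prop :=
  G^T = G /\ forall u : 'cV[R]_2, 0 <= (u^T *m G *m u) ord0 ord0.

(* [(U, V)] has a bivariate normal distribution with a regular covariance
   matrix. *)
Definition nondegenerate_binormal (R : realType) (d : measure_display)
    (Om : measurableType d) (Q : probability Om R) (U V : {RV Q >-> R}) : Prop :=
  exists (m : R * R) (G : 'M[R]_2),
    [/\ covariance_mx G, G \in unitmx &
        forall B : set (R * R), measurable B ->
          Q [set o | B (U o, V o)] =
          (\int[(lebesgue_measure \x lebesgue_measure)]_(w in B)
             (binormal_pdf m G w)%:E)%E].

Definition asymptotically_jointly_normal (R : realType)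
    (d : nat -> measure_display) (Om : forall n, measurableType (d n))
    (P : forall n, probability (Om n) R) (Z : forall n, Om n -> R * R) : Prop :=
  exists (d' : measure_display) (Om' : measurableType d')
    (Q : probability Om' R) (U V : {RV Q >-> R}),
    nondegenerate_binormal U V /\
    cvg_in_distribution P Z Q (fun o => (U o, V o)).

Definition asymptotically_independent (R : realType)
    (d : nat -> measure_display) (Om : forall n, measurableType (d n))
    (P : forall n, probability (Om n) R) (Z : forall n, Om n -> R * R) : Prop :=
  exists (d' : measure_display) (Om' : measurableType d')
    (Q : probability Om' R) (U V : {RV Q >-> R}),
    independent_rv U V /\
    cvg_in_distribution P Z Q (fun o => (U o, V o)).

Definition mx22 (R : realType) (a b c d : R) : 'M[R]_2 :=
  \matrix_(i, j) (if i == ord0 then (if j == ord0 then a else b)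
                  else (if j == ord0 then c else d)).

(* Main.v *)
(* Along a uniformly random word the transducer performs a Markov chain, and on
   its final component the Poisson equation g = e + h - P h is solvable. It
   splits p Input + q Output - (p e1 + q e2) n into a martingale plus a bounded
   function of the last state, and a second Poisson equation, for the conditional
   variances, yields the asymptotic variance V(p, q) of the martingale.

   The solutions h and h' give an eigenvector, up to third order in r, of the
   tilted transition matrix at x = exp(p r), y = exp(q r), with eigenvalue
   exp(e r + V r^2 / 2). Multiplying by the adjugate shows that
   f(exp(p r), exp(q r), exp(- e r - V r^2 / 2)) = O(r^3), and since f is a
   finite sum of terms a x^b y^c z^k, comparing coefficients expresses e and V
   through the partial derivatives of f. The same corrector, put inside
   E cos(th + r S_k), gives the convergence of the characteristic functions to
   those of the normal law. Aperiodicity makes the oscillation of E(S_k u(state))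
   contract, which removes the mixed terms from the second moments.

   Convergence in distribution follows from that of the characteristic functions
   since Bernstein polynomials in sines are bounded trigonometric polynomials
   approximating g on a large square. Conversely the limit law determines its
   characteristic function, which factorizes only if c = 0; if the covariance
   matrix is singular, the limit law is concentrated on a line. *)

Require Import Defs.
From HB Require Import structures.
From mathcomp Require Import all_boot all_order all_algebra finmap.
From mathcomp Require Import all_classical all_reals all_analysis.
From mathcomp Require Import measurable_realfun ring lra.
Import Order.TTheory GRing.Theory Num.Theory.
Import numFieldNormedType.Exports.
Set Implicit Arguments.
Unset Strict Implicit.
Unset Printing Implicit Defensive.
Local Open Scope classical_set_scope.
Local Open Scope ring_scope.

(** * The characteristic function of the normal law *)

(** Everything stays real: [cos (th + ...)] with a free phase [th] carries the real and the
    imaginary part of a characteristic function at once. No exact eigenvalue is constructed. The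
    formulas involve derivatives of order at most two, so an eigenvector up to third order suffices,
    and the directions (1, 0), (0, 1), (1, 1) determine the quadratic form V. That f_z is nonzero
    has a separate source: at x = y = 1 the determinant has the factor 1 - z, and the other factor
    at z = 1 is, up to a constant, the determinant of the linear system that solves the Poisson
    equation. The initial state may lie outside the final component, whereas f only sees that
    component. The Poisson equations are therefore solved on all states and their solutions
    restricted for the study of f. Since K >= 2, the input has positive variance. A singular
    covariance matrix hence forces a line s U + V = 0 with explicit slope, and the regular normal
    law can be built as the input followed by the output given the input. *)

Section Bounded.
Context d (T : measurableType d) (R : realType) (mu : {measure set T -> \bar R}).

Lemma integrable_bounded_mul (B : R) (g f : T -> R) :
  measurable_fun setT g -> (forall x, `|g x| <= B) ->
  mu.-integrable setT (EFin \o f) ->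
  mu.-integrable setT (EFin \o (fun x => g x * f x)).
Proof.
move=> mg gB fi.
have mf : measurable_fun setT f by case/integrableP: fi => /measurable_EFinP.
apply: (@le_integrable _ _ _ mu setT measurableT _ (fun x => B%:E * (EFin \o f) x)%E).
- by apply/measurable_EFinP; apply: measurable_funM.
- move=> x _ /=; rewrite lee_fin !normrM ler_wpM2r //.
  exact: le_trans (gB x) (ler_norm _).
- exact: integrableZl.
Qed.

End Bounded.

Section GaussCF.
Variables (R : realType) (s : R).
Hypothesis s_gt0 : 0 < s.
Notation mu := (@lebesgue_measure R).

Let s_neq0 : s != 0. Proof. by rewrite gt_eqF. Qed.

Let dbl (a : R) : a *+ 2 = 2 * a. Proof. by rewrite mulr_natl. Qed.

(** For [m = 0] this is the characteristic function in real form: [th = 0] gives its real part and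
    [th = - (pi / 2)] its imaginary part. The mean is kept as a variable in order to differentiate
    in it. *)
Let I (t th m : R) : R := \int[mu]_x (cos (th + t * x) * normal_pdf m s x).

Lemma measurable_cos_affine (t th : R) : measurable_fun setT (fun x : R => cos (th + t * x)).
Proof.
apply: measurableT_comp; first by apply: continuous_measurable_fun; exact: continuous_cos.
by apply: measurable_funD => //; apply: measurable_funM.
Qed.

Lemma cos_abs_le1 (x : R) : `|cos x| <= 1.
Proof. by rewrite ler_norml cos_geN1 cos_le1. Qed.

Lemma integrable_cos_normal (t th m : R) :
  mu.-integrable setT (EFin \o (fun x => cos (th + t * x) * normal_pdf m s x)).
Proof.
apply: (@integrable_bounded_mul _ _ _ mu 1 (fun x : R => cos (th + t * x)) (normal_pdf m s)); first
    exact: measurable_cos_affine.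
  by move=> x; exact: cos_abs_le1.
exact: integrable_normal_pdf.
Qed.

Lemma normal_pdf_shift (m x : R) : normal_pdf m s (x + m) = normal_pdf 0 s x.
Proof. by rewrite !normal_pdfE // /normal_fun addrK subr0. Qed.

(** Translating by the mean only changes the phase. The substitution rule is used for nonnegative
    integrands, so it is applied to 1 plus the cosine, and the mass 1 of the density is cancelled
    afterwards. *)
Lemma cos_normal_shift (t th m : R) : I t th m = I t (th + t * m) 0.
Proof.
have D1 : (fun x : R => x + m)^`()%classic = cst 1.
  by apply/funext => x; rewrite derive1E deriveD// derive_id derive_cst addr0.
have H (g : R -> R) : continuous g -> (forall x, 0 <= g x) ->
  (\int[mu]_x (g x * normal_pdf m s x) = \int[mu]_x (g (x + m) * normal_pdf 0 s x))%R.
  move=> cg g0; rewrite /Rintegral.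
  rewrite (@increasing_ge0_integration_by_substitutionT R (fun x => x + m)).
  - congr fine; apply: eq_integral => x _.
    by rewrite D1 !fctE/= mulr1 normal_pdf_shift.
  - by move=> x y xy; rewrite ltrD2r.
  - by rewrite D1 => ?; exact: cvg_cst.
  - by rewrite D1; exact: is_cvg_cst.
  - by rewrite D1; exact: is_cvg_cst.
  - by move=> x; apply: derivableD.
  - exact: cvg_addrr_Ny.
  - exact: cvg_addrr.
  - move=> x; apply: cvgM; first exact: cg.
    exact: continuous_normal_pdf.
  - by move=> x; rewrite mulr_ge0 // normal_pdf_ge0.
have in1 m' : mu.-integrable setT (EFin \o normal_pdf m' s).
  exact: integrable_normal_pdf.
have E1 : \int[mu]_x ((1 + cos (th + t * x)) * normal_pdf m s x) = 1 + I t th m.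
  under eq_Rintegral do rewrite mulrDl mul1r.
  rewrite RintegralD; [|exact: measurableT|exact: in1|exact: integrable_cos_normal].
  by congr (_ + _); rewrite /Rintegral integral_normal_pdf.
have E2 : \int[mu]_x ((1 + cos (th + t * (x + m))) * normal_pdf 0 s x) = 1 + I t (th + t * m) 0.
  have -> : (fun x => (1 + cos (th + t * (x + m))) * normal_pdf 0 s x) =
      (fun x => normal_pdf 0 s x + cos ((th + t * m) + t * x) * normal_pdf 0 s x).
    by apply/funext => x; rewrite mulrDl mul1r; congr (_ + cos _ * _); ring.
  rewrite RintegralD; [|exact: measurableT|exact: in1|exact: integrable_cos_normal].
  by congr (_ + _); rewrite /Rintegral integral_normal_pdf.
apply: (addrI 1); rewrite -[LHS]E1 -[RHS]E2.
apply: (H (fun x => 1 + cos (th + t * x))).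
- move=> x; apply: cvgD; first exact: cvg_cst.
  apply: continuous_comp; last exact: continuous_cos.
  by apply: cvgD; [exact: cvg_cst|apply: cvgM; [exact: cvg_cst|exact: cvg_id]].
- by move=> x; rewrite -lerBlDl sub0r cos_geN1.
Qed.

Let Gb (C : R) (x : R) := C * normal_pdf 0 (2 * s) x.

(** Domination for differentiating under the integral sign, in the frequency and in the mean.
    Doubling the standard deviation absorbs both the linear factor and the shift by [m]. *)
Lemma abs_mul_normal_le : exists2 C : R, 0 <= C & forall x m : R, `|m| <= 1 ->
  `|x - m| * normal_pdf m s x <= Gb C x.
Proof.
have s2 : 0 < s ^+ 2 by rewrite exprn_gt0.
have p2 : 0 < normal_peak (2 * s) by rewrite normal_peak_gt0 // mulf_neq0.
exists (s * expR (1 / (4 * s ^+ 2)) * normal_peak s / normal_peak (2 * s)).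
  by rewrite !mulr_ge0 ?invr_ge0 ?normal_peak_ge0 ?expR_ge0 ?(ltW s_gt0).
move=> x m m1; rewrite /Gb !normal_pdfE ?mulf_neq0 //.
set y := x - m.
(* The square of 2 s - |y| is nonnegative, and 1 + u <= exp u. Multiplying by this exponential uses
   up half of the Gaussian exponent. *)
have yb : `|y| <= s * expR (y ^+ 2 / (4 * s ^+ 2)).
  apply: (@le_trans _ _ (s * (1 + y ^+ 2 / (4 * s ^+ 2)))); last first.
    by rewrite ler_pM2l // expR_ge1Dx.
  rewrite -subr_ge0.
  have -> : s * (1 + y ^+ 2 / (4 * s ^+ 2)) - `|y| = (2 * s - `|y|) ^+ 2 / (4 * s).
    by rewrite -(real_normK (num_real y)); field.
  by rewrite divr_ge0 ?sqr_ge0 // mulr_ge0 // ltW.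
have -> : s * expR (1 / (4 * s ^+ 2)) * normal_peak s / normal_peak (2 * s) *
    (normal_peak (2 * s) * normal_fun 0 (2 * s) x) =
    normal_peak s * (s * (expR (1 / (4 * s ^+ 2)) * normal_fun 0 (2 * s) x)).
  by field; rewrite gt_eqF.
rewrite mulrCA ler_pM2l ?normal_peak_gt0 // /normal_fun -expRD.
apply: (le_trans (ler_wpM2r (expR_ge0 _) yb)).
rewrite -mulrA ler_pM2l // -expRD ler_expR subr0 -/y.
(* What remains to compare is x^2 <= 2 + 2 (x - m)^2, whose difference is 2 - 2 m^2 plus the square
   of x - 2 m. *)
rewrite -subr_ge0.
set rhs := (X in 0 <= X).
have -> : rhs = ((2 - 2 * m ^+ 2) + (x - 2 * m) ^+ 2) / (8 * s ^+ 2).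
  by rewrite /rhs /y (dbl ((2 * s) ^+ 2)) (dbl (s ^+ 2)); field.
apply: divr_ge0; last by rewrite mulr_ge0 // ltW.
apply: addr_ge0; last exact: sqr_ge0.
have : m ^+ 2 <= 1 by rewrite -[m ^+ 2]ger0_norm ?sqr_ge0 // normrX expr_le1.
by move=> ?; rewrite subr_ge0 -[leRHS]mulr1 ler_pM2l.
Qed.

Let integrable_Gb C : mu.-integrable setT (EFin \o Gb C).
Proof.
have := @integrable_normal_pdf R 0 (2 * s).
by move=> /(integrableZl measurableT C).
Qed.

Lemma is_derive_cos_affine (t th x : R) :
  is_derive t 1 (fun t => cos (th + t * x)) (- sin (th + t * x) * x).
Proof.
apply: is_derive_eq.
by rewrite scaler1 /GRing.scale /=; ring.
Qed.

Lemma is_derive_cvg (f : R -> R) (a l : R) :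
  h^-1 *: (f (h + a) - f a) @[h --> 0^'] --> l -> is_derive a 1 f l.
Proof.
move=> H.
have H' : h^-1 *: (f (h *: 1 + a) - f a) @[h --> 0^'] --> l.
  by under eq_fun do rewrite scaler1.
by apply: DeriveDef; [apply/cvg_ex; exists l | apply/cvg_lim].
Qed.

Lemma is_derive_normal_cf (t th : R) :
  is_derive t 1 (fun t => I t th 0)
    (\int[mu]_x (- sin (th + t * x) * x * normal_pdf 0 s x)).
Proof.
apply: is_derive_cvg.
have [C C0 HC] := abs_mul_normal_le.
have D (x y : R) : is_derive x 1 (fun x => cos (th + x * y) * normal_pdf 0 s y)
    (- sin (th + x * y) * y * normal_pdf 0 s y).
  have ? := is_derive_cos_affine x th y.
  by apply: is_derive_eq; rewrite /GRing.scale /=; ring.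
have DE (x y : R) : partial1of2 (fun x y => cos (th + x * y) * normal_pdf 0 s y) x y =
    - sin (th + x * y) * y * normal_pdf 0 s y.
  by rewrite partial1of2E derive_val.
have /= := @cvg_differentiation_under_integral R _ _ mu
  (fun x y => cos (th + x * y) * normal_pdf 0 s y) setT measurableT
  t (t - 1) (t + 1) _ _ _ (Gb C).
rewrite (_ : (fun y => partial1of2 _ t y) = (fun y => - sin (th + t * y) * y * normal_pdf 0 s y)); last first.
  by apply/funext => y; rewrite DE.
apply.
- by rewrite in_itv /= !(ltrDl, gtrDl) ltr01 oppr_lt0 ltr01.
- by move=> x _; exact: integrable_cos_normal.
- by move=> x y _ _; have := D x y; case.
- by move=> y; rewrite /Gb mulr_ge0 // normal_pdf_ge0.
- exact: integrable_Gb.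
- move=> x y _ _; rewrite DE !normrM normrN (ger0_norm (normal_pdf_ge0 _ _ _)).
  have := HC y 0; rewrite normr0 subr0 => /(_ ler01); apply: le_trans.
  rewrite ler_wpM2r ?normal_pdf_ge0 // ler_piMl //.
  by rewrite ler_norml sin_geN1 sin_le1.
Qed.

Lemma is_derive_normal_pdf_mean (m x : R) :
  is_derive m 1 (fun m => normal_pdf m s x) ((x - m) / s ^+ 2 * normal_pdf m s x).
Proof.
under eq_fun do rewrite normal_pdfE //.
rewrite normal_pdfE // /normal_fun.
have D1 : is_derive m 1 (fun m => - (x - m) ^+ 2 / (s ^+ 2 *+ 2)) ((x - m) / s ^+ 2).
  apply: is_derive_eq.
  by rewrite /GRing.scale /= (dbl (s ^+ 2)); field.
have D2 := @is_derive1_comp R expR (fun m => - (x - m) ^+ 2 / (s ^+ 2 *+ 2)) m _ _ (is_derive_expR _) D1.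
apply: is_derive_eq.
by rewrite /GRing.scale /=; ring.
Qed.

Lemma is_derive_normal_cf_mean (t th : R) :
  is_derive (0 : R) 1 (fun m => I t th m)
    (\int[mu]_x (cos (th + t * x) * (x / s ^+ 2 * normal_pdf 0 s x))).
Proof.
apply: is_derive_cvg.
have [C C0 HC] := abs_mul_normal_le.
have D (m y : R) : is_derive m 1 (fun m => cos (th + t * y) * normal_pdf m s y)
    (cos (th + t * y) * ((y - m) / s ^+ 2 * normal_pdf m s y)).
  have ? := is_derive_normal_pdf_mean m y.
  by apply: is_derive_eq; rewrite /GRing.scale /=; ring.
have DE (m y : R) : partial1of2 (fun m y => cos (th + t * y) * normal_pdf m s y) m y =
    (cos (th + t * y) * ((y - m) / s ^+ 2 * normal_pdf m s y)).
  by rewrite partial1of2E derive_val.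
have /= := @cvg_differentiation_under_integral R _ _ mu
  (fun m y => cos (th + t * y) * normal_pdf m s y) setT measurableT
  0 (- 1) 1 _ _ _ (Gb (C / s ^+ 2)).
rewrite (_ : (fun y => partial1of2 _ 0 y) = (fun y => cos (th + t * y) * (y / s ^+ 2 * normal_pdf 0 s
    y))); last first.
  by apply/funext => y; rewrite DE subr0.
apply.
- by rewrite in_itv /= oppr_lt0 ltr01.
- by move=> x _; exact: integrable_cos_normal.
- by move=> x y _ _; have := D x y; case.
- by move=> y; rewrite /Gb mulr_ge0 ?normal_pdf_ge0 // divr_ge0 // sqr_ge0.
- exact: integrable_Gb.
- move=> x y /andP[x1 x2] _; rewrite DE !normrM (ger0_norm (normal_pdf_ge0 _ _ _)).
  have s2 : 0 <= (s ^+ 2)^-1 by rewrite invr_ge0 sqr_ge0.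
  rewrite (ger0_norm s2) /Gb -[C / _ * _]mulrAC.
  apply: (@le_trans _ _ (`|y - x| * normal_pdf x s y / s ^+ 2)).
    rewrite [leRHS]mulrAC ler_piMl ?cos_abs_le1 //.
    by rewrite !mulr_ge0 ?normal_pdf_ge0.
  rewrite ler_wpM2r //; apply: HC.
  by rewrite ler_norml; move: x1 x2; rewrite !bnd_simp; lra.
Qed.

Lemma normal_cf_turn (t th : R) : I t (th + pi) 0 = - I t th 0.
Proof.
rewrite /I -[RHS]mulN1r -RintegralZl //; last exact: integrable_cos_normal.
by apply: eq_Rintegral => x _; rewrite addrAC cosDpi; ring.
Qed.

(* Differentiating the translation identity [cos_normal_shift] in the mean at 0
   plays the role of the integration by parts. *)
Lemma normal_cf_ode (t th : R) : is_derive t 1 (fun t => I t th 0) (- s ^+ 2 * t * I t th 0).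
Proof.
have := is_derive_normal_cf t th.
set J := (X in is_derive _ _ _ X); suff -> : J = - s ^+ 2 * t * I t th 0 by [].
have D1 := is_derive_normal_cf_mean t (th + pi / 2).
(* The phase [pi / 2] turns the cosine into minus the sine occurring in [J]. As the mean only moves
   the phase, the dependence on [m] is explicit and can be differentiated directly. *)
have E0 m : I t (th + pi / 2) m = cos (t * m) * I t (th + pi / 2) 0 + sin (t * m) * I t (th + pi) 0.
  rewrite cos_normal_shift /I -!RintegralZl //; try exact: integrable_cos_normal.
  rewrite -RintegralD //; try (apply: (@integrableZl _ _ _ mu setT measurableT _ (EFin \o _)); exact:
      integrable_cos_normal).
  apply: eq_Rintegral => x _.
  have -> : th + pi / 2 + t * m + t * x = (th + t * x) + pi / 2 + t * m by ring.
  have -> : th + pi / 2 + t * x = (th + t * x) + pi / 2 by ring.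
  have -> : th + pi + t * x = (th + t * x) + pi by ring.
  by rewrite cosD cosDpi sinDpihalf; ring.
have D2 : is_derive (0 : R) 1 (fun m => I t (th + pi / 2) m) (t * I t (th + pi) 0).
  rewrite (funext E0).
  have a0 : is_derive (0 : R) 1 (fun m : R => t * m) t.
    by apply: is_derive_eq; rewrite /GRing.scale /=; ring.
  have a1 := @is_derive1_comp R cos (fun m => t * m) 0 _ _ (is_derive_cos _) a0.
  have a2 := @is_derive1_comp R sin (fun m => t * m) 0 _ _ (is_derive_sin _) a0.
  apply: is_derive_eq.
  by rewrite /= !mulr0 sin0 cos0 /GRing.scale /=; ring.
have := @derive_val _ _ _ _ _ _ _ D1; rewrite (@derive_val _ _ _ _ _ _ _ D2) normal_cf_turn => E.
rewrite -mulrA -[I t th 0]opprK mulrN E mulrNN -RintegralZl //; last first.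
  have [C C0 HC] := abs_mul_normal_le.
  apply: (@le_integrable _ _ _ mu setT measurableT _ (EFin \o Gb (C / s ^+ 2))) => //.
  - apply/measurable_EFinP; apply: measurable_funM; first exact: measurable_cos_affine.
    by apply: measurable_funM; [apply: measurable_funM|exact: measurable_normal_pdf].
  - move=> x _ /=; rewrite lee_fin [leRHS]ger0_norm; last first.
      by rewrite /Gb !mulr_ge0 ?normal_pdf_ge0 ?invr_ge0 ?sqr_ge0.
    have := HC x 0; rewrite normr0 subr0 => /(_ ler01) xC.
    rewrite !normrM (ger0_norm (normal_pdf_ge0 _ _ _)) normfV (ger0_norm (sqr_ge0 s)).
    apply: (@le_trans _ _ (`|x| * normal_pdf 0 s x / s ^+ 2)).
      rewrite [X in _ * X]mulrAC ler_piMl ?cos_abs_le1 //.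
      by rewrite !mulr_ge0 ?normal_pdf_ge0 ?invr_ge0 ?sqr_ge0.
    by rewrite /Gb -[C / _ * _]mulrAC ler_wpM2r // invr_ge0 sqr_ge0.
rewrite /J; apply: eq_Rintegral => x _.
have -> : th + pi / 2 + t * x = (th + t * x) + pi / 2 by ring.
by rewrite cosDpihalf; field.
Qed.

Lemma normal_cf (t th m : R) :
  \int[mu]_x (cos (th + t * x) * normal_pdf m s x) =
  expR (- s ^+ 2 * t ^+ 2 / 2) * cos (th + t * m).
Proof.
have C0 t' th' : I t' th' 0 = expR (- s ^+ 2 * t' ^+ 2 / 2) * cos th'.
  (* Integrating factor of the linear differential equation: the product is constant in the
     frequency. *)
  have D (x : R) : is_derive x 1 (fun t => I t th' 0 * expR (s ^+ 2 * t ^+ 2 / 2)) 0.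
    have d1 := normal_cf_ode x th'.
    have d0 : is_derive x 1 (fun t : R => s ^+ 2 * t ^+ 2 / 2) (s ^+ 2 * x).
      apply: is_derive_eq.
      by rewrite /GRing.scale /=; field.
    have d2 := @is_derive1_comp R expR (fun t => s ^+ 2 * t ^+ 2 / 2) x _ _ (is_derive_expR _) d0.
    by apply: is_derive_eq; rewrite /GRing.scale /=; ring.
  have := is_derive_0_is_cst t' 0 D.
  rewrite expr0n /= mulr0 mul0r expR0 mulr1 => E.
  have I0 : I 0 th' 0 = cos th'.
    rewrite /I; under eq_Rintegral do rewrite mul0r addr0.
    rewrite RintegralZl //; last exact: integrable_normal_pdf.
    by rewrite /Rintegral integral_normal_pdf mulr1.
  rewrite -I0 -E mulrCA -expRD.
  have -> : - s ^+ 2 * t' ^+ 2 / 2 + s ^+ 2 * t' ^+ 2 / 2 = 0 by ring.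
  by rewrite expR0 mulr1.
by rewrite -[LHS]/(I t th m) cos_normal_shift C0.
Qed.

End GaussCF.

(** * Bivariate normal laws *)

Section Density.
Context d (T : measurableType d) (R : realType) (mu : {sigma_finite_measure set T -> \bar R}).
Variable p : T -> R.
Hypotheses (p_ge0 : forall x, 0 <= p x) (mp : measurable_fun setT p)
  (p_int1 : (\int[mu]_x (p x)%:E = 1)%E).

Definition density_measure : set T -> \bar R := fun A => (\int[mu]_(x in A) (p x)%:E)%E.

Let ip : mu.-integrable setT (EFin \o p).
Proof.
apply/integrableP; split; first exact/measurable_EFinP.
under eq_integral do rewrite /= ger0_norm //.
by rewrite p_int1 ltry.
Qed.

Let dens0 : density_measure set0 = 0%E. Proof. by rewrite /density_measure integral_set0. Qed.

Let dens_ge0 A : (0 <= density_measure A)%E.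
Proof. by apply: integral_ge0 => x _; rewrite lee_fin. Qed.

Let dens_additive : semi_sigma_additive density_measure.
Proof.
move=> /= A mA tA mUA.
rewrite /density_measure/= integral_bigcup//=; last first.
  exact: (integrableS _ _ (subsetT _) ip).
apply: is_cvg_ereal_nneg_natsum_cond => n _ _.
by apply: integral_ge0 => /= x ?; rewrite lee_fin.
Qed.

HB.instance Definition _ := isMeasure.Build _ _ _ density_measure dens0 dens_ge0 dens_additive.

Let densT : density_measure setT = 1%E.
Proof. exact: p_int1. Qed.

HB.instance Definition _ := @Measure_isProbability.Build _ _ R density_measure densT.

Let Q : probability T R := density_measure.

Let dens_dominates : Q `<< mu.
Proof.
apply/null_content_dominatesP => A mA muA0.
by rewrite /Q /= /density_measure null_set_integral //; apply: measurable_funTS; exact/measurable_EFinP.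
Qed.

(** The Radon-Nikodym derivative of the measure with density [p] agrees with [p] almost everywhere,
    because both have the same integral over every measurable set. This carries the change of
    variables over to bounded integrands. *)
Lemma density_probability : exists Q : probability T R,
  (forall A, measurable A -> Q A = (\int[mu]_(x in A) (p x)%:E)%E) /\
  forall (B : R) (g : T -> R), measurable_fun setT g -> (forall x, `|g x| <= B) ->
    (\int[Q]_x (g x)%:E = \int[mu]_x (g x * p x)%:E)%E.
Proof.
exists Q; split => // B g mg gB.
have ig : Q.-integrable setT (EFin \o g).
  apply: (@le_integrable _ _ _ Q setT measurableT _ (EFin \o cst B)).
  - exact/measurable_EFinP.
  - by move=> x _ /=; rewrite lee_fin (le_trans (gB x)) // ler_norm.
  - exact: finite_measure_integrable_cst.
rewrite -(Radon_Nikodym_change_of_variables dens_dominates measurableT ig).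
under [RHS]eq_integral do rewrite EFinM.
apply: ae_eq_integral => //.
- by apply: emeasurable_funM => //; exact/measurable_EFinP.
- by apply: emeasurable_funM => //; exact/measurable_EFinP.
- apply: ae_eqe_mul2l => /=.
  rewrite Radon_NikodymE //=.
  case: cid => /= h [h1 h2 h3].
  apply: integral_ae_eq => //=.
  + exact/measurable_EFinP.
  + by move=> E E01 mE; rewrite -h3.
Qed.

End Density.

Section JointNormal.
Variables (R : realType) (k s1 s2 : R).
Hypotheses (s1_gt0 : 0 < s1) (s2_gt0 : 0 < s2).
Notation mu := (@lebesgue_measure R).

(** A normal first coordinate and, given it, a normal second one with mean proportional to it.
    Regular centred bivariate normal densities have this form ([binormal_pdfE]), which lets every
    integral be done one variable at a time. *)
Definition cond_normal_pdf (w : R * R) : R :=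
  normal_pdf 0 s1 w.1 * normal_pdf (k * w.1) s2 w.2.

Lemma cond_normal_pdf_ge0 w : 0 <= cond_normal_pdf w.
Proof. by rewrite mulr_ge0 ?normal_pdf_ge0. Qed.

Lemma measurable_cond_normal_pdf : measurable_fun setT cond_normal_pdf.
Proof.
have -> : cond_normal_pdf = (fun w => normal_pdf 0 s1 w.1 * normal_pdf 0 s2 (w.2 - k * w.1)).
  apply/funext => w; rewrite /cond_normal_pdf; congr (_ * _).
  by rewrite -(normal_pdf_shift s2_gt0 (k * w.1)) subrK.
apply: measurable_funM.
  by apply: measurableT_comp; [exact: measurable_normal_pdf | exact: measurable_fst].
apply: measurableT_comp; first exact: measurable_normal_pdf.
by apply: measurable_funB => //; apply: measurable_funM.
Qed.

Lemma integral_cond_normal_pdf :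
  (\int[mu \x mu]_w (cond_normal_pdf w)%:E = 1)%E.
Proof.
rewrite fubini_tonelli1 /=; first last.
- by move=> w; rewrite lee_fin cond_normal_pdf_ge0.
- by apply/measurable_EFinP; exact: measurable_cond_normal_pdf.
rewrite -(integral_normal_pdf 0 s1); apply: eq_integral => x _.
rewrite /fubini_F /cond_normal_pdf /=.
under eq_integral do rewrite EFinM.
rewrite integralZl //; last exact: integrable_normal_pdf.
by rewrite integral_normal_pdf mule1.
Qed.

Lemma measurable_cos_pair (th a b : R) :
  measurable_fun setT (fun w : R * R => cos (th + a * w.1 + b * w.2)).
Proof.
apply: measurableT_comp; first by apply: continuous_measurable_fun; exact: continuous_cos.
by apply: measurable_funD; [apply: measurable_funD => //|]; apply: measurable_funM.
Qed.

(** Integrating out the second variable gives its Gaussian factor and, through the conditional mean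
    [k * x], changes the frequency in the first variable from [a] to [a + b * k]. *)
Lemma integral_cos_cond_normal (th a b : R) :
  (\int[mu \x mu]_w (cos (th + a * w.1 + b * w.2) * cond_normal_pdf w)%:E =
   (expR (- (s1 ^+ 2 * (a + b * k) ^+ 2 + s2 ^+ 2 * b ^+ 2) / 2) * cos th)%:E)%E.
Proof.
have ip : (mu \x mu)%E.-integrable setT (EFin \o cond_normal_pdf).
  apply/integrableP; split; first by apply/measurable_EFinP; exact: measurable_cond_normal_pdf.
  under eq_integral do rewrite /= ger0_norm ?cond_normal_pdf_ge0 //.
  by rewrite integral_cond_normal_pdf ltry.
have ic : (mu \x mu)%E.-integrable setT
    (EFin \o (fun w => cos (th + a * w.1 + b * w.2) * cond_normal_pdf w)).
  apply: (@integrable_bounded_mul _ _ _ (mu \x mu)%E 1 (fun w : R * R => cos (th + a * w.1 + b * w.2))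
      cond_normal_pdf) => //.
  - exact: measurable_cos_pair.
  - by move=> w; exact: cos_abs_le1.
rewrite -(integral12_prod_meas1 ic) /fubini_F /=.
have inner x : (\int[mu]_y (cos (th + a * x + b * y) * cond_normal_pdf (x, y))%:E =
   ((expR (- s2 ^+ 2 * b ^+ 2 / 2)) * (cos (th + (a + b * k) * x) * normal_pdf 0 s1 x))%:E)%E.
  rewrite /cond_normal_pdf /=.
  have -> : (fun y => (cos (th + a * x + b * y) * (normal_pdf 0 s1 x * normal_pdf (k * x) s2 y))%:E) =
    (fun y => (normal_pdf 0 s1 x)%:E * (cos (th + a * x + b * y) * normal_pdf (k * x) s2 y)%:E)%E.
    by apply/funext => y; rewrite -EFinM mulrCA.
  have i1 := integrable_cos_normal s2 b (th + a * x) (k * x).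
  rewrite integralZl //.
  have -> : (\int[mu]_y (cos (th + a * x + b * y) * normal_pdf (k * x) s2 y)%:E)%E =
     (\int[mu]_y (cos (th + a * x + b * y) * normal_pdf (k * x) s2 y))%R%:E.
    by rewrite /Rintegral fineK //; exact: integrable_fin_num i1.
  rewrite normal_cf // -EFinM; congr EFin.
  have -> : th + a * x + b * (k * x) = th + (a + b * k) * x by ring.
  ring.
under eq_integral do rewrite inner.
under eq_integral do rewrite EFinM.
have i1 := integrable_cos_normal s1 (a + b * k) th 0.
rewrite integralZl //.
have -> : (\int[mu]_x (cos (th + (a + b * k) * x) * normal_pdf 0 s1 x)%:E)%E =
   (\int[mu]_x (cos (th + (a + b * k) * x) * normal_pdf 0 s1 x))%R%:E.
  by rewrite /Rintegral fineK //; exact: integrable_fin_num i1.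
rewrite normal_cf // -EFinM mulr0 addr0 mulrA -expRD; congr ((expR _ * _)%:E).
by field.
Qed.

Lemma cond_normal_probability : exists Q : probability (measurableTypeR R * measurableTypeR R)%type R,
  (forall A, measurable A -> Q A = (\int[mu \x mu]_(w in A) (cond_normal_pdf w)%:E)%E) /\
  forall th a b : R, ('E_Q[fun w => (cos (th + a * w.1 + b * w.2))%R] =
   (expR (- (s1 ^+ 2 * (a + b * k) ^+ 2 + s2 ^+ 2 * b ^+ 2) / 2) * cos th)%R%:E)%E.
Proof.
have sfM : sigma_finite setT (mu \x mu)%E.
  pose J (n : nat) : set R := `[- n%:R, n%:R]%classic.
  have JT x : exists n0, forall n, (n0 <= n)%N -> J n x.
    exists (Num.truncn `|x|).+1 => n xn; rewrite /J /= in_itv /= -ler_norml.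
    by rewrite (le_trans (ltW (truncnS_gt _))) // ler_nat.
  exists (fun n => J n `*` J n).
    apply/esym/seteqP; split => // -[x y] _.
    have [n1 H1] := JT x; have [n2 H2] := JT y.
    by exists (maxn n1 n2) => //; split; [apply: H1|apply: H2]; rewrite ?leq_maxl ?leq_maxr.
  move=> n; have mJ : measurable (J n) by exact: measurable_itv.
  split; first exact: measurableX.
  have oJ : (mu (J n) < +oo)%E by rewrite /J lebesgue_measure_itv /=; case: ifP => _; rewrite ltry.
  by rewrite product_measure1E // lte_mul_pinfty // ge0_fin_numE.
pose M : {sigma_finite_measure set (measurableTypeR R * measurableTypeR R)%type -> \bar R} :=
  HB.pack (mu \x mu)%E (Measure_isSigmaFinite.Build _ _ _ (mu \x mu)%E sfM).
have [Q [QE HQ]] := @density_probability _ _ _ M _ cond_normal_pdf_ge0 measurable_cond_normal_pdf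
  integral_cond_normal_pdf.
exists Q; split => // th a b.
rewrite unlock (HQ 1); [exact: integral_cos_cond_normal|exact: measurable_cos_pair|].
by move=> w; exact: cos_abs_le1.
Qed.

End JointNormal.

(** * Bernstein polynomials and trigonometric polynomials *)

Section HeineCantor.
Variable R : realType.

(** Only [x] is confined to [K]. This form is needed in [trig_approx], where the nodes at which [g]
    is sampled may lie outside the square. *)
Lemma heine_cantor (K : set (R * R)) (g : R * R -> R) (eta : R) :
  compact K -> continuous g -> 0 < eta ->
  exists2 del : R, 0 < del & forall x y, K x -> ball x del y -> `|g x - g y| <= eta.
Proof.
move=> /compact_near_coveringP cK cg eta0.
have H : \forall del \near 0^'+, K `<=` [set x | forall y, ball x (del : R) y -> `|g x - g y| <= eta].
  apply: cK => x Kx.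
  have /cvgrPdist_le /(_ (eta / 2)) := cg x.
  rewrite divr_gt0 // => /(_ isT) /nbhs_ballP [r /= r0 Hr].
  exists (ball x (r / 2), [set d : R | d < r / 2]) => /=.
    split; first by apply: nbhsx_ballx; rewrite divr_gt0.
    by apply: nbhs_right_lt; rewrite divr_gt0.
  move=> [x' del] [/= xx' delr] y x'y.
  have h1 : `|g x - g x'| <= eta / 2.
    by apply: Hr; apply: le_ball xx'; lra.
  have h2 : `|g x - g y| <= eta / 2.
    apply: Hr; rewrite (splitr r); apply: ball_triangle xx' _.
    exact: le_ball (ltW delr) _ x'y.
  rewrite (splitr eta); apply: le_trans (lerD h1 h2).
  by rewrite [X in _ <= X + _]distrC; apply: le_trans (ler_normD _ _); rewrite addrA subrK.
near ((0 : R)^'+) => del; exists del; first by [].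
move=> x y Kx; have Hdel : K `<=` [set x | forall y, ball x (del : R) y -> `|g x - g y| <= eta].
  by near: del.
exact: Hdel.
Unshelve. all: by end_near. Qed.

End HeineCantor.

Section Bernstein.
Variable R : realType.
Implicit Types (p c : R) (m : nat) (phi psi : nat -> R).

(* Mean of [phi] under the binomial distribution with parameters [m] and [p]. *)
Fixpoint bern p m phi : R :=
  if m is m'.+1 then p * bern p m' (fun j => phi j.+1) + (1 - p) * bern p m' phi
  else phi 0%N.

Lemma bern_le p m phi psi : 0 <= p <= 1 ->
  (forall j, (j <= m)%N -> phi j <= psi j) -> bern p m phi <= bern p m psi.
Proof.
move=> /andP[p0 p1]; elim: m phi psi => [|m IH] phi psi H /=; first exact: H.
apply: lerD; apply: ler_wpM2l; rewrite ?subr_ge0 //; apply: IH => j jm; apply: H => //.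
exact: leqW.
Qed.

Lemma bern_lin p m a b phi psi :
  bern p m (fun j => a * phi j + b * psi j) = a * bern p m phi + b * bern p m psi.
Proof. by elim: m phi psi => [|m IH] phi psi //=; rewrite !IH; ring. Qed.

Lemma bern_cst p m c : bern p m (fun=> c) = c.
Proof. by elim: m => //= m ->; ring. Qed.

(** The offset [c] makes the induction work: a success moves it by 1 - p and a failure by - p, and
    the two cases average out. *)
Lemma bern_var p m c :
  bern p m (fun j => (j%:R + c - m%:R * p) ^+ 2) = m%:R * p * (1 - p) + c ^+ 2.
Proof.
elim: m c => [|m IH] c /=; first by ring.
have -> : (fun j => (j.+1%:R + c - m.+1%:R * p) ^+ 2) =
    (fun j => (j%:R + (c + 1 - p) - m%:R * p) ^+ 2).
  by apply/funext => j; rewrite -!natr1; ring.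
have -> : (fun j => (j%:R + c - m.+1%:R * p) ^+ 2) =
    (fun j => (j%:R + (c - p) - m%:R * p) ^+ 2).
  by apply/funext => j; rewrite -!natr1; ring.
by rewrite !IH -natr1; ring.
Qed.

Lemma bern_abs_le p m phi psi : 0 <= p <= 1 ->
  (forall j, (j <= m)%N -> `|phi j| <= psi j) -> `|bern p m phi| <= bern p m psi.
Proof.
move=> p01 H; rewrite ler_norml; apply/andP; split.
  have -> : - bern p m psi = bern p m (fun j => (-1) * psi j + 0 * psi j).
    by rewrite bern_lin; ring.
  by apply: bern_le => // j /H; rewrite ler_norml mulN1r mul0r addr0 => /andP[].
by apply: bern_le => // j /H; rewrite ler_norml => /andP[].
Qed.

Lemma bern_sqr_dist p m : 0 <= p <= 1 -> (0 < m)%N ->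
  bern p m (fun j => (j%:R / m%:R - p) ^+ 2) <= m%:R^-1.
Proof.
move=> /andP[p0 p1] m0.
have mn0 : m%:R != 0 :> R by rewrite pnatr_eq0 -lt0n.
have -> : (fun j => (j%:R / m%:R - p) ^+ 2) =
   (fun j => m%:R ^- 2 * (j%:R + 0 - m%:R * p) ^+ 2 + 0 * (j%:R + 0 - m%:R * p) ^+ 2) :> (nat -> R).
  by apply/funext => j; field.
rewrite bern_lin bern_var.
have -> : m%:R ^- 2 * (m%:R * p * (1 - p) + 0 ^+ 2) + 0 * (m%:R * p * (1 - p) + 0 ^+ 2) =
   p * (1 - p) * m%:R^-1 by field.
rewrite ler_piMl ?invr_ge0 ?ler0n //.
by rewrite mulr_ile1 // ?subr_ge0 // lerBlDr lerDl.
Qed.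

End Bernstein.

Section Trig.
Variable R : realType.

(** The components of [q] are amplitude, phase, and the frequencies in [x] and [y]. Having a phase
    instead of separate sines, the product of two terms is the sum of two terms by a single
    product-to-sum formula. *)
Definition cterm (q : R * R * R * R) (x y : R) : R :=
  q.1.1.1 * cos (q.1.1.2 + q.1.2 * x + q.2 * y).

Definition trig (T : R -> R -> R) : Prop :=
  exists l : seq (R * R * R * R), forall x y, T x y = \sum_(q <- l) cterm q x y.

Lemma trig_cterm q : trig (cterm q).
Proof. by exists [:: q] => x y; rewrite big_seq1. Qed.

Lemma trig_cst c : trig (fun _ _ => c).
Proof.
by exists [:: (c, 0, 0, 0)] => x y; rewrite big_seq1 /cterm /= !mul0r !addr0 cos0 mulr1.
Qed.

Lemma trigD T1 T2 : trig T1 -> trig T2 -> trig (fun x y => T1 x y + T2 x y).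
Proof. by move=> [l1 H1] [l2 H2]; exists (l1 ++ l2) => x y; rewrite big_cat /= H1 H2. Qed.

Lemma trig_ext T1 T2 : (forall x y, T1 x y = T2 x y) -> trig T1 -> trig T2.
Proof. by move=> H [l Hl]; exists l => x y; rewrite -H. Qed.

Lemma trigM T1 T2 : trig T1 -> trig T2 -> trig (fun x y => T1 x y * T2 x y).
Proof.
move=> [l1 H1] [l2 H2].
suff H : trig (fun x y => \sum_(q <- l1) \sum_(q' <- l2) cterm q x y * cterm q' x y).
  apply: trig_ext H => x y; rewrite H1 H2 big_distrl /=; apply: eq_bigr => q _.
  by rewrite big_distrr.
elim: l1 {H1} => [|q l1 IH].
  by apply: trig_ext (trig_cst 0) => x y; rewrite big_nil.
apply: trig_ext (_ : trig (fun x y => (\sum_(q' <- l2) cterm q x y * cterm q' x y) +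
   \sum_(q <- l1) \sum_(q' <- l2) cterm q x y * cterm q' x y)).
  by move=> x y; rewrite big_cons.
apply: trigD IH; elim: l2 {H2} => [|q' l2 IH].
  by apply: trig_ext (trig_cst 0) => x y; rewrite big_nil.
apply: trig_ext (_ : trig (fun x y => cterm q x y * cterm q' x y +
   \sum_(q' <- l2) cterm q x y * cterm q' x y)).
  by move=> x y; rewrite big_cons.
apply: trigD IH.
exists [:: (q.1.1.1 * q'.1.1.1 / 2, q.1.1.2 + q'.1.1.2, q.1.2 + q'.1.2, q.2 + q'.2);
  (q.1.1.1 * q'.1.1.1 / 2, q.1.1.2 - q'.1.1.2, q.1.2 - q'.1.2, q.2 - q'.2)] => x y.
rewrite big_cons big_seq1 /cterm /=.
set A := q.1.1.2 + q.1.2 * x + q.2 * y; set B := q'.1.1.2 + q'.1.2 * x + q'.2 * y.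
have -> : q.1.1.2 + q'.1.1.2 + (q.1.2 + q'.1.2) * x + (q.2 + q'.2) * y = A + B by rewrite /A /B; ring.
have -> : q.1.1.2 - q'.1.1.2 + (q.1.2 - q'.1.2) * x + (q.2 - q'.2) * y = A - B by rewrite /A /B; ring.
by rewrite cosD cosB; field.
Qed.

Lemma trig_bern (P : R -> R -> R) (m : nat) (Phi : nat -> R -> R -> R) :
  trig P -> (forall j, trig (Phi j)) ->
  trig (fun x y => bern (P x y) m (fun j => Phi j x y)).
Proof.
move=> tP; elim: m Phi => [|m IH] Phi tPhi /=; first exact: tPhi.
apply: trigD; apply: trigM => //; try by apply: IH.
apply: trig_ext (trigD (trig_cst 1) (trigM (trig_cst (-1)) tP)) => x y.
by rewrite mulN1r.
Qed.

End Trig.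

(** * Lower bounds for differences of sines *)

Section SinLower.
Variable R : realType.

Lemma cos_ge_abs (Y y : R) : 0 <= Y <= pi -> `|y| <= Y -> cos Y <= cos y.
Proof.
move=> /andP[Y0 Ypi] yY.
have -> : cos y = cos `|y| by case: (ger0P y) => _; rewrite ?cosN.
move: yY; rewrite le_eqVlt => /predU1P[-> //|yY].
apply/ltW; rewrite ltr_cos // in_itv /= ?Y0 ?normr_ge0 //.
by rewrite (le_trans (ltW yY)).
Qed.

(** Mean value theorem: the sine is |y| times a cosine at a point of modulus at most Y, and there
    the cosine is least at the ends. *)
Lemma sin_lower (Y y : R) : 0 <= Y <= pi -> `|y| <= Y -> cos Y * `|y| <= `|sin y|.
Proof.
move=> YY.
have pos z : 0 <= z -> z <= Y -> cos Y * z <= sin z.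
  move=> z0 zY.
  have [|c] := @MVT_segment R sin cos 0 z z0.
    by apply: continuous_subspaceT => x; exact: continuous_sin.
  rewrite in_itv /= sin0 !subr0 => /andP[c0 cz] ->.
  apply: ler_wpM2r => //; apply: cos_ge_abs => //.
  by rewrite ger0_norm // (le_trans cz).
case: (ger0P y) => [y0|y0] yY.
  by apply: le_trans (ler_norm _); apply: pos.
rewrite -normrN -sinN; apply: le_trans (ler_norm _); apply: pos => //.
by rewrite oppr_ge0 ltW.
Qed.

(** The difference is 2 sin ((a - b) / 2) cos ((a + b) / 2), and both half-angles have modulus at
    most Y = (pi / 2 + 1) / 2 < pi / 2. The asymmetric ranges matter: if [a] and [b] could both
    approach pi / 2, no positive constant would do. Here [a] will be an arcsine and [b] a rescaled
    coordinate. *)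
Lemma sin_dist_lower : exists2 c0 : R, 0 < c0 &
  forall a b : R, `|a| <= pi / 2 -> `|b| <= 1 -> c0 * `|a - b| <= `|sin a - sin b|.
Proof.
pose Y : R := (pi / 2 + 1) / 2.
have /andP[p0 p2] := @pihalf_02 R.
have p1 : 1 < pi / 2 :> R.
  rewrite lt_neqAle pihalf_ge1 andbT; apply/eqP => E.
  by have := @cos1_gt0 R; rewrite E cos_pihalf ltxx.
have Ypi : Y < pi / 2 by rewrite /Y; lra.
have Y0 : 0 <= Y <= pi by rewrite /Y; apply/andP; split; lra.
have c0 : 0 < cos Y by apply: cos_gt0_pihalf; rewrite Ypi andbT /Y; lra.
exists (cos Y ^+ 2) => [|a b a1 b1]; first exact: exprn_gt0.
have half (z : R) : `|z / 2| = `|z| / 2 by rewrite normrM normfV (normr_nat R 2).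
have h1 : `|(a - b) / 2| <= Y.
  by rewrite half /Y ler_pM2r ?invr_gt0 // (le_trans (ler_normB _ _)) // lerD.
have h2 : `|(a + b) / 2| <= Y.
  by rewrite half /Y ler_pM2r ?invr_gt0 // (le_trans (ler_normD _ _)) // lerD.
have -> : sin a - sin b = 2 * (sin ((a - b) / 2) * cos ((a + b) / 2)).
  have -> : sin a = sin ((a + b) / 2 + (a - b) / 2) by congr sin; field.
  have -> : sin b = sin ((a + b) / 2 - (a - b) / 2) by congr sin; field.
  by rewrite sinD sinB; ring.
have h3 := sin_lower Y0 h1.
have h4 := cos_ge_abs Y0 h2.
rewrite normrM (normr_nat R 2) normrM.
have -> : cos Y ^+ 2 * `|a - b| = 2 * (cos Y * `|(a - b) / 2| * cos Y).
  by rewrite half; field.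
rewrite ler_pM2l //; apply: ler_pM => //.
- by rewrite mulr_ge0 // ltW.
- exact: ltW.
- exact: le_trans h4 (ler_norm _).
Qed.

End SinLower.

Section TrigApprox.
Variables (R : realType) (g : R * R -> R) (B : R).
Hypotheses (cg : continuous g) (gB : forall w, `|g w| <= B).

(* Bernstein approximation in the variables [(1 + sin (x / L)) / 2] and
   [(1 + sin (y / L)) / 2], which keeps the global bound [B] of [g]. *)
Lemma trig_approx (L eta : R) : 0 < L -> 0 < eta ->
  exists T, [/\ trig T, forall x y, `|T x y| <= B &
    forall x y, `|x| <= L -> `|y| <= L -> `|T x y - g (x, y)| <= eta].
Proof.
move=> L0 eta0.
have B0 : 0 <= B by rewrite (le_trans _ (gB (0, 0))).
have cK : compact ([set x : R | `|x| <= L] `*` [set x : R | `|x| <= L]).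
  have -> : [set x : R | `|x| <= L] = `[- L, L]%classic.
    by apply/seteqP; split => x /=; rewrite in_itv /= ler_norml.
  by apply: compact_setX; exact: segment_compact.
have eta20 : 0 < eta / 2 by rewrite divr_gt0.
have [del del0 Hdel] := heine_cantor cK cg eta20.
have [c0 c00 Hc0] := sin_dist_lower R.
pose P (x : R) := (1 + sin (x / L)) / 2.
have P01 x : 0 <= P x <= 1.
  by have := sin_geN1 (x / L); have := sin_le1 (x / L); rewrite /P => ? ?; apply/andP; split; lra.
pose xi (u : R) := L * asin (2 * u - 1).
(* [xi] inverts [P] on [-L, L]. *)
have Lip u x : 0 <= u <= 1 -> `|x| <= L -> `|xi u - x| <= 2 * L / c0 * `|u - P x|.
  move=> /andP[u0 u1] xL.
  have u2 : -1 <= 2 * u - 1 <= 1 by apply/andP; split; lra.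
  have xL1 : `|x / L| <= 1 by rewrite normrM normfV (gtr0_norm L0) ler_pdivrMr // mul1r.
  have a1 : `|asin (2 * u - 1)| <= pi / 2 by rewrite ler_norml asin_geNpi2 ?asin_lepi2.
  have := Hc0 _ _ a1 xL1; rewrite asinK ?in_itv //= => H.
  have -> : xi u - x = L * (asin (2 * u - 1) - x / L) by rewrite /xi; field; rewrite gt_eqF.
  have E : 2 * u - 1 - sin (x / L) = 2 * (u - P x) by rewrite /P; field.
  move: H; rewrite E !normrM (normr_nat R 2) (gtr0_norm L0) => H.
  rewrite [leRHS](_ : _ = L * ((2 * `|u - P x|) / c0)); last by field; rewrite gt_eqF.
  by rewrite ler_pM2l // ler_pdivlMr // mulrC.
(* By [Lip], this distance between u and [P x] is small enough to keep [xi u] within [del] of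
   [x]. *)
pose d' := del * c0 / (2 * L).
have d'0 : 0 < d' by rewrite /d' !(divr_gt0, mulr_gt0).
have CB0 : 0 <= 2 * B / d' ^+ 2 by rewrite divr_ge0 ?sqr_ge0 // mulr_ge0.
have near_node u x : 0 <= u <= 1 -> `|x| <= L -> `|u - P x| < d' -> `|x - xi u| < del.
  move=> u01 xL H; rewrite distrC; apply: le_lt_trans (Lip _ _ u01 xL) _.
  rewrite mulrC -ltr_pdivlMr ?divr_gt0 ?mulr_gt0 //.
  by apply: lt_le_trans H _; rewrite le_eqVlt /d'; apply/orP; left; apply/eqP; field; rewrite !gt_eqF.
(* Degree given by Chebyshev: far nodes cost at most 2 B / d'^2 times the sum of two variances, each
   at most 1 / m, and this has to be at most eta / 2. *)
pose m := (Num.truncn (8 * B / (d' ^+ 2 * eta))).+1.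
have m0 : (0 < m)%N by [].
have mR0 : 0 < m%:R :> R by rewrite ltr0n.
have mbig : 4 * B / d' ^+ 2 * m%:R^-1 <= eta / 2.
  rewrite [leLHS](_ : _ = eta / 2 * (8 * B / (d' ^+ 2 * eta)) / m%:R); last first.
    by field; rewrite !gt_eqF.
  by rewrite ler_pdivrMr // ler_pM2l //; exact: ltW (truncnS_gt _).
pose nd (j : nat) : R := xi (j%:R / m%:R).
have nd01 j : (j <= m)%N -> 0 <= (j%:R / m%:R : R) <= 1.
  by move=> jm; rewrite divr_ge0 ?ler0n //= ler_pdivrMr // mul1r ler_nat.
pose T x y := bern (P x) m (fun j => bern (P y) m (fun k => g (nd j, nd k))).
exists T; split.
- apply: trig_bern.
    apply: trig_ext (_ : trig (fun x y => cterm (1 / 2, 0, 0, 0) x y + cterm (1 / 2, - (pi / 2), L^-1, 0) x y)).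
      move=> x y; rewrite /cterm /P /= !mul0r !addr0 cos0.
      by rewrite addrC [_ + L^-1 * x]addrC cosBpihalf [L^-1 * x]mulrC; field.
    by apply: trigD; exact: trig_cterm.
  move=> j; apply: (@trig_bern R (fun _ y => P y) m (fun k _ _ => g (nd j, nd k))).
    apply: trig_ext (_ : trig (fun x y => cterm (1 / 2, 0, 0, 0) x y + cterm (1 / 2, - (pi / 2), 0, L^-1) x y)).
      move=> x y; rewrite /cterm /P /= !mul0r !addr0 cos0.
      by rewrite [_ + L^-1 * y]addrC cosBpihalf [L^-1 * y]mulrC; field.
    by apply: trigD; exact: trig_cterm.
  by move=> k; exact: trig_cst.
- move=> x y; rewrite -(bern_cst (P x) m B); apply: bern_abs_le => // j _.
  by rewrite -(bern_cst (P y) m B); apply: bern_abs_le.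
- move=> x y xL yL.
  pose A (j : nat) : R := (j%:R / m%:R - P x) ^+ 2.
  pose A' (k : nat) : R := (k%:R / m%:R - P y) ^+ 2.
  (* If both node distances are below [d'], uniform continuity of [g] applies; otherwise
     [A j + A' k] is at least d'^2 and the trivial bound 2 B is paid by the second term. *)
  have pt j k : (j <= m)%N -> (k <= m)%N ->
      `|g (nd j, nd k) - g (x, y)| <= eta / 2 + 2 * B / d' ^+ 2 * (A j + A' k).
    move=> jm km.
    have AA : 0 <= A j /\ 0 <= A' k by rewrite !sqr_ge0.
    have d2 : 0 < d' ^+ 2 by rewrite exprn_gt0.
    have far : d' ^+ 2 <= A j + A' k ->
        `|g (nd j, nd k) - g (x, y)| <= eta / 2 + 2 * B / d' ^+ 2 * (A j + A' k).
      move=> H; apply: (@le_trans _ _ (2 * B)).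
        by rewrite (le_trans (ler_normB _ _)) // mulr_natl mulr2n lerD.
      apply: (@le_trans _ _ (2 * B / d' ^+ 2 * (A j + A' k))); last by rewrite lerDr ltW.
      rewrite -{1}[2 * B](divfK (lt0r_neq0 d2)).
      exact: ler_wpM2l.
    have [lx|lx] := ltP `|j%:R / m%:R - P x| d'; last first.
      apply: far; rewrite -[d' ^+ 2]addr0; apply: lerD; last by case: AA.
      by rewrite /A -(real_normK (num_real (_ - P x))) ler_sqr ?nnegrE // ltW.
    have [ly|ly] := ltP `|k%:R / m%:R - P y| d'; last first.
      apply: far; rewrite -[d' ^+ 2]add0r; apply: lerD; first by case: AA.
      by rewrite /A' -(real_normK (num_real (_ - P y))) ler_sqr ?nnegrE // ltW.
    apply: (@le_trans _ _ (eta / 2)); last first.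
      by rewrite lerDl mulr_ge0 // addr_ge0 //; case: AA.
    rewrite distrC; apply: Hdel; first by split.
    by split => /=; apply: near_node => //; exact: nd01.
  have -> : T x y - g (x, y) = bern (P x) m (fun j => bern (P y) m (fun k => g (nd j, nd k) - g (x, y))).
    have E j : bern (P y) m (fun k => g (nd j, nd k) - g (x, y)) =
      1 * bern (P y) m (fun k => g (nd j, nd k)) + (- g (x, y)) * 1.
      have := bern_lin (P y) m 1 (- g (x, y)) (fun k => g (nd j, nd k)) (fun=> 1).
      by rewrite bern_cst => <-; congr (bern _ _ _); apply/funext => k; ring.
    under [in RHS]eq_fun do rewrite E.
    have := bern_lin (P x) m 1 (- g (x, y)) (fun j => bern (P y) m (fun k => g (nd j, nd k))) (fun=> 1).
    by rewrite bern_cst => ->; rewrite /T; ring.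
  apply: (@le_trans _ _ (eta / 2 + 2 * B / d' ^+ 2 * (bern (P x) m A + bern (P y) m A'))).
    have -> : eta / 2 + 2 * B / d' ^+ 2 * (bern (P x) m A + bern (P y) m A') =
        bern (P x) m (fun j => bern (P y) m (fun k => eta / 2 + 2 * B / d' ^+ 2 * (A j + A' k))).
      have E j : bern (P y) m (fun k => eta / 2 + 2 * B / d' ^+ 2 * (A j + A' k)) =
        (2 * B / d' ^+ 2) * A j + (eta / 2 + 2 * B / d' ^+ 2 * bern (P y) m A') * 1.
        have -> : (fun k => eta / 2 + 2 * B / d' ^+ 2 * (A j + A' k)) =
           (fun k => (2 * B / d' ^+ 2) * A' k + (eta / 2 + 2 * B / d' ^+ 2 * A j) * 1).
          by apply/funext => k; ring.
        by rewrite bern_lin bern_cst; ring.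
      under [in RHS]eq_fun do rewrite E.
      by rewrite bern_lin bern_cst; ring.
    apply: bern_abs_le => // j jm; apply: bern_abs_le => // k km.
    exact: pt.
  have vx : bern (P x) m A <= m%:R^-1 by apply: bern_sqr_dist.
  have vy : bern (P y) m A' <= m%:R^-1 by apply: bern_sqr_dist.
  rewrite [leRHS](splitr eta) lerD2l; apply: le_trans mbig.
  rewrite [leRHS](_ : _ = 2 * B / d' ^+ 2 * (m%:R^-1 + m%:R^-1)); last by ring.
  by apply: ler_wpM2l => //; exact: lerD.
Qed.

End TrigApprox.

(** * Convergence of characteristic functions implies convergence in law *)

Section Levy.
Variables (R : realType) (I : nat -> finType) (p : forall n, I n -> R)
  (z : forall n, I n -> R * R).
Hypotheses (p_ge0 : forall n i, 0 <= @p n i) (p_sum : forall n, \sum_i @p n i = 1).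
Variable C : R.
Hypothesis p_sqr : forall n, \sum_i @p n i * ((@z n i).1 ^+ 2 + (@z n i).2 ^+ 2) <= C.
Context d (Om : measurableType d) (Q : probability Om R) (W : Om -> R * R).
Hypothesis mW1 : measurable_fun setT (fun o => (W o).1).
Hypothesis mW2 : measurable_fun setT (fun o => (W o).2).
Hypothesis cf : forall th s t : R,
  (\sum_i @p n i * cos (th + s * (@z n i).1 + t * (@z n i).2)) @[n --> \oo] -->
  \int[Q]_o cos (th + s * (W o).1 + t * (W o).2).

Let A n (g : R * R -> R) : R := \sum_i @p n i * g (@z n i).

Let measurable_ctermW q : measurable_fun setT (fun o => cterm q (W o).1 (W o).2).
Proof.
apply: measurable_funM => //; apply: measurableT_comp.
  by apply: continuous_measurable_fun; exact: continuous_cos.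
by apply: measurable_funD; [apply: measurable_funD => //|]; apply: measurable_funM.
Qed.

Lemma integrable_bounded_prob (f : Om -> R) (B : R) : measurable_fun setT f ->
  (forall o, `|f o| <= B) -> Q.-integrable setT (EFin \o f).
Proof.
move=> mf fB; apply: (@le_integrable _ _ _ Q setT measurableT _ (EFin \o cst B)).
- exact/measurable_EFinP.
- by move=> x _ /=; rewrite lee_fin (le_trans (fB x)) // ler_norm.
- exact: finite_measure_integrable_cst.
Qed.

Let integrable_ctermW q : Q.-integrable setT (EFin \o (fun o => cterm q (W o).1 (W o).2)).
Proof.
apply: (@integrable_bounded_prob _ `|q.1.1.1|) => // o.
by rewrite /cterm normrM ler_piMr // cos_abs_le1.
Qed.

Let trig_cvg T : trig T ->
  [/\ measurable_fun setT (fun o => T (W o).1 (W o).2),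
   Q.-integrable setT (EFin \o (fun o => T (W o).1 (W o).2)) &
   A n (fun w => T w.1 w.2) @[n --> \oo] --> \int[Q]_o T (W o).1 (W o).2].
Proof.
move=> [l Hl].
have -> : T = (fun x y => \sum_(q <- l) cterm q x y) by apply/funext => x; apply/funext => y.
elim: l {T Hl} => [|q l [IH1 IH2 IH3]].
  have -> : (fun o => \sum_(q <- [::]) cterm q (W o).1 (W o).2) = cst 0.
    by apply/funext => o; rewrite big_nil.
  split; [exact: measurable_cst | exact: finite_measure_integrable_cst |].
  rewrite [X in _ --> X](_ : _ = 0); last by rewrite /Rintegral integral0.
  rewrite (_ : (fun n => _) = cst 0); first exact: cvg_cst.
  by apply/funext => n; rewrite /A big1 // => i _; rewrite big_nil mulr0.
have -> : (fun o => \sum_(q <- q :: l) cterm q (W o).1 (W o).2) =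
   (fun o => cterm q (W o).1 (W o).2 + \sum_(q <- l) cterm q (W o).1 (W o).2).
  by apply/funext => o; rewrite big_cons.
split.
- exact: measurable_funD.
- have -> : EFin \o (fun o => cterm q (W o).1 (W o).2 + \sum_(q <- l) cterm q (W o).1 (W o).2) =
    ((EFin \o (fun o => cterm q (W o).1 (W o).2)) \+
     (EFin \o (fun o => (\sum_(q <- l) cterm q (W o).1 (W o).2)%R)))%E by [].
  exact: integrableD.
- rewrite RintegralD //.
  rewrite (_ : (fun n => A n _) = (fun n => A n (fun w => cterm q w.1 w.2) + A n (fun w => \sum_(q <- l)
      cterm q w.1 w.2))); last first.
    apply/funext => n; rewrite /A -big_split /=; apply: eq_bigr => i _.
    by rewrite big_cons mulrDr.
  apply: cvgD => //.
  rewrite /cterm RintegralZl //; last first.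
    apply: (@integrable_bounded_prob _ 1); last by move=> o; exact: cos_abs_le1.
    have := measurable_ctermW (1, q.1.1.2, q.1.2, q.2); rewrite /cterm /=.
    by under eq_fun do rewrite mul1r.
  rewrite (_ : (fun n => A n _) = (fun n => q.1.1.1 * A n (fun w => cos (q.1.1.2 + q.1.2 * w.1 + q.2 *
      w.2)))); last first.
    by apply/funext => n; rewrite /A big_distrr /=; apply: eq_bigr => i _; rewrite mulrCA.
  by apply: cvgM; [exact: cvg_cst|exact: cf].
Qed.

(** The bounded second moments provide tightness: outside a large square the error 2 B is paid by
    Chebyshev, uniformly in [n]. On the side of the limit the same trigonometric polynomials are
    handled by dominated convergence. *)
Lemma levy_cvg (g : R * R -> R) (B : R) : continuous g -> (forall w, `|g w| <= B) ->
  Q.-integrable setT (EFin \o (g \o W)) /\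
  (\sum_i @p n i * g (@z n i)) @[n --> \oo] --> \int[Q]_o g (W o).
Proof.
move=> cg gB.
have C0 : 0 <= C.
  apply: le_trans (p_sqr 0%N); apply: sumr_ge0 => i _.
  by rewrite mulr_ge0 // addr_ge0 // sqr_ge0.
have B0 : 0 <= B by rewrite (le_trans _ (gB (0, 0))).
(* The square grows and the accuracy improves with [m], so that [T m] tends to [g] pointwise while
   all [T m] keep the bound [B]. *)
have /choice [T HT] : forall m : nat, exists T, [/\ trig T, forall x y, `|T x y| <= B &
    forall x y, `|x| <= m.+1%:R -> `|y| <= m.+1%:R -> `|T x y - g (x, y)| <= m.+1%:R^-1].
  by move=> m; apply: trig_approx; rewrite // ?invr_gt0 ltr0n.
have Tpt x y : T m x y @[m --> \oo] --> g (x, y).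
  apply/cvgrPdist_le => e e0; near=> m.
  rewrite distrC; have [_ _ H] := HT m; apply: le_trans (H x y _ _) _.
  - have : `|x| < m%:R by near: m; exact: nbhs_infty_gtr.
    by move=> /ltW/le_trans; apply; rewrite ler_nat.
  - have : `|y| < m%:R by near: m; exact: nbhs_infty_gtr.
    by move=> /ltW/le_trans; apply; rewrite ler_nat.
  - have : e^-1 < m%:R by near: m; exact: nbhs_infty_gtr.
    move=> H1; rewrite invf_ple ?posrE ?ltr0n //.
    by apply: le_trans (ltW H1) _; rewrite ler_nat.
have mT m : measurable_fun setT (fun o => T m (W o).1 (W o).2).
  by have [tT _ _] := HT m; have [] := trig_cvg tT.
have Tpt' o : setT o -> (T m (W o).1 (W o).2)%:E @[m --> \oo] --> (EFin \o (g \o W)) o.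
  move=> _; apply/fine_cvgP; split; first exact: nearW.
  by rewrite /= [X in g X]surjective_pairing; exact: Tpt.
(* Measurability of [g] after [W] is inherited from the pointwise limit, for each [T m] is a finite
   sum of cosines of the measurable coordinates. *)
have mgW : measurable_fun setT (EFin \o (g \o W)).
  apply: (emeasurable_fun_cvg (fun m o => (T m (W o).1 (W o).2)%:E)) => // m.
  exact/measurable_EFinP.
have [igW _ cvT0] := @dominated_convergence _ _ _ Q setT measurableT
  (fun m o => (T m (W o).1 (W o).2)%:E) (EFin \o (g \o W)) (EFin \o cst B)
  (fun m => (measurable_EFinP _ _).2 (mT m)) mgW (aeW _ Tpt')
  (finite_measure_integrable_cst _ _ measurableT)
  (aeW _ (fun o m _ => let: And3 _ H _ := HT m in H (W o).1 (W o).2)).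
split => //.
have cvT : \int[Q]_o T m (W o).1 (W o).2 @[m --> \oo] --> \int[Q]_o g (W o).
  by apply: fine_cvg; rewrite fineK //; exact: integrable_fin_num igW.
(* The constant does not depend on [n], so [m] can be fixed before [n] goes to infinity. *)
have unif m n : `|A n (fun w => T m w.1 w.2) - A n g| <= (1 + 2 * B * C) * m.+1%:R^-1.
  have m0 : 0 < m.+1%:R :> R by rewrite ltr0n.
  have [_ TB Tg] := HT m.
  have pt w : `|T m w.1 w.2 - g w| <= m.+1%:R^-1 + 2 * B / m.+1%:R ^+ 2 * (w.1 ^+ 2 + w.2 ^+ 2).
    have c0 : 0 <= 2 * B / m.+1%:R ^+ 2 by rewrite divr_ge0 ?sqr_ge0 ?mulr_ge0.
    have far : m.+1%:R ^+ 2 <= w.1 ^+ 2 + w.2 ^+ 2 ->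
       `|T m w.1 w.2 - g w| <= m.+1%:R^-1 + 2 * B / m.+1%:R ^+ 2 * (w.1 ^+ 2 + w.2 ^+ 2).
      move=> H; apply: (@le_trans _ _ (2 * B)).
        by rewrite (le_trans (ler_normB _ _)) // mulr_natl mulr2n lerD.
      apply: (@le_trans _ _ (2 * B / m.+1%:R ^+ 2 * (w.1 ^+ 2 + w.2 ^+ 2))).
        rewrite -{1}[2 * B](divfK (lt0r_neq0 (exprn_gt0 2 m0))).
        exact: ler_wpM2l.
      by rewrite lerDr invr_ge0 ltW.
    have [lx|lx] := leP `|w.1| m.+1%:R; last first.
      apply: far; rewrite -[m.+1%:R ^+ 2]addr0; apply: lerD; last exact: sqr_ge0.
      by rewrite -(real_normK (num_real w.1)) ler_sqr ?nnegrE // ltW.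
    have [ly|ly] := leP `|w.2| m.+1%:R; last first.
      apply: far; rewrite -[m.+1%:R ^+ 2]add0r; apply: lerD; first exact: sqr_ge0.
      by rewrite -(real_normK (num_real w.2)) ler_sqr ?nnegrE // ltW.
    apply: (@le_trans _ _ m.+1%:R^-1); last first.
      by rewrite lerDl mulr_ge0 // addr_ge0 // sqr_ge0.
    by rewrite [w in g w]surjective_pairing; exact: Tg.
  rewrite /A -sumrB; apply: (le_trans (ler_norm_sum _ _ _)).
  apply: (@le_trans _ _ (\sum_i @p n i * (m.+1%:R^-1 + 2 * B / m.+1%:R ^+ 2 * ((@z n i).1 ^+ 2 + (@z n
      i).2 ^+ 2)))).
    apply: ler_sum => i _; rewrite -mulrBr normrM (ger0_norm (p_ge0 _)).
    by apply: ler_wpM2l.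
  rewrite (_ : \sum_i _ = (\sum_i @p n i) * m.+1%:R^-1 + 2 * B / m.+1%:R ^+ 2 * \sum_i @p n i * ((@z n
      i).1 ^+ 2 + (@z n i).2 ^+ 2)); last first.
    rewrite big_distrl big_distrr -big_split /=; apply: eq_bigr => i _.
    by rewrite mulrDr mulrCA.
  rewrite p_sum mul1r [leRHS](_ : _ = m.+1%:R^-1 + 2 * B * C * m.+1%:R^-1); last by ring.
  rewrite lerD2l.
  apply: (@le_trans _ _ (2 * B / m.+1%:R ^+ 2 * C)).
    by apply: ler_wpM2l => //; rewrite divr_ge0 ?sqr_ge0 ?mulr_ge0.
  rewrite mulrAC; apply: ler_wpM2l; first by rewrite !mulr_ge0.
  by rewrite lef_pV2 ?posrE ?exprn_gt0 // -[leLHS]expr1 ler_weXn2l // ler1n.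
apply/cvgrPdist_le => e e0.
have e4 : 0 < e / 4 by rewrite divr_gt0.
have K0 : 0 <= 1 + 2 * B * C by rewrite addr_ge0 // !mulr_ge0.
have [m [Hm1 Hm2]] : exists m, `|\int[Q]_o g (W o) - \int[Q]_o T m (W o).1 (W o).2| <= e / 4 /\
   (1 + 2 * B * C) * m.+1%:R^-1 <= e / 4.
  near \oo => m; exists m; split.
    near: m; by move/cvgrPdist_le : cvT => /(_ _ e4).
  rewrite ler_pdivrMr ?ltr0n // [leRHS]mulrC -ler_pdivrMr //.
  have : (1 + 2 * B * C) / (e / 4) < m%:R by near: m; exact: nbhs_infty_gtr.
  by move=> /ltW/le_trans; apply; rewrite ler_nat.
have [tT _ _] := HT m; have [_ _ cT] := trig_cvg tT.
near=> n.
have Hn : `|\int[Q]_o T m (W o).1 (W o).2 - A n (fun w => T m w.1 w.2)| <= e / 4.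
  by near: n; move/cvgrPdist_le : cT; apply.
have Hu := le_trans (unif m n) Hm2.
rewrite -[\sum_i _]/(A n g).
set X := \int[Q]_o g (W o) in Hm1 *; set Y := \int[Q]_o _ in Hm1 Hn.
have -> : X - A n g = (X - Y) + (Y - A n (fun w => T m w.1 w.2)) + (A n (fun w => T m w.1 w.2) - A n g) by ring.
apply: (le_trans (ler_normD _ _)); apply: (le_trans (lerD (ler_normD _ _) (lexx _))).
apply: (le_trans (lerD (lerD Hm1 Hn) Hu)).
by move: (ltW e0) => e0'; lra.
Unshelve. all: by end_near. Qed.

End Levy.

(** * Taylor estimates *)

Section Taylor.
Variable R : realType.

Lemma mvt_bound (f g : R -> R) (M y : R) :
  (forall x : R, is_derive x 1 f (g x)) -> f 0 = 0 ->
  (forall c, `|c| <= `|y| -> `|g c| <= M) -> `|f y| <= M * `|y|.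
Proof.
move=> fg f0 gM.
have cf a b : {within `[a, b], continuous f}.
  apply: continuous_subspaceT => x.
  by apply: differentiable_continuous; apply/derivable1_diffP; have [] := fg x.
have [y0|y0] := leP 0 y.
  have [c] := @MVT_segment R f g 0 y y0 (fun x _ => fg x) (cf _ _).
  rewrite in_itv /= f0 !subr0 => /andP[c0 cy] ->; rewrite normrM ler_wpM2r //.
  by apply: gM; rewrite !ger0_norm.
have [c] := @MVT_segment R f g y 0 (ltW y0) (fun x _ => fg x) (cf _ _).
rewrite in_itv /= f0 !sub0r => /andP[cy c0] E.
rewrite -normrN E normrM normrN ler_wpM2r //.
by apply: gM; rewrite !ler0_norm ?lerN2 // ltW.
Qed.

(** [mvt_bound] is used three times, each remainder being the derivative of the next one. Only the
    power of |y| matters later, so the factor 1/6 is given up. *)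
Lemma exp_taylor (y : R) : `|expR y - (1 + y + y ^+ 2 / 2)| <= expR `|y| * `|y| ^+ 3.
Proof.
have e_le c : `|c| <= `|y| -> `|expR c| <= expR `|y|.
  by move=> H; rewrite ger0_norm ?expR_ge0 // ler_expR (le_trans (ler_norm _)).
have h0 c : `|c| <= `|y| -> `|expR c - 1| <= expR `|y| * `|y|.
  move=> H; apply: le_trans (ler_wpM2l (expR_ge0 _) H).
  apply: (@mvt_bound (fun x => expR x - 1) expR) => [x||c' H']; last first.
  - by apply: e_le; apply: le_trans H.
  - by rewrite expR0 subrr.
  - by apply: is_derive_eq; rewrite subr0.
have h1 c : `|c| <= `|y| -> `|expR c - (1 + c)| <= expR `|y| * `|y| * `|y|.
  move=> H; apply: (@le_trans _ _ (expR `|y| * `|y| * `|c|)); last first.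
    by apply: ler_wpM2l => //; rewrite mulr_ge0 ?expR_ge0.
  apply: (@mvt_bound (fun x => expR x - (1 + x)) (fun x => expR x - 1)) => [x||c' H']; last first.
  - by apply: h0; apply: le_trans H.
  - by rewrite expR0 addr0 subrr.
  - by apply: is_derive_eq; rewrite add0r.
rewrite (exprSr `|y| 2) (expr2 `|y|) !mulrA.
apply: (@mvt_bound (fun x => expR x - (1 + x + x ^+ 2 / 2)) (fun x => expR x - (1 + x))) => [x||c' H'].
- by apply: is_derive_eq; rewrite /GRing.scale /=; field.
- by rewrite expR0 expr0n /= mul0r !addr0 subrr.
- by apply: h1.
Qed.

Lemma cos_taylor (p y : R) :
  `|cos (p + y) - (cos p - y * sin p - y ^+ 2 / 2 * cos p)| <= `|y| ^+ 3.
Proof.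
have h0 c : `|c| <= `|y| -> `|- cos (p + c) + cos p| <= `|y|.
  move=> H; apply: le_trans H; rewrite -[leRHS]mul1r.
  apply: (@mvt_bound (fun x => - cos (p + x) + cos p) (fun x => sin (p + x))) => [x||c' H'].
  - have D : is_derive (x : R) 1 (fun x : R => p + x) (1 : R).
      by apply: is_derive_eq; ring.
    have D2 := @is_derive1_comp R cos (fun x => p + x) x _ _ (is_derive_cos _) D.
    by apply: is_derive_eq; ring.
  - by rewrite addr0 addNr.
  - by rewrite ler_norml sin_geN1 sin_le1.
have h1 c : `|c| <= `|y| -> `|- sin (p + c) + sin p + c * cos p| <= `|y| * `|y|.
  move=> H; apply: (@le_trans _ _ (`|y| * `|c|)); last by apply: ler_wpM2l.
  apply: (@mvt_bound (fun x => - sin (p + x) + sin p + x * cos p) (fun x => - cos (p + x) + cos p)) => [x||c' H'].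
  - have D : is_derive (x : R) 1 (fun x : R => p + x) (1 : R).
      by apply: is_derive_eq; ring.
    have D2 := @is_derive1_comp R sin (fun x => p + x) x _ _ (is_derive_sin _) D.
    by apply: is_derive_eq; rewrite /GRing.scale /=; ring.
  - by rewrite addr0 addNr mul0r addr0.
  - by apply: h0; apply: le_trans H.
rewrite (exprSr `|y| 2) (expr2 `|y|).
apply: (@mvt_bound (fun x => cos (p + x) - (cos p - x * sin p - x ^+ 2 / 2 * cos p))
  (fun x => - sin (p + x) + sin p + x * cos p)) => [x||c' H'].
- have D : is_derive (x : R) 1 (fun x : R => p + x) (1 : R).
    by apply: is_derive_eq; ring.
  have D2 := @is_derive1_comp R cos (fun x => p + x) x _ _ (is_derive_cos _) D.
  by apply: is_derive_eq; rewrite /GRing.scale /=; field.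
- by rewrite addr0 expr0n /= !mul0r !subr0 subrr.
- exact: h1.
Qed.

End Taylor.

(** * Explicit remainder estimates and comparison of coefficients *)

Section BigO.
Variable R : realType.
Implicit Types f g : R -> R.

(** An explicit constant on the whole interval [-1, 1] instead of a filter: finite families then
    have a common constant, and the bound may be evaluated at r = 1 / sqrt k. *)
Definition bigO k f : Prop := exists2 C : R, 0 <= C & forall r, `|r| <= 1 -> `|f r| <= C * `|r| ^+ k.

Lemma bigO_ext k f g : f =1 g -> bigO k f -> bigO k g.
Proof. by move=> E [C C0 H]; exists C => // r r1; rewrite -E; exact: H. Qed.

Lemma bigOD k f g : bigO k f -> bigO k g -> bigO k (fun r => f r + g r).
Proof.
move=> [C C0 H] [C' C'0 H']; exists (C + C') => [|r r1]; first exact: addr_ge0.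
by rewrite mulrDl (le_trans (ler_normD _ _)) // lerD ?H ?H'.
Qed.

Lemma bigOM k k' f g : bigO k f -> bigO k' g -> bigO (k + k') (fun r => f r * g r).
Proof.
move=> [C C0 H] [C' C'0 H']; exists (C * C') => [|r r1]; first exact: mulr_ge0.
by rewrite exprD normrM mulrACA ler_pM ?H ?H'.
Qed.

Lemma bigO_cst (c : R) : bigO 0 (fun=> c).
Proof. by exists `|c| => // r _; rewrite expr0 mulr1. Qed.

Lemma bigO_id : bigO 1 (fun r => r).
Proof. by exists 1 => // r _; rewrite expr1 mul1r. Qed.

Lemma bigOX k : bigO k (fun r => r ^+ k).
Proof. by exists 1 => // r _; rewrite normrX mul1r. Qed.

Lemma bigO_weak k k' f : (k <= k')%N -> bigO k' f -> bigO k f.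
Proof.
move=> kk' [C C0 H]; exists C => // r r1; apply: (le_trans (H r r1)).
by apply: ler_wpM2l => //; apply: ler_wiXn2l.
Qed.

Lemma bigOZ k (c : R) f : bigO k f -> bigO k (fun r => c * f r).
Proof. exact: bigOM (bigO_cst c). Qed.

Lemma bigO_sum (I : Type) (s : seq I) (P : pred I) k (F : I -> R -> R) :
  (forall i, bigO k (F i)) -> bigO k (fun r => \sum_(i <- s | P i) F i r).
Proof.
move=> H; elim: s => [|i s IH].
  by exists 0 => // r _; rewrite big_nil normr0 mul0r.
case E: (P i).
  by apply: bigO_ext (bigOD (H i) IH) => r; rewrite big_cons E.
by apply: bigO_ext IH => r; rewrite big_cons E.
Qed.

Lemma bigO_prod0 (I : Type) (s : seq I) (P : pred I) (F : I -> R -> R) :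
  (forall i, bigO 0 (F i)) -> bigO 0 (fun r => \prod_(i <- s | P i) F i r).
Proof.
move=> H; elim: s => [|i s IH].
  by apply: bigO_ext (bigO_cst 1) => r; rewrite big_nil.
case E: (P i).
  by apply: bigO_ext (bigOM (H i) IH) => r; rewrite big_cons E.
by apply: bigO_ext IH => r; rewrite big_cons E.
Qed.

Lemma bigO_det n (A : R -> 'M[R]_n) : (forall i j, bigO 0 (fun r => A r i j)) ->
  bigO 0 (fun r => \det (A r)).
Proof.
move=> H; rewrite /determinant; apply: bigO_sum => s.
by apply: bigOZ; apply: bigO_prod0 => i.
Qed.

(** Second-order expansion at y = a r + b r^2; the square y^2 / 2 contributes a^2 / 2 to the
    coefficient of r^2, and the rest of it is a multiple of r^3. *)
Lemma bigO_exp (a b : R) :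
  bigO 3 (fun r => expR (a * r + b * r ^+ 2) - (1 + a * r + (b + a ^+ 2 / 2) * r ^+ 2)).
Proof.
pose y r := a * r + b * r ^+ 2.
have h1 : bigO 3 (fun r => expR (y r) - (1 + y r + y r ^+ 2 / 2)).
  have yC r : `|r| <= 1 -> `|y r| <= (`|a| + `|b|) * `|r|.
    move=> r1; rewrite /y (le_trans (ler_normD _ _)) // (normrM a) (normrM b) mulrDl lerD2l ler_wpM2l //.
    by rewrite normrX expr2 ler_piMl.
  exists (expR (`|a| + `|b|) * (`|a| + `|b|) ^+ 3) => [|r r1].
    by rewrite mulr_ge0 ?expR_ge0 // exprn_ge0 // addr_ge0.
  apply: (le_trans (exp_taylor _)); rewrite -mulrA -exprMn; apply: ler_pM.
  - exact: expR_ge0.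
  - exact: exprn_ge0.
  - rewrite ler_expR (le_trans (yC r r1)) // ler_piMr //; exact: addr_ge0.
  - apply: lerXn2r; rewrite ?nnegrE ?mulr_ge0 ?addr_ge0 //; exact: yC.
have h2 : bigO 3 (fun r => (a * b + b ^+ 2 / 2 * r) * r ^+ 3).
  apply: (@bigOM 0 3); last exact: bigOX.
  apply: bigOD; first exact: bigO_cst.
  apply: bigO_weak (bigOZ (b ^+ 2 / 2) bigO_id) => //.
by apply: bigO_ext (bigOD h1 h2) => r; rewrite /y; field.
Qed.

Lemma small_eq0 (B M : R) : (forall r, 0 < r -> r <= 1 -> `|B| <= M * r) -> B = 0.
Proof.
move=> H; apply/eqP; rewrite -normr_eq0; apply/eqP/le_anti; rewrite normr_ge0 andbT.
have M0 : 0 <= M by have := H 1 ltr01 (lexx _); rewrite mulr1; apply: le_trans.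
rewrite leNgt; apply/negP => B0.
pose r := Num.min 1 (`|B| / (2 * (M + 1))).
have M1 : 0 < 2 * (M + 1) by lra.
have r0 : 0 < r by rewrite lt_min ltr01 divr_gt0.
have r1 : r <= 1 by rewrite ge_min lexx.
have r2 : r <= `|B| / (2 * (M + 1)) by rewrite ge_min lexx orbT.
have := H r r0 r1; apply/negP; rewrite -ltNge.
apply: (le_lt_trans (ler_wpM2l M0 r2)).
rewrite mulrA ltr_pdivrMr // mulrC ltr_pM2l //; lra.
Qed.

Lemma bigO3_coef (A B D : R) : bigO 3 (fun r => A + B * r + D * r ^+ 2) ->
  [/\ A = 0, B = 0 & D = 0].
Proof.
move=> [C C0 H].
have A0 : A = 0.
  have := H 0; rewrite normr0 !expr0n /= !mulr0 !addr0 => /(_ ler01).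
  by rewrite normr_le0 => /eqP.
have B0 : B = 0.
  apply: (@small_eq0 _ (C + `|D|)) => r r0 r1.
  have := H r; rewrite (gtr0_norm r0) A0 => /(_ r1) H1.
  have : `|B| * r <= (C + `|D|) * r * r.
    have -> : `|B| * r = `|(0 + B * r + D * r ^+ 2) - D * r ^+ 2|.
      by rewrite add0r addrK normrM (gtr0_norm r0).
    apply: (le_trans (ler_normB _ _)).
    rewrite [leRHS](_ : _ = C * r ^+ 2 + `|D| * r ^+ 2); last by ring.
    apply: lerD; last by rewrite normrM normrX (gtr0_norm r0).
    apply: (le_trans H1); apply: ler_wpM2l => //.
    by apply: ler_wiXn2l => //; exact: ltW.
  by rewrite ler_pM2r.
split => //.
apply: (@small_eq0 _ C) => r r0 r1.
have := H r; rewrite (gtr0_norm r0) A0 B0 mul0r !add0r => /(_ r1).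
rewrite normrM normrX (gtr0_norm r0) => H1.
by rewrite -(ler_pM2r (exprn_gt0 2 r0)) -mulrA -exprS.
Qed.

End BigO.

(** * The Poisson equation of a finite Markov chain *)

Section Avg.
Variables (R : realType) (L : finType).
Implicit Types f g : L -> R.

Definition avg f : R := #|L|%:R^-1 * \sum_l f l.

Lemma avgD f g : avg (fun l => f l + g l) = avg f + avg g.
Proof. by rewrite /avg big_split mulrDr. Qed.

Lemma avgZ c f : avg (fun l => c * f l) = c * avg f.
Proof. by rewrite /avg -big_distrr mulrCA. Qed.

Lemma avgB f g : avg (fun l => f l - g l) = avg f - avg g.
Proof. by rewrite /avg sumrB mulrBr. Qed.

Lemma eq_avg f g : f =1 g -> avg f = avg g.
Proof. by move=> E; rewrite /avg; congr (_ * _); apply: eq_bigr => l _. Qed.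

Lemma avg_le f g : (forall l, f l <= g l) -> avg f <= avg g.
Proof.
by move=> H; rewrite /avg ler_wpM2l ?invr_ge0 ?ler0n //; apply: ler_sum => l _.
Qed.

Lemma avg_norm f : `|avg f| <= avg (fun l => `|f l|).
Proof.
rewrite /avg normrM ger0_norm ?invr_ge0 ?ler0n // ler_wpM2l ?invr_ge0 ?ler0n //.
exact: ler_norm_sum.
Qed.

Lemma avg_sum (I : finType) (F : I -> L -> R) :
  avg (fun l => \sum_i F i l) = \sum_i avg (F i).
Proof. by rewrite /avg exchange_big /= -big_distrr. Qed.

Hypothesis L_gt0 : (0 < #|L|)%N.

Lemma avg_cst c : avg (fun=> c) = c.
Proof.
rewrite /avg sumr_const -[c *+ _]mulr_natl mulKf // pnatr_eq0 -lt0n.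
by rewrite (eq_card (_ : _ =i L)).
Qed.

Lemma avg_max f M : (forall l, f l <= M) -> M <= avg f -> forall l, f l = M.
Proof.
move=> fM Mf l; apply/eqP; rewrite eq_sym -subr_eq0; apply/eqP.
have H : \sum_l (M - f l) = 0.
  apply/eqP; rewrite eq_le sumr_ge0 ?andbT => [|i _]; last by rewrite subr_ge0.
  have : avg (fun l => M - f l) <= 0 by rewrite avgB avg_cst subr_le0.
  by rewrite /avg pmulr_rle0 // invr_gt0 ltr0n.
have := psumr_eq0P _ H; apply => // i _.
by rewrite subr_ge0.
Qed.

End Avg.

Section Chain.
Variables (R : realType) (L : finType) (n : nat).
Variables (nx : 'I_n -> L -> 'I_n) (t : 'I_n).
Hypothesis L_gt0 : (0 < #|L|)%N.

Definition chain_step : rel 'I_n := fun i j => [exists l, nx i l == j].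

Hypothesis t_reach : forall i, connect chain_step i t.

Implicit Types u h g : 'I_n -> R.

(** Maximum principle: an average that attains the maximum has all its terms maximal, so the maximum
    propagates along every transition and arrives at [t]. *)
Lemma subharmonic_le u : (forall i, u i <= avg (fun l => u (nx i l))) -> forall i, u i <= u t.
Proof.
move=> H.
have [m _ Hm] := @arg_maxP _ _ _ t xpredT u isT.
have closed i j : connect chain_step i j -> u i = u m -> u j = u m.
  move=> /connectP [p]; elim: p i => [|k p IH] i /=; first by move=> _ ->.
  move=> /andP[/existsP [l /eqP <-] pp] jE ui; apply: (IH (nx i l)) => //.
  apply: (avg_max L_gt0 (f := fun l => u (nx i l))) => [l'|]; first exact: Hm.
  by rewrite -ui.
by move=> i; rewrite (closed m t) //; exact: Hm.
Qed.

Lemma harmonic_const u : (forall i, avg (fun l => u (nx i l)) = u i) -> forall i, u i = u t.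
Proof.
move=> H i; apply: le_anti; rewrite subharmonic_le => [|j]; last by rewrite H.
rewrite /= -lerN2; apply: (@subharmonic_le (fun i => - u i)) => j.
rewrite (_ : avg _ = - avg (fun l => u (nx j l))) ?H //.
by rewrite -(H j) -[RHS]mulN1r -avgZ; apply: eq_avg => l; rewrite mulN1r.
Qed.

Lemma exists_avg_le u : exists i, u i <= avg (fun l => u (nx i l)).
Proof.
have [m _ Hm] := @arg_minP _ _ _ t xpredT u isT.
exists m; rewrite -[leLHS](avg_cst L_gt0); apply: avg_le => l; exact: Hm.
Qed.

Lemma exists_avg_ge u : exists i, avg (fun l => u (nx i l)) <= u i.
Proof.
have [m _ Hm] := @arg_maxP _ _ _ t xpredT u isT.
exists m; rewrite -[leRHS](avg_cst L_gt0); apply: avg_le => l; exact: Hm.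
Qed.

(** The constant is nonnegative at a minimum of [u] and nonpositive at a maximum. *)
Lemma poisson_cst_eq0 u c : (forall i, avg (fun l => u (nx i l)) - u i = c) -> c = 0.
Proof.
move=> H; apply: le_anti; apply/andP; split.
  by have [i] := exists_avg_ge u; rewrite -subr_le0 H.
by have [i] := exists_avg_le u; rewrite -subr_ge0 H.
Qed.

Definition trans_avg_mx : 'M[R]_n := \matrix_(i, j) avg (fun l => (nx i l == j)%:R).

Lemma sum_trans_avg i u : \sum_j trans_avg_mx i j * u j = avg (fun l => u (nx i l)).
Proof.
under eq_bigr do rewrite mxE mulrC -avgZ.
rewrite -avg_sum; apply: eq_avg => l.
rewrite (bigD1 (nx i l)) //= eqxx mulr1 big1 ?addr0 // => j.
by rewrite eq_sym => /negbTE ->; rewrite mulr0.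
Qed.

(* The ones in column [t] make room for the unknown constant of the Poisson
   equation, whose solution is normalized by [h t = 0]. *)
Definition bordered_mx (z : R) : 'M[R]_n :=
  \matrix_(i, j) (if j == t then 1 else (i == j)%:R - z * trans_avg_mx i j).

Lemma bordered_mxE z (w : 'I_n -> R) i (w' := fun j => if j == t then 0 else w j) :
  \sum_j bordered_mx z i j * w j = w t + w' i - z * avg (fun l => w' (nx i l)).
Proof.
rewrite -sum_trans_avg (bigD1 t) //= [\sum_j trans_avg_mx i j * _](bigD1 t) //= {2}/w' eqxx mulr0 add0r.
rewrite !mxE eqxx mul1r -addrA; congr (_ + _).
have -> : w' i = \sum_(j | j != t) (i == j)%:R * w j.
  rewrite /w'; case: eqP => [->|/eqP it].
    by rewrite big1 // => j /negbTE; rewrite eq_sym => ->; rewrite mul0r.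
  rewrite (bigD1 i) //= eqxx mul1r big1 ?addr0 // => j /andP[_].
  by rewrite eq_sym => /negbTE ->; rewrite mul0r.
rewrite big_distrr /= -sumrB; apply: eq_bigr => j /negbTE jt.
by rewrite !mxE /w' jt; ring.
Qed.

(** A kernel vector solves the Poisson equation with right-hand side 0. Its entry at [t] is the
    constant and vanishes by [poisson_cst_eq0]; the others then form a harmonic function that is 0
    at [t], hence 0 everywhere. *)
Lemma bordered_unit : bordered_mx 1 \in unitmx.
Proof.
rewrite unitmxE unitfE -det_tr; apply/det0P => -[v v0 vA].
case/negP: v0; apply/eqP/rowP => k; rewrite mxE.
pose w j := v 0 j; pose w' j := if j == t then 0 else w j.
have H i : w t + w' i - avg (fun l => w' (nx i l)) = 0.
  rewrite -[avg _]mul1r -bordered_mxE.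
  have := congr1 (fun M : 'rV_n => M 0 i) vA; rewrite mxE [RHS]mxE => E.
  rewrite -[RHS]E; apply: eq_bigr => j _.
  by rewrite [(_^T) _ _]mxE mulrC.
have wt : w t = 0.
  apply: (@poisson_cst_eq0 w') => i; have := H i; lra.
have Hc := @harmonic_const w' (fun i => _).
have {}Hc i : w' i = 0.
  have -> : w' i = w' t.
    by apply: Hc => j; have := H j; rewrite wt add0r => /eqP; rewrite subr_eq0 => /eqP.
  by rewrite /w' eqxx.
have := Hc k; rewrite /w' /w; case: eqP => // -> _; exact: wt.
Qed.

Lemma poisson_solvable g : exists e h, forall i, g i = e + h i - avg (fun l => h (nx i l)).
Proof.
pose w : 'cV[R]_n := invmx (bordered_mx 1) *m \col_i g i.
(* Entry [t] of the solution holds the constant [e], the remaining entries hold [h]. *)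
exists (w t 0), (fun j => if j == t then 0 else w j 0) => i.
rewrite -[avg _]mul1r -(bordered_mxE 1 (fun j => w j 0)).
have : bordered_mx 1 *m w = \col_i g i by rewrite mulKVmx // bordered_unit.
by move=> /colP /(_ i); rewrite !mxE.
Qed.

(** Multiplication by [U] adds all columns to column [t]. The rows of the transition matrix sum to
    1, so this column becomes constantly 1 - z, and the factor comes out. It exhibits the zero of
    the characteristic determinant at z = 1. *)
Lemma det_trans_avg (z : R) (U : 'M[R]_n := \matrix_(i, j) (if j == t then 1 else (i == j)%:R)) :
  \det (1%:M - z *: trans_avg_mx) * \det U = \det (bordered_mx z) * (1 - z).
Proof.
have dD : \det (diag_mx (\row_j (if j == t then 1 - z else 1))) = 1 - z.
  rewrite det_diag (bigD1 t) //= mxE eqxx big1 ?mulr1 // => j /negbTE jt.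
  by rewrite mxE jt.
rewrite -{1}dD -!det_mulmx; congr (\det _); apply/matrixP => i j.
rewrite mul_mx_diag !mxE; case: (eqVneq j t) => [->|jt].
  rewrite mul1r; under eq_bigr do rewrite !mxE eqxx mulr1.
  rewrite sumrB -[X in _ - X]big_distrr /=.
  have -> : \sum_(k < n) avg (fun l => ((nx i l == k)%:R : R)) = 1.
    have := sum_trans_avg i (fun=> 1); rewrite avg_cst // => E.
    by rewrite -[RHS]E; apply: eq_bigr => k _; rewrite mxE mulr1.
  rewrite mulr1; congr (_ - _); rewrite (bigD1 i) //= eqxx big1 ?addr0 // => k.
  by rewrite eq_sym => /negbTE ->.
rewrite mulr1 (bigD1 j) //= !mxE (negbTE jt) eqxx mulr1 big1 ?addr0 // => k kj.
by rewrite !mxE (negbTE jt) (negbTE kj) mulr0.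
Qed.

End Chain.

(** * Generalized polynomials *)

Section GeneralizedPolynomials.
Variable R : realType.
Notation monom := (R * R * R * nat)%type.
Implicit Types (l : seq monom) (F G : R -> R -> R -> R).

(** A monomial lists its coefficient, the real exponents of [x] and [y], and the natural exponent of
    [z]. *)
Definition gpev l (x y z : R) : R :=
  \sum_(q <- l) q.1.1.1 * x `^ q.1.1.2 * y `^ q.1.2 * z ^+ q.2.

(** Positivity of [x] and [y] is what makes real exponents add and differentiate properly; partial
    derivatives at (1, 1, 1) only see such points. *)
Definition gp l F := forall x y z, 0 < x -> 0 < y -> F x y z = gpev l x y z.

Definition isgp F := exists l, gp l F.

Lemma isgp_ext F G : (forall x y z, 0 < x -> 0 < y -> F x y z = G x y z) -> isgp F -> isgp G.
Proof. by move=> E [l H]; exists l => x y z x0 y0; rewrite -E // H. Qed.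

Lemma isgp_monom (c a b : R) k : isgp (fun x y z => c * x `^ a * y `^ b * z ^+ k).
Proof. by exists [:: (c, a, b, k)] => x y z _ _; rewrite /gpev big_seq1. Qed.

Lemma isgp_cst c : isgp (fun _ _ _ => c).
Proof.
by apply: isgp_ext (isgp_monom c 0 0 0) => x y z _ _; rewrite !powRr0 expr0 !mulr1.
Qed.

Lemma isgp_z : isgp (fun _ _ z => z).
Proof.
by apply: isgp_ext (isgp_monom 1 0 0 1) => x y z _ _; rewrite !powRr0 expr1 !mulr1 mul1r.
Qed.

Lemma isgpD F G : isgp F -> isgp G -> isgp (fun x y z => F x y z + G x y z).
Proof.
move=> [l H] [l' H']; exists (l ++ l') => x y z x0 y0.
by rewrite /gpev big_cat /= H // H'.
Qed.

Lemma isgpM F G : isgp F -> isgp G -> isgp (fun x y z => F x y z * G x y z).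
Proof.
move=> [l H] [l' H'].
exists [seq (q.1.1.1 * q'.1.1.1, q.1.1.2 + q'.1.1.2, q.1.2 + q'.1.2, (q.2 + q'.2)%N) | q <- l, q' <- l'].
move=> x y z x0 y0; rewrite /gpev big_allpairs_dep /= H // H' // /gpev big_distrl /=.
apply: eq_bigr => q _; rewrite big_distrr /=; apply: eq_bigr => q' _.
rewrite !powRD ?exprD; last 2 first.
- by rewrite (gt_eqF y0) implybT.
- by rewrite (gt_eqF x0) implybT.
ring.
Qed.

Lemma isgp_sum (I : Type) (s : seq I) (P : pred I) (F : I -> R -> R -> R -> R) :
  (forall i, isgp (F i)) -> isgp (fun x y z => \sum_(i <- s | P i) F i x y z).
Proof.
move=> H; elim: s => [|i s IH].
  by apply: isgp_ext (isgp_cst 0) => x y z _ _; rewrite big_nil.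
case E: (P i).
  by apply: isgp_ext (isgpD (H i) IH) => x y z _ _; rewrite big_cons E.
by apply: isgp_ext IH => x y z _ _; rewrite big_cons E.
Qed.

Lemma isgp_prod (I : Type) (s : seq I) (P : pred I) (F : I -> R -> R -> R -> R) :
  (forall i, isgp (F i)) -> isgp (fun x y z => \prod_(i <- s | P i) F i x y z).
Proof.
move=> H; elim: s => [|i s IH].
  by apply: isgp_ext (isgp_cst 1) => x y z _ _; rewrite big_nil.
case E: (P i).
  by apply: isgp_ext (isgpM (H i) IH) => x y z _ _; rewrite big_cons E.
by apply: isgp_ext IH => x y z _ _; rewrite big_cons E.
Qed.

Lemma isgp_det n (A : R -> R -> R -> 'M[R]_n) :
  (forall i j, isgp (fun x y z => A x y z i j)) -> isgp (fun x y z => \det (A x y z)).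
Proof.
move=> H; rewrite /determinant; apply: isgp_sum => s.
by apply: isgpM; [exact: isgp_cst | apply: isgp_prod => i].
Qed.

Definition gpdx (q : monom) : monom := (q.1.1.1 * q.1.1.2, q.1.1.2 - 1, q.1.2, q.2).
Definition gpdy (q : monom) : monom := (q.1.1.1 * q.1.2, q.1.1.2, q.1.2 - 1, q.2).
(** For exponent 0 the predecessor is again 0, harmlessly, since the coefficient becomes 0. *)
Definition gpdz (q : monom) : monom := (q.1.1.1 * q.2%:R, q.1.1.2, q.1.2, q.2.-1).

Lemma derive1_sum (I : Type) (s : seq I) (f : I -> R -> R) (df : I -> R) (x : R) :
  (forall i, is_derive x 1 (f i) (df i)) ->
  is_derive x 1 (fun u => \sum_(i <- s) f i u) (\sum_(i <- s) df i).
Proof.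
move=> H; elim: s => [|i s IH].
  rewrite big_nil (_ : (fun u => _) = cst 0); first exact: is_derive_cst.
  by apply/funext => u; rewrite big_nil.
rewrite big_cons (_ : (fun u => _) = (fun u => f i u + \sum_(i <- s) f i u)); last first.
  by apply/funext => u; rewrite big_cons.
exact: is_deriveD.
Qed.

Lemma gp_is_derive_x l F (x y z : R) : gp l F -> 0 < x -> 0 < y ->
  is_derive x 1 (fun u : R => F u y z) (gpev (map gpdx l) x y z).
Proof.
move=> H x0 y0.
apply: (@near_eq_is_derive _ _ _ (fun u => gpev l u y z)).
  near=> u; rewrite H //; near: u; exact: lt_nbhsr.
rewrite /gpev big_map; apply: derive1_sum => q.
have ? := is_derive1_powR q.1.1.2 x0.
by apply: is_derive_eq; rewrite /GRing.scale /=; ring.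
Unshelve. all: by end_near. Qed.

Lemma gp_is_derive_y l F (x y z : R) : gp l F -> 0 < x -> 0 < y ->
  is_derive y 1 (fun u : R => F x u z) (gpev (map gpdy l) x y z).
Proof.
move=> H x0 y0.
apply: (@near_eq_is_derive _ _ _ (fun u => gpev l x u z)).
  near=> u; rewrite H //; near: u; exact: lt_nbhsr.
rewrite /gpev big_map; apply: derive1_sum => q.
have ? := is_derive1_powR q.1.2 y0.
by apply: is_derive_eq; rewrite /GRing.scale /=; ring.
Unshelve. all: by end_near. Qed.

Lemma gp_is_derive_z l F (x y z : R) : gp l F -> 0 < x -> 0 < y ->
  is_derive z 1 (fun u : R => F x y u) (gpev (map gpdz l) x y z).
Proof.
move=> H x0 y0.
apply: (@near_eq_is_derive _ _ _ (fun u => gpev l x y u)).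
  by near=> u; rewrite H.
rewrite /gpev big_map; apply: derive1_sum => q.
have ? : is_derive z 1 (fun u : R => u ^+ q.2) (q.2%:R * z ^+ q.2.-1).
  apply: DeriveDef; first exact: exprn_derivable.
  by rewrite exp_derive /GRing.scale /= mulr1.
by apply: is_derive_eq; rewrite /GRing.scale /=; ring.
Unshelve. all: by end_near. Qed.

Lemma gp_Dx l F : gp l F -> gp (map gpdx l) (Dx F).
Proof.
move=> H x y z x0 y0; have D := gp_is_derive_x z H x0 y0.
by rewrite /Dx derive1E derive_val.
Qed.

Lemma gp_Dy l F : gp l F -> gp (map gpdy l) (Dy F).
Proof.
move=> H x y z x0 y0; have D := gp_is_derive_y z H x0 y0.
by rewrite /Dy derive1E derive_val.
Qed.

Lemma gp_Dz l F : gp l F -> gp (map gpdz l) (Dz F).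
Proof.
move=> H x y z x0 y0; have D := gp_is_derive_z z H x0 y0.
by rewrite /Dz derive1E derive_val.
Qed.

Lemma gp1 l F : gp l F -> F 1 1 1 = \sum_(q <- l) q.1.1.1.
Proof.
move=> H; rewrite H // /gpev; apply: eq_bigr => q _.
by rewrite !powR1 expr1n !mulr1.
Qed.

Lemma gp_partials l F : gp l F ->
  [/\ Dx F 1 1 1 = \sum_(q <- l) q.1.1.1 * q.1.1.2,
      Dy F 1 1 1 = \sum_(q <- l) q.1.1.1 * q.1.2 &
      Dz F 1 1 1 = \sum_(q <- l) q.1.1.1 * q.2%:R] /\
  [/\ Dx (Dx F) 1 1 1 = \sum_(q <- l) q.1.1.1 * (q.1.1.2 * (q.1.1.2 - 1)),
      Dy (Dy F) 1 1 1 = \sum_(q <- l) q.1.1.1 * (q.1.2 * (q.1.2 - 1)) &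
      Dz (Dz F) 1 1 1 = \sum_(q <- l) q.1.1.1 * (q.2%:R * (q.2%:R - 1))] /\
  [/\ Dy (Dx F) 1 1 1 = \sum_(q <- l) q.1.1.1 * (q.1.1.2 * q.1.2),
      Dz (Dx F) 1 1 1 = \sum_(q <- l) q.1.1.1 * (q.1.1.2 * q.2%:R) &
      Dz (Dy F) 1 1 1 = \sum_(q <- l) q.1.1.1 * (q.1.2 * q.2%:R)].
Proof.
move=> H; have X := gp_Dx H; have Y := gp_Dy H; have Z := gp_Dz H.
rewrite (gp1 X) (gp1 Y) (gp1 Z) (gp1 (gp_Dx X)) (gp1 (gp_Dy Y)) (gp1 (gp_Dz Z)).
rewrite (gp1 (gp_Dy X)) (gp1 (gp_Dz X)) (gp1 (gp_Dz Y)) !big_map.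
split; [|split]; split => //; apply: eq_bigr => q _ /=; try by rewrite mulrA.
by rewrite -mulrA; congr (_ * _); case: q.2 => [|k] /=; rewrite ?mul0r // -natr1 addrK.
Qed.

End GeneralizedPolynomials.

(** * The characteristic determinant of a chain *)

Section ChainChar.
Variables (R : realType) (L : finType) (n : nat).
Variables (nx : 'I_n -> L -> 'I_n) (t : 'I_n).
Hypothesis L_gt0 : (0 < #|L|)%N.
Hypothesis t_reach : forall i, connect (chain_step nx) i t.
Variables (inp : L -> R) (out : 'I_n -> L -> R).

Definition tilted_mx (x y : R) : 'M[R]_n :=
  \matrix_(i, j) avg (fun l => (nx i l == j)%:R * (x `^ inp l * y `^ out i l)).

Definition chain_char (x y z : R) : R := \det (1%:M - z *: tilted_mx x y).

Lemma sum_tilted x y i (u : 'I_n -> R) :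
  \sum_j tilted_mx x y i j * u j = avg (fun l => x `^ inp l * y `^ out i l * u (nx i l)).
Proof.
under eq_bigr do rewrite mxE mulrC -avgZ.
rewrite -avg_sum; apply: eq_avg => l.
rewrite (bigD1 (nx i l)) //= eqxx mul1r big1 ?addr0 1?mulrC // => j.
by rewrite eq_sym => /negbTE ->; rewrite mul0r mulr0.
Qed.

Lemma isgp_chain_char : isgp chain_char.
Proof.
apply: (@isgp_det R n (fun x y z => 1%:M - z *: tilted_mx x y)) => i j.
apply: isgp_ext (isgpD (isgp_cst (i == j)%:R) (isgpM (isgpM (isgp_cst (-1)) (isgp_z R))
  (isgpM (isgp_cst (#|L|%:R^-1)) (isgp_sum (index_enum L) xpredT
     (fun l => isgp_monom (nx i l == j)%:R (inp l) (out i l) 0))))) => x y z _ _.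
rewrite !mxE /avg mulN1r mulNr; congr (_ - _ * (_ * _)).
by apply: eq_bigr => l _; rewrite expr0 mulr1 mulrA.
Qed.

(** Serves to differentiate this determinant in [z]; [x] and [y] are dummies. *)
Lemma isgp_det_bordered : isgp (fun _ _ z => \det (@bordered_mx R L n nx t z)).
Proof.
apply: (@isgp_det R n (fun _ _ z => @bordered_mx R L n nx t z)) => i j.
case jt: (j == t).
  by apply: isgp_ext (isgp_cst 1) => x y z _ _; rewrite mxE jt.
apply: isgp_ext (isgpD (isgp_cst (i == j)%:R) (isgpM (isgpM (isgp_cst (-1)) (isgp_z R))
  (isgp_cst (@trans_avg_mx R L n nx i j)))) => x y z _ _.
by rewrite [RHS]mxE jt mulN1r mulNr.
Qed.

Lemma tilted_mx1 : tilted_mx 1 1 = @trans_avg_mx R L n nx.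
Proof.
by apply/matrixP => i j; rewrite !mxE; apply: eq_avg => l; rewrite !powR1 !mulr1.
Qed.

(** Differentiating [det_trans_avg] at z = 1 turns its right side into minus the determinant of
    [bordered_mx 1], which is nonzero because that matrix is invertible. So f_z cannot vanish. *)
Lemma chain_char_z_neq0 l : gp l chain_char -> \sum_(q <- l) q.1.1.1 * q.2%:R != 0.
Proof.
move=> H; have [l' H'] := isgp_det_bordered.
have D := gp_is_derive_z 1 H ltr01 ltr01.
have D' := gp_is_derive_z 1 H' ltr01 ltr01.
set U : 'M[R]_n := \matrix_(i, j) (if j == t then 1 else (i == j)%:R).
have E z : chain_char 1 1 z * \det U = \det (@bordered_mx R L n nx t z) * (1 - z).
  by rewrite /chain_char tilted_mx1 det_trans_avg.
have D1 : is_derive (1 : R) 1 (fun z => chain_char 1 1 z * \det U)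
    (gpev (map (@gpdz R) l) 1 1 1 * \det U).
  by apply: is_derive_eq; rewrite /GRing.scale /=; ring.
have D2 : is_derive (1 : R) 1 (fun z => \det (@bordered_mx R L n nx t z) * (1 - z))
    (- \det (@bordered_mx R L n nx t 1)).
  by apply: is_derive_eq; rewrite /GRing.scale /=; ring.
have E' : gpev (map (@gpdz R) l) 1 1 1 * \det U = - \det (@bordered_mx R L n nx t 1).
  have EF : (fun z => chain_char 1 1 z * \det U) =
    (fun z => \det (@bordered_mx R L n nx t z) * (1 - z)) by apply/funext => z; exact: E.
  move: D1; rewrite EF => D1.
  by have := @derive_val _ _ _ _ _ _ _ D1; rewrite (@derive_val _ _ _ _ _ _ _ D2).
have : \det (@bordered_mx R L n nx t 1) != 0.
  by have := bordered_unit R L_gt0 t_reach; rewrite unitmxE unitfE.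
apply: contraNneq => S0; rewrite -oppr_eq0 -E'.
have -> : gpev (map (@gpdz R) l) 1 1 1 = \sum_(q <- l) q.1.1.1 * q.2%:R.
  by rewrite /gpev big_map; apply: eq_bigr => q _; rewrite !powR1 expr1n !mulr1.
by rewrite S0 mul0r.
Qed.

Variables (p q e v : R) (h h' : 'I_n -> R).
Let psi i l : R := p * inp l + q * out i l - e + h (nx i l) - h i.
Hypothesis psi_mean : forall i, avg (psi i) = 0.
Hypothesis psi_var : forall i, avg (fun l => psi i l ^+ 2) = v + h' i - avg (fun l => h' (nx i l)).

Let z_ r : R := expR (- e * r + - (v / 2) * r ^+ 2).
Let N r : 'M[R]_n := 1%:M - z_ r *: tilted_mx (expR (p * r)) (expR (q * r)).
Let u_ i r : R := expR (h i * r + h' i / 2 * r ^+ 2).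

Let exp_O0 a b : bigO 0 (fun r : R => expR (a * r + b * r ^+ 2)).
Proof.
have h1 := bigO_weak (leq0n 3) (bigO_exp a b).
have h2 : bigO 0 (fun r : R => 1 + a * r + (b + a ^+ 2 / 2) * r ^+ 2).
  apply: bigOD; first apply: bigOD; first exact: bigO_cst.
    by apply: bigOZ; apply: (@bigO_weak _ 0 1) => //; exact: bigO_id.
  by apply: bigOZ; apply: (@bigO_weak _ 0 2) => //; exact: bigOX.
by apply: bigO_ext (bigOD h1 h2) => r; rewrite subrK.
Qed.

Let tilt_expE i l r : z_ r * (expR (p * r) `^ inp l * expR (q * r) `^ out i l) =
  expR ((p * inp l + q * out i l - e) * r + - (v / 2) * r ^+ 2).
Proof. by rewrite /z_ -!expRM -!expRD; congr expR; ring. Qed.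

Let N_O0 i j : bigO 0 (fun r => N r i j).
Proof.
have H : bigO 0 (fun r : R => (i == j)%:R + (- #|L|%:R^-1) *
   \sum_l (nx i l == j)%:R * expR ((p * inp l + q * out i l - e) * r + - (v / 2) * r ^+ 2)).
  apply: bigOD; first exact: bigO_cst.
  by apply: bigOZ; apply: bigO_sum => l; apply: bigOZ; exact: exp_O0.
apply: bigO_ext H => r; rewrite !mxE /avg mulNr; congr (_ - _).
rewrite [RHS]mulrCA; congr (_ * _); rewrite big_distrr /=; apply: eq_bigr => l _.
by rewrite -tilt_expE mulrCA.
Qed.

(** After factoring out exp (h i r), the exponents are psi r + b r^2 on one side and h' i / 2 r^2 on
    the other. Averaging their expansions, the terms in r agree by [psi_mean] and those in r^2 by
    [psi_var]. *)
Let Nu_O3 i : bigO 3 (fun r => \sum_j N r i j * u_ j r).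
Proof.
pose b l : R := (h' (nx i l) - v) / 2.
pose P a b (r : R) := 1 + a * r + (b + a ^+ 2 / 2) * r ^+ 2.
have H : bigO 3 (fun r => - expR (h i * r + 0 * r ^+ 2) * (#|L|%:R^-1 *
    (\sum_l (expR (psi i l * r + b l * r ^+ 2) - P (psi i l) (b l) r))
    + (-1) * (expR (0 * r + h' i / 2 * r ^+ 2) - P 0 (h' i / 2) r))).
  apply: (@bigOM _ 0 3).
    by apply: bigO_ext (bigOZ (-1) (exp_O0 (h i) 0)) => r; rewrite mulN1r.
  apply: bigOD; last by apply: bigOZ; exact: bigO_exp.
  by apply: bigOZ; apply: bigO_sum => l; exact: bigO_exp.
apply: bigO_ext H => r.
have -> : \sum_j N r i j * u_ j r = u_ i r - z_ r * avg (fun l =>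
    expR (p * r) `^ inp l * expR (q * r) `^ out i l * u_ (nx i l) r).
  rewrite -(sum_tilted _ _ _ (fun j => u_ j r)) big_distrr /=.
  rewrite (eq_bigr (fun j => (i == j)%:R * u_ j r -
    z_ r * (tilted_mx (expR (p * r)) (expR (q * r)) i j * u_ j r))); last first.
    by move=> j _; rewrite !mxE; ring.
  rewrite sumrB; congr (_ - _); rewrite (bigD1 i) //= eqxx mul1r big1 ?addr0 // => j.
  by rewrite eq_sym => /negbTE ->; rewrite mul0r.
have -> : z_ r * avg (fun l => expR (p * r) `^ inp l * expR (q * r) `^ out i l * u_ (nx i l) r) =
   expR (h i * r) * avg (fun l => expR (psi i l * r + b l * r ^+ 2)).
  rewrite -!avgZ; apply: eq_avg => l; rewrite mulrA tilt_expE /u_ -!expRD.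
  by congr expR; rewrite /psi /b; field.
have -> : u_ i r = expR (h i * r) * expR (0 * r + h' i / 2 * r ^+ 2).
  by rewrite /u_ -expRD; congr expR; ring.
rewrite mul0r addr0 sumrB mulrBr -/(avg _) -/(avg (fun l => P (psi i l) (b l) r)).
suff -> : avg (fun l => P (psi i l) (b l) r) = P 0 (h' i / 2) r by ring.
rewrite (eq_avg (g := fun l => (1 + r * psi i l) + (r ^+ 2 / 2) * ((h' (nx i l) - v) + psi i l ^+ 2))); last first.
  by move=> l; rewrite /P /b; field.
by rewrite avgD avgD avg_cst // !avgZ psi_mean avgD avgB avg_cst // psi_var /P; field.
Qed.

(* [u_] is in the kernel of [N] up to third order. *)
Lemma det_tilted_O3 : bigO 3 (fun r => chain_char (expR (p * r)) (expR (q * r)) (z_ r)).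
Proof.
(* The exponential is the inverse of [u_ t r]: row [t] of adj N N u = det N u is divided by it. The
   entries of the adjugate only have to stay bounded. *)
have H : bigO 3 (fun r => expR (- h t * r + - (h' t / 2) * r ^+ 2) *
    \sum_j \adj (N r) t j * \sum_k N r j k * u_ k r).
  apply: (@bigOM _ 0 3); first exact: exp_O0.
  apply: bigO_sum => j; apply: (@bigOM _ 0 3); last exact: Nu_O3.
  rewrite (_ : (fun r => _) = (fun r => (-1) ^+ (j + t) * \det (row' j (col' t (N r))))); last first.
    by apply/funext => r; rewrite mxE.
  apply: bigOZ; apply: bigO_det => a b.
  apply: bigO_ext (N_O0 (lift j a) (lift t b)) => r.
  by rewrite [RHS]mxE [RHS]mxE.
apply: bigO_ext H => r; rewrite /chain_char -/(N r).
have -> : \sum_j \adj (N r) t j * (\sum_k N r j k * u_ k r) = \det (N r) * u_ t r.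
  pose V : 'cV[R]_n := \col_k u_ k r.
  have VE k : V k 0 = u_ k r by rewrite mxE.
  have : (\adj (N r) *m (N r *m V)) t 0 = (\det (N r) *: V) t 0.
    by rewrite mulmxA mul_adj_mx mul_scalar_mx.
  rewrite mxE [RHS]mxE VE => <-; apply: eq_bigr => j _; congr (_ * _).
  by rewrite mxE; apply: eq_bigr => k _; rewrite VE.
rewrite mulrCA -expRD (_ : _ + _ = 0) ?expR0 ?mulr1 //; ring.
Qed.

Lemma chain_char_moments l : gp l chain_char ->
  [/\ \sum_(m <- l) m.1.1.1 = 0,
      \sum_(m <- l) m.1.1.1 * (p * m.1.1.2 + q * m.1.2 - e * m.2%:R) = 0 &
      \sum_(m <- l) m.1.1.1 * ((p * m.1.1.2 + q * m.1.2 - e * m.2%:R) ^+ 2 - v * m.2%:R) = 0].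
Proof.
move=> H.
pose a (m : R * R * R * nat) : R := p * m.1.1.2 + q * m.1.2 - e * m.2%:R.
pose b (m : R * R * R * nat) : R := - (v / 2) * m.2%:R.
have H1 : bigO 3 (fun r => \sum_(m <- l) m.1.1.1 * expR (a m * r + b m * r ^+ 2)).
  apply: bigO_ext det_tilted_O3 => r; rewrite H ?expR_gt0 // /gpev.
  apply: eq_bigr => m _; rewrite /z_ -!expRM -expRM_natr -!mulrA -!expRD.
  by congr (_ * expR _); rewrite /a /b; ring.
have H2 : bigO 3 (fun r => \sum_(m <- l) (- m.1.1.1) * (expR (a m * r + b m * r ^+ 2)
     - (1 + a m * r + (b m + a m ^+ 2 / 2) * r ^+ 2))).
  by apply: bigO_sum => m; apply: bigOZ; exact: bigO_exp.
have H3 : bigO 3 (fun r => \sum_(m <- l) m.1.1.1 + (\sum_(m <- l) m.1.1.1 * a m) * r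
     + (\sum_(m <- l) m.1.1.1 * (b m + a m ^+ 2 / 2)) * r ^+ 2).
  apply: bigO_ext (bigOD H1 H2) => r.
  rewrite !big_distrl -!big_split /=; apply: eq_bigr => m _; ring.
have [-> -> E] := bigO3_coef H3; split => //.
have : 2 * (\sum_(m <- l) m.1.1.1 * (b m + a m ^+ 2 / 2)) = 0 by rewrite E mulr0.
rewrite big_distrr /= => {2}<-; apply: eq_bigr => m _.
by rewrite /b /a; field.
Qed.

End ChainChar.

(** * Averages over words *)

Section WordAvg.
Variables (R : realType) (L : finType).
Hypothesis L_gt0 : (0 < #|L|)%N.
Implicit Types F : seq L -> R.

(** The mean over words of length [k] ([wavg_tuple]). With the first letter outermost, unfolding
    once conditions on the first step of the chain. *)
Fixpoint wavg k F : R :=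
  if k is k'.+1 then avg (fun l => wavg k' (fun w => F (l :: w))) else F [::].

Lemma eq_wavg k F F' : (forall w, size w = k -> F w = F' w) -> wavg k F = wavg k F'.
Proof.
elim: k F F' => [|k IH] F F' H /=; first exact: H.
by apply: eq_avg => l; apply: IH => w wk; apply: H; rewrite /= wk.
Qed.

Lemma wavgD k F F' : wavg k (fun w => F w + F' w) = wavg k F + wavg k F'.
Proof. by elim: k F F' => //= k IH F F'; rewrite -avgD; apply: eq_avg => l; exact: IH. Qed.

Lemma wavgZ k c F : wavg k (fun w => c * F w) = c * wavg k F.
Proof. by elim: k F => //= k IH F; rewrite -avgZ; apply: eq_avg => l; exact: IH. Qed.

Lemma wavg_cst k c : wavg k (fun=> c) = c.
Proof. by elim: k => //= k IH; rewrite -[RHS](avg_cst L_gt0); apply: eq_avg. Qed.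

Lemma wavg_le k F F' : (forall w, size w = k -> F w <= F' w) -> wavg k F <= wavg k F'.
Proof.
elim: k F F' => [|k IH] F F' H /=; first exact: H.
by apply: avg_le => l; apply: IH => w wk; apply: H; rewrite /= wk.
Qed.

Lemma wavg_norm k F : `|wavg k F| <= wavg k (fun w => `|F w|).
Proof.
elim: k F => //= k IH F; apply: (le_trans (avg_norm _)); apply: avg_le => l; exact: IH.
Qed.

Lemma wavg_bound k F M : (forall w, size w = k -> `|F w| <= M) -> `|wavg k F| <= M.
Proof. by move=> H; rewrite -(wavg_cst k M); apply: (le_trans (wavg_norm _ _)); apply: wavg_le. Qed.

Lemma wavg_tuple k F : wavg k F = #|L|%:R ^- k * \sum_(w : k.-tuple L) F w.
Proof.
elim: k F => [|k IH] F.
  rewrite expr0 invr1 mul1r /= (big_pred1 [tuple]) // => w; exact/esym/eqP/tuple0.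
rewrite /= /avg exprS invfM -mulrA; congr (_ * _).
transitivity (\sum_l #|L|%:R ^- k * \sum_(w : k.-tuple L) F (l :: w)).
  by apply: eq_bigr => l _; exact: IH.
rewrite -big_distrr /=; congr (_ * _); rewrite pair_big /=.
rewrite [LHS](reindex (fun w : k.+1.-tuple L => (thead w, [tuple of behead w]))) /=.
  by apply: eq_bigr => w _; rewrite [in RHS](tuple_eta w).
exists (fun p : L * k.-tuple L => [tuple of p.1 :: p.2]) => [w _|[l w] _] /=.
  by rewrite [RHS]tuple_eta; apply: val_inj.
by congr pair; apply: val_inj.
Qed.

(** Reversal permutes the words of given length. This disposes of the reading direction of the
    transducer. *)
Lemma wavg_rev k F : wavg k (fun w => F (rev w)) = wavg k F.
Proof.
rewrite !wavg_tuple; congr (_ * _).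
rewrite [RHS](reindex (fun w : k.-tuple L => [tuple of rev w])) //=.
by exists (fun w : k.-tuple L => [tuple of rev w]) => w _; apply: val_inj; rewrite /= revK.
Qed.

(** A single word has weight |L|^-k; with a word leading to a common state, this is the minorization
    behind the contraction. *)
Lemma wavg_ge_word k F a w0 : (forall w, a <= F w) -> size w0 = k ->
  a + #|L|%:R ^- k * (F w0 - a) <= wavg k F.
Proof.
move=> Fa wk; rewrite -lerBrDl.
have -> : wavg k F - a = wavg k (fun w => F w + (-1) * a).
  by rewrite wavgD wavg_cst mulN1r.
rewrite wavg_tuple ler_wpM2l ?invr_ge0 ?exprn_ge0 //.
have sw : size w0 == k by apply/eqP.
rewrite (bigD1 (Tuple sw)) //= mulN1r lerDl; apply: sumr_ge0 => w _.
by rewrite subr_ge0.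
Qed.

End WordAvg.

(** * Sums along words and their moments *)

Section ChainWords.
Variables (R : realType) (L : finType) (n : nat).
Variables (nx : 'I_n -> L -> 'I_n).
Hypothesis L_gt0 : (0 < #|L|)%N.
Implicit Types (psi : 'I_n -> L -> R) (u h : 'I_n -> R).

Fixpoint wsum psi i w : R :=
  if w is l :: w' then psi i l + wsum psi (nx i l) w' else 0.

Definition wend i w : 'I_n := foldl nx i w.

Lemma wsumD psi psi' i w :
  wsum (fun i l => psi i l + psi' i l) i w = wsum psi i w + wsum psi' i w.
Proof. by elim: w i => [|l w IH] i /=; rewrite ?addr0 // IH; ring. Qed.

Lemma wsumZ c psi i w : wsum (fun i l => c * psi i l) i w = c * wsum psi i w.
Proof. by elim: w i => [|l w IH] i /=; rewrite ?mulr0 // IH mulrDr. Qed.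

(** The corrector [h] telescopes along the word, leaving only its values at the two ends. With [h]
    from the Poisson equation, the last sum has centred increments. *)
Lemma wsum_telescope (theta : 'I_n -> L -> R) e h i w :
  wsum theta i w = e * (size w)%:R + h i - h (wend i w) +
    wsum (fun i l => theta i l - e + h (nx i l) - h i) i w.
Proof.
elim: w i => [|l w IH] i /=; first by rewrite /wend /=; ring.
by rewrite IH /wend /= -natr1; ring.
Qed.

Lemma fun_bounded u : exists2 B : R, 0 <= B & forall i, `|u i| <= B.
Proof.
exists (\sum_i `|u i|) => [|i]; first exact: sumr_ge0.
by rewrite (bigD1 i) //= lerDl sumr_ge0.
Qed.

Lemma fun2_bounded psi : exists2 B : R, 0 <= B & forall i l, `|psi i l| <= B.
Proof.
exists (\sum_i \sum_l `|psi i l|) => [|i l]; first by apply: sumr_ge0 => i _; exact: sumr_ge0.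
rewrite (bigD1 i) //= (bigD1 l) //= -addrA lerDl addr_ge0 ?sumr_ge0 // => j _.
exact: sumr_ge0.
Qed.

Section Martingale.
Variable psi : 'I_n -> L -> R.
Hypothesis psi_mean : forall i, avg (psi i) = 0.

Lemma wavg_wsum k i : wavg k (wsum psi i) = 0.
Proof.
elim: k i => //= k IH i.
rewrite (eq_avg (g := psi i)) // => l.
by rewrite wavgD wavg_cst // IH addr0.
Qed.

(** Conditioning on the first letter, the cross term vanishes because the remaining sum has mean 0,
    and the conditional variances telescope through [h']. *)
Lemma wavg_wsum_sqr v h' k i :
  (forall i, avg (fun l => psi i l ^+ 2) = v + h' i - avg (fun l => h' (nx i l))) ->
  wavg k (fun w => wsum psi i w ^+ 2) = k%:R * v + h' i - wavg k (fun w => h' (wend i w)).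
Proof.
move=> Hv; elim: k i => [|k IH] i /=; first by rewrite /wend /=; ring.
rewrite (eq_avg (g := fun l => psi i l ^+ 2 + (k%:R * v + h' (nx i l) - wavg k (fun w => h' (wend (nx i l) w))))).
  by rewrite avgD avgB avgD avg_cst // Hv -natr1; ring.
move=> l; rewrite -IH.
rewrite -(wavg_cst L_gt0 k (psi i l ^+ 2)) -wavgD.
rewrite (eq_wavg (F' := fun w => (psi i l ^+ 2 + wsum psi (nx i l) w ^+ 2) + 2 * psi i l * wsum psi (nx i l) w)).
  by rewrite [LHS]wavgD wavgZ wavg_wsum mulr0 addr0.
by move=> w _; ring.
Qed.

(* Contraction of the oscillation: all states reach [t] by words of the same length [m]. *)
Lemma wavg_wsum_mul_bounded (m : nat) (t : 'I_n) u : (0 < m)%N ->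
  (forall i, exists2 w, size w = m & wend i w = t) ->
  exists2 C : R, 0 <= C & forall k i, `|wavg k (fun w => wsum psi i w * u (wend i w))| <= C.
Proof.
move=> m0 reach.
have [B B0 HB] := fun2_bounded psi; have [U U0 HU] := fun_bounded u.
pose P k (u : 'I_n -> R) i := wavg k (fun w => u (wend i w)).
(* The probability of any particular word of length [m], in particular of one leading from the
   current state to [t]. *)
pose al : R := #|L|%:R ^- m.
have L1 : 1 <= #|L|%:R :> R by rewrite ler1n.
have al0 : 0 < al by rewrite invr_gt0 exprn_gt0 // (lt_le_trans ltr01).
have al1 : al <= 1 by rewrite invf_le1 ?exprn_gt0 ?(lt_le_trans ltr01) // exprn_ege1.
pose bnd o (u : 'I_n -> R) := exists lo, forall i, lo <= u i <= lo + o.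
have bnd_step o f : bnd o f -> bnd ((1 - al) * o) (P m f).
  move=> [lo Hlo]; exists (lo + al * (f t - lo)) => i.
  have [w wm wt] := reach i; apply/andP; split.
    rewrite -wt; apply: (wavg_ge_word L_gt0 (F := fun w => f (wend i w))) => // w'.
    by have /andP[] := Hlo (wend i w').
  have := @wavg_ge_word R L L_gt0 m (fun w => - f (wend i w)) (- (lo + o)) w.
  have -> : wavg m (fun w => - f (wend i w)) = - P m f i.
    by rewrite -mulN1r -wavgZ; apply: eq_wavg => w' _; rewrite mulN1r.
  rewrite wt -/al => H.
  have {}H : - (lo + o) + al * (- f t - - (lo + o)) <= - P m f i.
    apply: H => // w'; rewrite lerN2; by have /andP[] := Hlo (wend i w').
  rewrite -lerN2; apply: le_trans H; rewrite le_eqVlt; apply/orP; left; apply/eqP; ring.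
have Padd k k' f i : P (k + k')%N f i = P k (P k' f) i.
  by elim: k i => [|k IH] i //=; apply: eq_avg => l; exact: IH.
have bnd0 k f o : bnd o f -> bnd o (P k f).
  move=> [lo Hlo]; exists lo => i; rewrite -(wavg_cst L_gt0 k lo) -(wavg_cst L_gt0 k o) -wavgD.
  by apply/andP; split; apply: wavg_le => w _; have /andP[] := Hlo (wend i w).
(* The oscillation of [u] is at most 2 U, and each complete block of [m] steps multiplies the bound
   by 1 - al. *)
pose o k : R := (2 * U) * (1 - al) ^+ (k %/ m)%N.
have o_ge0 k : 0 <= o k by rewrite mulr_ge0 ?mulr_ge0 // exprn_ge0 // subr_ge0.
have bo k : bnd (o k) (P k u).
  rewrite /o {2}(divn_eq k m) addnC.
  elim: (k %/ m)%N => [|j IH].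
    rewrite mul0n addn0 expr0 mulr1; apply: bnd0; exists (- U) => i.
    have := HU i; rewrite ler_norml => /andP[-> ui] /=.
    by apply: (le_trans ui); rewrite le_eqVlt; apply/orP; left; apply/eqP; ring.
  have -> : P (k %% m + j.+1 * m)%N u = P m (P (k %% m + j * m)%N u).
    by apply/funext => i; rewrite -Padd; congr (P _ _ _); rewrite mulSn addnCA.
  have -> : 2 * U * (1 - al) ^+ j.+1 = (1 - al) * (2 * U * (1 - al) ^+ j) by rewrite exprS; ring.
  exact: bnd_step.
pose S k := \sum_(j < k) o j.
(* From [S (m + k') = S m + (1 - al) * S k']. The bound solves M = 2 m U + (1 - al) M. *)
have S_bound k : S k <= m%:R * (2 * U) / al.
  have SM j : (j <= m)%N -> S j <= m%:R * (2 * U).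
    move=> jm; apply: (@le_trans _ _ (\sum_(i < j) (2 * U))).
      by apply: ler_sum => i _; rewrite ler_piMr ?mulr_ge0 // exprn_ile1 ?subr_ge0 // lerBlDr lerDl ltW.
    by rewrite sumr_const card_ord -[leLHS]mulr_natl ler_wpM2r ?mulr_ge0 // ler_nat.
  have [j] := ubnP k; elim: j k => // j IH k kj.
  have MU : 0 <= m%:R * (2 * U) by rewrite !mulr_ge0.
  have [km|mk] := leqP k m.
    by apply: (le_trans (SM k km)); rewrite ler_pdivlMr // ler_piMr.
  have E k' : S (m + k')%N = S m + (1 - al) * S k'.
    rewrite /S big_split_ord /=; congr (_ + _).
    rewrite big_distrr /=; apply: eq_bigr => i _.
    by rewrite /o divnDl ?dvdnn // divnn m0 add1n exprS; ring.
  rewrite -(subnKC (ltnW mk)) E; apply: (@le_trans _ _ (m%:R * (2 * U) + (1 - al) * (m%:R * (2 * U) / al))).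
    apply: lerD; first exact: SM.
    apply: ler_wpM2l; first by rewrite subr_ge0.
    apply: IH; apply: (@leq_trans k); last by rewrite -ltnS.
    by rewrite ltn_subrL m0 (leq_trans m0) // ltnW.
  by rewrite le_eqVlt; apply/orP; left; apply/eqP; field; rewrite gt_eqF.
exists (B * (m%:R * (2 * U) / al)) => [|k i].
  by rewrite mulr_ge0 // divr_ge0 ?mulr_ge0 // ltW.
apply: (@le_trans _ _ (B * S k)); last exact: ler_wpM2l.
elim: k i => [|k IH] i /=; first by rewrite /S big_ord0 mul0r mulr0 normr0.
have [lo Hlo] := bo k.
(* As [psi i] is centred, [lo] may be subtracted from [P k u]. The first letter then costs at most
   [B * o k], and these costs are summable. *)
rewrite (eq_avg (g := fun l => psi i l * (P k u (nx i l) - lo) + lo * psi i l +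
   wavg k (fun w => wsum psi (nx i l) w * u (wend (nx i l) w)))); last first.
  move=> l; rewrite /P mulrBr [lo * _]mulrC subrK -wavgZ -wavgD.
  by apply: eq_wavg => w _; rewrite mulrDl.
rewrite avgD avgD avgZ psi_mean mulr0 addr0 /S big_ord_recr /= mulrDr addrC.
apply: (le_trans (ler_normD _ _)); apply: lerD.
  apply: (le_trans (avg_norm _)); rewrite -[leRHS](avg_cst L_gt0).
  by apply: avg_le => l; exact: IH.
apply: (le_trans (avg_norm _)); rewrite -[leRHS](avg_cst L_gt0); apply: avg_le => l.
have /andP[h1 h2] := Hlo (nx i l).
by rewrite normrM ler_pM // ger0_norm ?subr_ge0 // lerBlDl.
Qed.

End Martingale.
End ChainWords.

(** * The central limit theorem for additive functionals *)

Section BigOMore.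
Variable R : realType.

Lemma bigO_avg (L : finType) k (F : L -> R -> R) :
  (forall l, bigO k (F l)) -> bigO k (fun r => avg (fun l => F l r)).
Proof. by move=> H; apply: bigOZ; apply: bigO_sum. Qed.

Lemma bigO_uniform (I : finType) k (F : I -> R -> R) : (forall i, bigO k (F i)) ->
  exists2 C : R, 0 <= C & forall i r, `|r| <= 1 -> `|F i r| <= C * `|r| ^+ k.
Proof.
move=> H.
have /choice [c Hc] : forall i, exists C : R, 0 <= C /\ forall r, `|r| <= 1 -> `|F i r| <= C * `|r| ^+ k.
  by move=> i; have [C C0 HC] := H i; exists C.
exists (\sum_i c i) => [|i r r1]; first by apply: sumr_ge0 => i _; have [] := Hc i.
have [_ Hi] := Hc i; apply: (le_trans (Hi r r1)); apply: ler_wpM2r; first exact: exprn_ge0.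
by rewrite (bigD1 i) //= lerDl sumr_ge0 // => j _; have [] := Hc j.
Qed.

Lemma bigO_cos (a : R) : bigO 3 (fun r => cos (r * a) - (1 - a ^+ 2 / 2 * r ^+ 2)).
Proof.
exists (`|a| ^+ 3) => [|r _]; first exact: exprn_ge0.
have := cos_taylor 0 (r * a); rewrite add0r sin0 cos0 (normrM r a) (exprMn _ `|r|) [leRHS]mulrC.
by apply: le_trans; rewrite (_ : 1 - a ^+ 2 / 2 * r ^+ 2 = 1 - r * a * 0 - (r * a) ^+ 2 / 2 * 1) //; field.
Qed.

Lemma bigO_sin (a : R) : bigO 3 (fun r => sin (r * a) - a * r).
Proof.
exists (`|a| ^+ 3) => [|r _]; first exact: exprn_ge0.
have := cos_taylor (- (pi / 2)) (r * a).
rewrite (addrC (- (pi / 2))) cosBpihalf cosN sinN cos_pihalf sin_pihalf (normrM r a) (exprMn _ `|r|) [leRHS]mulrC.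
by apply: le_trans; rewrite (_ : a * r = 0 - r * a * - 1 - (r * a) ^+ 2 / 2 * 0) //; ring.
Qed.

Lemma cos_lipschitz (x y : R) : `|cos (x + y) - cos x| <= `|y|.
Proof.
rewrite -[leRHS]mul1r.
apply: (@mvt_bound R (fun y => cos (x + y) - cos x) (fun y => - sin (x + y))) => [z||c _].
- have D : is_derive (z : R) 1 (fun y : R => x + y) (1 : R).
    by apply: is_derive_eq; ring.
  have D2 := @is_derive1_comp R cos (fun y => x + y) z _ _ (is_derive_cos _) D.
  by apply: is_derive_eq; ring.
- by rewrite addr0 subrr.
- by rewrite normrN ler_norml sin_geN1 sin_le1.
Qed.

End BigOMore.

Section ChainCLT.
Variables (R : realType) (L : finType) (n : nat).
Variables (nx : 'I_n -> L -> 'I_n) (t : 'I_n).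
Hypothesis L_gt0 : (0 < #|L|)%N.
Variable psi : 'I_n -> L -> R.
Hypothesis psi_mean : forall i, avg (psi i) = 0.
Variables (v : R) (h' : 'I_n -> R).
Hypothesis psi_var : forall i, avg (fun l => psi i l ^+ 2) = v + h' i - avg (fun l => h' (nx i l)).

(** At a minimum of [h'], [v] is a mean of squares plus a nonnegative difference. *)
Lemma chain_var_ge0 : 0 <= v.
Proof.
have [i Hi] := exists_avg_le nx t L_gt0 h'.
have -> : v = avg (fun l => psi i l ^+ 2) + (avg (fun l => h' (nx i l)) - h' i).
  by rewrite psi_var; ring.
apply: addr_ge0; last by rewrite subr_ge0.
by rewrite -(avg_cst L_gt0 0); apply: avg_le => l; exact: sqr_ge0.
Qed.

Let lam r : R := expR (0 * r + - (v / 2) * r ^+ 2).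

(** The weight 1 - r^2 h' / 2 replaces the state-dependent conditional variance by the constant [v],
    so one step acts as multiplication by [lam r] up to third order. *)
Let corr_cos i : bigO 3 (fun r => avg (fun l => cos (r * psi i l) * (1 - r ^+ 2 / 2 * h' (nx i l)))
   - lam r * (1 - r ^+ 2 / 2 * h' i)).
Proof.
have O0 a : bigO 0 (fun r : R => 1 + a * r ^+ 2).
  apply: bigOD; first exact: bigO_cst.
  by apply: bigOZ; apply: (@bigO_weak _ 0 2) => //; exact: bigOX.
have H1 : bigO 3 (fun r => avg (fun l => (cos (r * psi i l) - (1 - psi i l ^+ 2 / 2 * r ^+ 2)) *
    (1 + (- h' (nx i l) / 2) * r ^+ 2))).
  by apply: bigO_avg => l; apply: (@bigOM _ 3 0); [exact: bigO_cos | exact: O0].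
have H2 : bigO 3 (fun r : R => r ^+ 3 * ((avg (fun l => psi i l ^+ 2 * h' (nx i l)) / 4 - v * h' i / 4) * r)).
  apply: (@bigOM _ 3 0); first exact: bigOX.
  by apply: bigOZ; apply: (@bigO_weak _ 0 1) => //; exact: bigO_id.
have H3 : bigO 3 (fun r => (lam r - (1 + 0 * r + (- (v / 2) + 0 ^+ 2 / 2) * r ^+ 2)) * ((-1) * (1 + (-
    h' i / 2) * r ^+ 2))).
  by apply: (@bigOM _ 3 0); [exact: bigO_exp | apply: bigOZ; exact: O0].
apply: bigO_ext (bigOD (bigOD H1 H2) H3) => r.
rewrite (eq_avg (g := fun l => cos (r * psi i l) * (1 - r ^+ 2 / 2 * h' (nx i l)) +
   ((-1) + ((r ^+ 2 / 2) * (psi i l ^+ 2 + h' (nx i l)) + - (r ^+ 4 / 4) * (psi i l ^+ 2 * h' (nx i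
       l)))))); last first.
  by move=> l; field.
rewrite avgD avgD avg_cst // avgD !avgZ avgD psi_var.
by field.
Qed.

Let corr_sin i : bigO 3 (fun r => avg (fun l => sin (r * psi i l) * (1 - r ^+ 2 / 2 * h' (nx i l)))).
Proof.
have H1 : bigO 3 (fun r => avg (fun l => (sin (r * psi i l) - psi i l * r) * (1 + (- h' (nx i l) / 2) * r ^+ 2))).
  apply: bigO_avg => l; apply: (@bigOM _ 3 0); first exact: bigO_sin.
  apply: bigOD; first exact: bigO_cst.
  by apply: bigOZ; apply: (@bigO_weak _ 0 2) => //; exact: bigOX.
have H2 : bigO 3 (fun r => (avg (fun l => psi i l * h' (nx i l)) * (- 1 / 2)) * r ^+ 3).
  by apply: bigOZ; exact: bigOX.
apply: bigO_ext (bigOD H1 H2) => r.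
rewrite (eq_avg (g := fun l => sin (r * psi i l) * (1 - r ^+ 2 / 2 * h' (nx i l)) +
   ((- r) * psi i l + (r ^+ 3 / 2) * (psi i l * h' (nx i l))))); last first.
  by move=> l; field.
rewrite avgD avgD !avgZ psi_mean.
by field.
Qed.

(** Each of the [k] steps costs O(r^3), the corrector at the ends O(r^2). At r = 1 / sqrt k the
    total is of order 1 / sqrt k. *)
Lemma wavg_cos : exists2 C : R, 0 <= C & forall r, `|r| <= 1 -> forall k i p,
  `|wavg k (fun w => cos (p + r * wsum nx psi i w)) - expR (- (v / 2) * r ^+ 2) ^+ k * cos p|
    <= C * (`|r| ^+ 2 + k%:R * `|r| ^+ 3).
Proof.
have [C1 C10 H1] := bigO_uniform corr_cos.
have [C2 C20 H2] := bigO_uniform corr_sin.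
have [H H0 Hh] := fun_bounded h'.
exists (H + (C1 + C2)) => [|r r1 k i p]; first by rewrite !addr_ge0.
have -> : expR (- (v / 2) * r ^+ 2) = lam r by rewrite /lam mul0r add0r.
have lam0 : 0 <= lam r by exact: expR_ge0.
have lam1 : lam r <= 1.
  rewrite /lam mul0r add0r -expR0 ler_expR mulNr oppr_le0.
  by rewrite mulr_ge0 ?sqr_ge0 // divr_ge0 // chain_var_ge0.
have lamk j : 0 <= lam r ^+ j <= 1 by rewrite exprn_ge0 //= exprn_ile1.
(* The approximation that reproduces itself under one step. As [lam r] is at most 1, earlier errors
   are not amplified. *)
pose G j i p : R := lam r ^+ j * (cos p * (1 - r ^+ 2 / 2 * h' i)).
have hr i' : `|r ^+ 2 / 2 * h' i'| <= H / 2 * `|r| ^+ 2.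
  rewrite normrM normrM normrX normfV (normr_nat R 2).
  rewrite [leRHS](_ : _ = `|r| ^+ 2 / 2 * H); last by field.
  by rewrite ler_wpM2l // divr_ge0 // exprn_ge0.
have D j : forall i p, `|wavg j (fun w => cos (p + r * wsum nx psi i w)) - G j i p| <=
    H / 2 * `|r| ^+ 2 + j%:R * ((C1 + C2) * `|r| ^+ 3).
  elim: j => [|j IH] i' p' /=.
    rewrite /G mulr0 addr0 expr0 mul1r mul0r addr0.
    have -> : cos p' - cos p' * (1 - r ^+ 2 / 2 * h' i') = cos p' * (r ^+ 2 / 2 * h' i') by ring.
    rewrite normrM; apply: le_trans (hr i'); exact: ler_piMl (cos_abs_le1 _).
  set X := avg _.
  have -> : X - G j.+1 i' p' = avg (fun l => wavg j (fun w => cos (p' + r * psi i' l + r * wsum nx psi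
      (nx i' l) w))
       - G j (nx i' l) (p' + r * psi i' l)) + (avg (fun l => G j (nx i' l) (p' + r * psi i' l)) - G j.+1 i' p').
    rewrite avgB addrA subrK; congr (_ - _); apply: eq_avg => l; apply: eq_wavg => w _.
    by rewrite mulrDr addrA.
  rewrite [leRHS](_ : _ = (H / 2 * `|r| ^+ 2 + j%:R * ((C1 + C2) * `|r| ^+ 3)) + (C1 + C2) * `|r| ^+ 3);
      last first.
    by rewrite -natr1; ring.
  apply: (le_trans (ler_normD _ _)); apply: lerD.
    apply: (le_trans (avg_norm _)); rewrite -[leRHS](avg_cst L_gt0); apply: avg_le => l; exact: IH.
  have -> : avg (fun l => G j (nx i' l) (p' + r * psi i' l)) - G j.+1 i' p' =
     lam r ^+ j * (cos p' * (avg (fun l => cos (r * psi i' l) * (1 - r ^+ 2 / 2 * h' (nx i' l)))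
        - lam r * (1 - r ^+ 2 / 2 * h' i')) -
      sin p' * avg (fun l => sin (r * psi i' l) * (1 - r ^+ 2 / 2 * h' (nx i' l)))).
    rewrite (eq_avg (g := fun l => lam r ^+ j * (cos p' * (cos (r * psi i' l) * (1 - r ^+ 2 / 2 * h' (nx i' l))) +
       (- sin p') * (sin (r * psi i' l) * (1 - r ^+ 2 / 2 * h' (nx i' l)))))); last first.
      by move=> l; rewrite /G cosD; ring.
    by rewrite avgZ avgD !avgZ /G (exprS (lam r)); ring.
  have /andP[l0 l1] := lamk j.
  rewrite normrM (ger0_norm l0); apply: (@le_trans _ _ (1 * ((C1 + C2) * `|r| ^+ 3))); last by rewrite mul1r.
  apply: ler_pM => //; apply: (le_trans (ler_normB _ _)); rewrite mulrDl.
  apply: lerD; rewrite normrM.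
    by rewrite -[leRHS]mul1r; apply: ler_pM => //; [exact: cos_abs_le1 | exact: H1].
  rewrite -[leRHS]mul1r; apply: ler_pM => //; last exact: H2.
  by rewrite ler_norml sin_geN1 sin_le1.
set X := wavg _ _.
have -> : X - lam r ^+ k * cos p = (X - G k i p) - lam r ^+ k * (cos p * (r ^+ 2 / 2 * h' i)).
  by rewrite /G; ring.
apply: (le_trans (ler_normB _ _)); apply: (le_trans (lerD (D k i p) (lexx _))).
have /andP[l0 l1] := lamk k.
have : `|lam r ^+ k * (cos p * (r ^+ 2 / 2 * h' i))| <= H / 2 * `|r| ^+ 2.
  rewrite normrM (ger0_norm l0) normrM; apply: le_trans (hr i).
  rewrite -[leRHS]mul1r; apply: ler_pM => //.
  exact: ler_piMl (cos_abs_le1 _).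
move=> /(lerD (lexx (H / 2 * `|r| ^+ 2 + k%:R * ((C1 + C2) * `|r| ^+ 3)))) /le_trans; apply.
have : 0 <= (C1 + C2) * `|r| ^+ 2 + H * (k%:R * `|r| ^+ 3).
  by rewrite addr_ge0 // !mulr_ge0 ?addr_ge0 // exprn_ge0.
move=> Hp; rewrite -subr_ge0; apply: (le_trans Hp).
by rewrite le_eqVlt; apply/orP; left; apply/eqP; field.
Qed.

End ChainCLT.

Section Deviation.
Variables (R : realType) (L : finType) (n : nat).
Variables (nx : 'I_n -> L -> 'I_n) (t : 'I_n).
Hypothesis L_gt0 : (0 < #|L|)%N.
Variables (theta : 'I_n -> L -> R) (e : R) (h : 'I_n -> R).
Let psi i l : R := theta i l - e + h (nx i l) - h i.
Hypothesis psi_mean : forall i, avg (psi i) = 0.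
Variables (v : R) (h' : 'I_n -> R).
Hypothesis psi_var : forall i, avg (fun l => psi i l ^+ 2) = v + h' i - avg (fun l => h' (nx i l)).
Variable b : 'I_n -> R.

Definition dev k i w : R := wsum nx theta i w + b (wend nx i w) - e * k%:R.

Let g i w : R := h i + (b (wend nx i w) - h (wend nx i w)).

Let devE k i w : size w = k -> dev k i w = wsum nx psi i w + g i w.
Proof. by move=> wk; rewrite /dev (wsum_telescope _ _ e h) wk /g /psi; ring. Qed.

Let g_bounded : exists2 B : R, 0 <= B & forall i w, `|g i w| <= B.
Proof.
have [B B0 HB] := fun_bounded b; have [H H0 HH] := fun_bounded h.
exists (H + (B + H)) => [|i w]; first by rewrite !addr_ge0.
rewrite (le_trans (ler_normD _ _)) // lerD // (le_trans (ler_normB _ _)) // lerD //.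
Qed.

Lemma dev_mean : exists2 C : R, 0 <= C & forall k i, `|wavg k (dev k i)| <= C.
Proof.
have [B B0 HB] := g_bounded; exists B => // k i.
rewrite (eq_wavg (@devE k i)) wavgD wavg_wsum // add0r.
by apply: wavg_bound => // w _; exact: HB.
Qed.

(** In the square of martingale plus [g], the part [h i] of [g] is constant and its mixed term has
    mean 0. The part depending on the last state is correlated with the sum, and
    [wavg_wsum_mul_bounded] keeps that term bounded. *)
Lemma dev_sqr (m : nat) : (0 < m)%N ->
  (forall i, exists2 w, size w = m & wend nx i w = t) ->
  exists2 C : R, 0 <= C & forall k i, `|wavg k (fun w => dev k i w ^+ 2) - k%:R * v| <= C.
Proof.
move=> m0 reach.
have [B B0 HB] := g_bounded; have [H H0 HH] := fun_bounded h'.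
have [C C0 HC] := wavg_wsum_mul_bounded L_gt0 psi_mean (fun i => b i - h i) m0 reach.
exists ((H + H) + (2 * C + B ^+ 2)) => [|k i].
  by rewrite !addr_ge0 // ?mulr_ge0 // ?exprn_ge0.
have -> : wavg k (fun w => dev k i w ^+ 2) - k%:R * v =
   (h' i - wavg k (fun w => h' (wend nx i w))) +
   (2 * wavg k (fun w => wsum nx psi i w * (b (wend nx i w) - h (wend nx i w))) + wavg k (fun w => g i w ^+ 2)).
  rewrite (eq_wavg (F' := fun w => wsum nx psi i w ^+ 2 + (2 * h i * wsum nx psi i w +
     (2 * (wsum nx psi i w * (b (wend nx i w) - h (wend nx i w))) + g i w ^+ 2)))); last first.
    by move=> w wk; rewrite devE // /g; ring.
  rewrite wavgD wavgD wavgD (wavg_wsum_sqr L_gt0 psi_mean _ _ psi_var) !wavgZ wavg_wsum //.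
  by ring.
apply: (le_trans (ler_normD _ _)); apply: lerD.
  apply: (le_trans (ler_normB _ _)); apply: lerD => //.
  by apply: wavg_bound => // w _.
apply: (le_trans (ler_normD _ _)); apply: lerD.
  by rewrite normrM (normr_nat R 2) ler_wpM2l.
apply: wavg_bound => // w _.
by rewrite normrX lerXn2r ?nnegrE.
Qed.

Lemma dev_cos i p :
  wavg k (fun w => cos (p + dev k i w / Num.sqrt k%:R)) @[k --> \oo] --> expR (- (v / 2)) * cos p.
Proof.
have [B B0 HB] := g_bounded.
have [C C0 HC] := wavg_cos t L_gt0 psi_mean psi_var.
apply/cvgrPdist_le => eps eps0; near=> k.
(* With r = 1 / sqrt k, replacing the deviation by the martingale costs at most B r, and the
   martingale estimate at most 2 C r. *)
have kbig : ((B + 2 * C) / eps) ^+ 2 < k%:R by near: k; exact: nbhs_infty_gtr.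
have k1 : (1 : R) < k%:R by near: k; exact: nbhs_infty_gtr.
set s := Num.sqrt k%:R; have k0 : 0 < k%:R :> R by rewrite (lt_trans ltr01).
have s0 : 0 < s by rewrite sqrtr_gt0.
have s2 : s ^+ 2 = k%:R by rewrite sqr_sqrtr // ltW.
have r0 : 0 < s^-1 by rewrite invr_gt0.
have s1 : 1 <= s by rewrite -sqrtr1 ler_sqrt ?ltW.
have r1 : `|s^-1| <= 1 by rewrite (gtr0_norm r0) invf_le1.
have := HC _ r1 k i p; rewrite (gtr0_norm r0).
have -> : s^-1 ^+ 2 + k%:R * s^-1 ^+ 3 = 2 * s^-1 * s^-1 + s^-1 * (1 - s^-1).
  by rewrite -s2; field; rewrite gt_eqF.
have -> : expR (- (v / 2) * s^-1 ^+ 2) ^+ k = expR (- (v / 2)).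
  by rewrite -expRM_natr -s2; congr expR; field; rewrite gt_eqF.
set X := wavg _ _; set Y := wavg _ _ => H1.
have H2 : `|Y - X| <= B * s^-1.
  have -> : Y - X = wavg k (fun w => cos (p + dev k i w / s) + (-1) * cos (p + s^-1 * wsum nx psi i w)).
    by rewrite wavgD wavgZ mulN1r.
  apply: wavg_bound => // w wk; rewrite mulN1r devE //.
  have -> : p + (wsum nx psi i w + g i w) / s = p + s^-1 * wsum nx psi i w + g i w * s^-1 by ring.
  apply: (le_trans (cos_lipschitz _ _)); rewrite normrM (gtr0_norm r0).
  by apply: ler_wpM2r => //; exact: ltW.
have -> : expR (- (v / 2)) * cos p - Y = - ((Y - X) + (X - expR (- (v / 2)) * cos p)) by ring.
rewrite normrN; apply: (le_trans (ler_normD _ _)); apply: (le_trans (lerD H2 H1)).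
have rr : s^-1 <= 1 by rewrite invf_le1.
apply: (@le_trans _ _ ((B + 2 * C) * s^-1)).
  rewrite [leRHS](_ : _ = B * s^-1 + C * (2 * s^-1)); last by ring.
  rewrite lerD2l ler_wpM2l // -subr_ge0.
  have -> : 2 * s^-1 - (2 * s^-1 * s^-1 + s^-1 * (1 - s^-1)) = s^-1 * (1 - s^-1) by ring.
  by rewrite mulr_ge0 ?subr_ge0 // ltW.
rewrite ler_pdivrMr // [leRHS]mulrC -ler_pdivrMr //.
have BC : 0 <= (B + 2 * C) / eps by rewrite divr_ge0 ?addr_ge0 ?mulr_ge0 // ltW.
rewrite -(ger0_norm BC) -sqrtr_sqr ler_sqrt ?ltW //.
Unshelve. all: by end_near. Qed.

End Deviation.

(** * Aperiodicity *)

Section NumericalSemigroup.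
Variable A : nat -> Prop.
Hypotheses (A0 : A 0%N) (AD : forall a b, A a -> A b -> A (a + b)%N).
Hypothesis A_gcd : forall d, (forall a, A a -> (d %| a)%N) -> d = 1%N.

Let AM k a : A a -> A (k * a)%N.
Proof. by move=> Aa; elim: k => // k IH; rewrite mulSn; exact: AD. Qed.

(* The least positive difference of two elements of [A] divides all of [A]. *)
Lemma numerical_semigroup_cofinite : exists N, forall k, (N <= k)%N -> A k.
Proof.
pose D d := (0 < d)%N /\ exists2 a, A a & A (a + d)%N.
(* Otherwise [A] would consist of 0 alone, and 2 would divide all its elements. *)
have exD : exists d, `[< D d >].
  apply: contrapT => noD.
  have H d a : A a -> (d %| a)%N.
    move=> Aa; case: a Aa => [|a] Aa; first exact: dvdn0.
    by case: noD; exists a.+1; apply/asboolP; split => //; exists 0%N.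
  by have := A_gcd (H 2%N).
have [d /asboolP [d0 [a Aa Aad]] dmin] := ex_minnP exD.
have d1 : d = 1%N.
  apply: A_gcd => k Ak; apply: contrapT => /negP dk.
  have r0 : (0 < k %% d)%N by rewrite lt0n.
  have /dmin : `[< D (k %% d)%N >].
    (* If d does not divide k, then k mod d is a smaller positive difference: adding it to (k / d)
       (a + d) gives k + (k / d) a. *)
    apply/asboolP; split => //; exists (k %/ d * (a + d))%N; first exact: AM.
    rewrite (_ : (_ + _)%N = (k + k %/ d * a)%N); first by apply: AD => //; exact: AM.
    by rewrite mulnDr {4}(divn_eq k d); ring.
  by rewrite leqNgt ltn_pmod.
(* With a and a + 1 in [A], write k = q a + r as (q - r) a + r (a + 1). This needs r <= q, which
   holds for k >= a^2. *)
subst d; exists (a * a)%N => k ka.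
case: (posnP a) => a0.
  by move: Aad; rewrite a0 add0n => A1; rewrite -[k]muln1; exact: AM.
have rq : (k %% a <= k %/ a)%N.
  apply: (leq_trans (ltnW (ltn_pmod k a0))).
  by rewrite leq_divRL.
have -> : k = ((k %/ a - k %% a) * a + (k %% a) * (a + 1))%N.
  have {1}-> := divn_eq k a.
  move: (k %/ a)%N (k %% a)%N rq => q r rq.
  by rewrite -{1}(subnK rq); ring.
by apply: AD; exact: AM.
Qed.

End NumericalSemigroup.

Section UniformReach.
Variables (L : finType) (n : nat) (nx : 'I_n -> L -> 'I_n) (t : 'I_n).
Hypothesis t_reach : forall i, connect (chain_step nx) i t.
Hypothesis t_aper : forall d,
  (forall w, wend nx t w = t -> (d %| size w)%N) -> d = 1%N.

Lemma connect_word i j : connect (chain_step nx) i j -> exists w, wend nx i w = j.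
Proof.
move=> /connectP [p]; elim: p i => [|k p IH] i /=; first by move=> _ ->; exists [::].
move=> /andP[/existsP [l /eqP lk] pp] jE; have [w wE] := IH _ pp jE.
by exists (l :: w); rewrite /wend /= lk.
Qed.

(** The lengths of closed walks at [t] form a semigroup with gcd 1, so all large lengths occur, and
    a path to [t] can be padded by a closed walk at [t]. *)
Lemma uniform_reach : exists2 m : nat, (0 < m)%N & forall i, exists2 w, size w = m & wend nx i w = t.
Proof.
pose A k := exists2 w, size w = k & wend nx t w = t.
have [N HN] : exists N, forall k, (N <= k)%N -> A k.
  apply: numerical_semigroup_cofinite.
  - by exists [::].
  - move=> a b [w wa wt] [w' wb wt']; exists (w ++ w'); first by rewrite size_cat wa wb.
    by rewrite /wend foldl_cat -!/(wend _ _ _) wt.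
  - by move=> d Hd; apply: t_aper => w wt; apply: Hd; exists w.
have /choice [f Hf] : forall i, exists w, wend nx i w = t by move=> i; exact: connect_word.
(* After any of the paths [f i], at least [N] letters are left for the closed walk. *)
exists (N + \sum_i size (f i)).+1%N => // i.
have si : (size (f i) <= \sum_i size (f i))%N by rewrite (bigD1 i) //= leq_addr.
have [|w wk wt] := HN ((N + \sum_i size (f i)).+1 - size (f i))%N.
  by rewrite -addnS -addnBA ?leq_addr // ltnW.
exists (f i ++ w).
  by rewrite size_cat wk subnKC // ltnW // ltnS (leq_trans si) // leq_addl.
by rewrite /wend foldl_cat -!/(wend _ _ _) Hf.
Qed.

End UniformReach.

(** * The chain of a transducer *)

Section TransducerChain.
Variables (R : realType) (T : transducer R) (a : tr_state T -> R).
Hypotheses (Tcomplete : complete_transducer T) (Tdet : deterministic T).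
Notation S := (tr_size T).+1.
Notation letter := (tr_letter T).

Definition tnext : 'I_S -> letter -> 'I_S := @next_state R T.

Definition in_label : 'I_S -> letter -> R := fun _ l => val l.
Definition out_label : 'I_S -> letter -> R := fun s l => tr_delta (s, tnext s l, l).

Lemma card_letter : #|letter| = #|` tr_in T|.
Proof. by rewrite cardfE. Qed.

Lemma tnext_trans s l : (s, tnext s l, l) \in tr_trans T.
Proof.
rewrite /tnext /next_state; case: pickP => //= H.
by have [t st] := Tcomplete s l; have := H t; rewrite st.
Qed.

Lemma trans_tnext s t l : ((s, t, l) \in tr_trans T) = (tnext s l == t).
Proof.
apply/idP/eqP => [H|<-]; last exact: tnext_trans.
exact: Tdet (tnext_trans s l) H.
Qed.

Lemma step_chain : @step R T =2 chain_step tnext.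
Proof. by move=> s t; apply: eq_existsb => l; rewrite trans_tnext. Qed.

Lemma final_reach t : t \in final_states T -> forall s, connect (chain_step tnext) s t.
Proof. by rewrite inE => /forallP H s; rewrite -(eq_connect step_chain). Qed.

Lemma final_closed s l : s \in final_states T -> tnext s l \in final_states T.
Proof.
rewrite !inE => /forallP H; apply/forallP => u; apply: connect_trans (H u) _.
by apply: connect1; apply/existsP; exists l; exact: tnext_trans.
Qed.

Lemma final_transE e : (e \in final_trans T) = (e.1.1 \in final_states T) && (tnext e.1.1 e.2 == e.1.2).
Proof.
case: e => -[s t] l; rewrite inE trans_tnext /= andbC.
case: (boolP (s \in _)) => //= sf; case: eqP => [<-|]; last by rewrite andbF.
by rewrite final_closed.
Qed.

Lemma walk_word s p t : s \in final_states T -> walk s p t -> wend tnext s [seq e.2 | e <- p] = t.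
Proof.
elim: p s => [|e p IH] s sf /=; first by move=> /eqP.
case/and3P => ef /eqP es w; rewrite final_transE es sf /= in ef.
rewrite /wend /= (eqP ef); apply: IH w; rewrite -(eqP ef); exact: final_closed.
Qed.

Lemma final_aperiodic_words t d : finally_aperiodic T -> t \in final_states T ->
  (forall w, wend tnext t w = t -> (d %| size w)%N) -> d = 1%N.
Proof.
move=> Taper tf H; apply: (Taper t tf) => p /(walk_word tf) /H.
by rewrite size_map.
Qed.

Lemma input_sumE (w : seq letter) s : input_sum w = wsum tnext in_label s (rev w).
Proof.
have -> : input_sum w = \sum_(l <- rev w) val l.
  by apply: perm_big; rewrite perm_sym perm_rev.
elim: (rev w) s => [|l w' IH] s; first by rewrite big_nil.
by rewrite big_cons /= (IH (tnext s l)).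
Qed.

Lemma output_sumE (w : seq letter) :
  output_sum a w = wsum tnext out_label (tr_init T) (rev w) + a (wend tnext (tr_init T) (rev w)).
Proof.
rewrite /output_sum /output_seq; elim: (rev w) (tr_init T) => [|l w' IH] s /=.
  by rewrite big_seq1 add0r.
by rewrite big_cons IH addrA.
Qed.

Variables (t0 : tr_state T) (t0f : t0 \in final_states T).
Notation nf := #|final_states T|.

(** The chain restricted to the final component. The default of [enum_rank_in] never shows, because
    the component is closed ([fnextE]). *)
Definition fnext (i : 'I_nf) (l : letter) : 'I_nf := enum_rank_in t0f (tnext (enum_val i) l).

Lemma fnextE i l : enum_val (fnext i l) = tnext (enum_val i) l.
Proof. by rewrite /fnext enum_rankK_in // final_closed // enum_valP. Qed.

Lemma fnext_reach i : connect (chain_step fnext) i (enum_rank_in t0f t0).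
Proof.
have H s t : s \in final_states T -> connect (chain_step tnext) s t ->
    connect (chain_step fnext) (enum_rank_in t0f s) (enum_rank_in t0f t).
  move=> sf /connectP [p]; elim: p s sf => [|u p IH] s sf /=; first by move=> _ ->.
  move=> /andP[/existsP [l /eqP lu] pp] tE.
  apply: (@connect_trans _ _ (enum_rank_in t0f u)).
    apply: connect1; apply/existsP; exists l; apply/eqP; apply: enum_val_inj.
    by rewrite fnextE !enum_rankK_in // -lu ?final_closed.
  by apply: IH => //; rewrite -lu; exact: final_closed.
rewrite -[i](enum_valK_in t0f); apply: H; first exact: enum_valP.
exact: final_reach.
Qed.

(** In a complete deterministic transducer every letter contributes to exactly one entry of each
    row, so the sum over letters divided by K is the tilted transition matrix. *)
Lemma char_funE : char_fun T =
  chain_char fnext (fun l => val l) (fun i l => out_label (enum_val i) l).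
Proof.
apply/funext => x; apply/funext => y; apply/funext => z.
rewrite /char_fun /chain_char; congr (\det (_ - _)).
apply/matrixP => i j; rewrite !mxE summxE /avg card_letter mulrA; congr (_ * _).
apply: eq_bigr => l _; rewrite !mxE /= final_transE /= enum_valP /=.
have -> : (fnext i l == j) = (tnext (enum_val i) l == enum_val j).
  by rewrite -fnextE (inj_eq enum_val_inj).
case: eqP => [E|_]; last by rewrite mul0r mulr0.
by rewrite mul1r /out_label E.
Qed.

End TransducerChain.

(** * Moments and partial derivatives *)

Section Formulas.
Variables (R : realType) (F : R -> R -> R -> R) (l : seq (R * R * R * nat)).
Hypothesis HF : gp l F.

(* The coefficients of [r] and [r ^+ 2] in
   [F (expR (p * r)) (expR (q * r)) (expR (- e * r - v / 2 * r ^+ 2))] vanish. *)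
Definition moment_eqs (p q e v : R) : Prop :=
  \sum_(m <- l) m.1.1.1 * (p * m.1.1.2 + q * m.1.2 - e * m.2%:R) = 0 /\
  \sum_(m <- l) m.1.1.1 * ((p * m.1.1.2 + q * m.1.2 - e * m.2%:R) ^+ 2 - v * m.2%:R) = 0.

Let fx := Dx F 1 1 1. Let fy := Dy F 1 1 1. Let fz := Dz F 1 1 1.
Let fxx := Dx (Dx F) 1 1 1. Let fyy := Dy (Dy F) 1 1 1. Let fzz := Dz (Dz F) 1 1 1.
Let fxy := Dy (Dx F) 1 1 1. Let fxz := Dz (Dx F) 1 1 1. Let fyz := Dz (Dy F) 1 1 1.

(** Second derivatives at 1 produce a (a - 1), so the sum of the coefficients times a^2 is f_xx +
    f_x; likewise for the other variables. Hence the combinations in the formulas. *)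
Lemma moment_eqsE p q e v : moment_eqs p q e v ->
  p * fx + q * fy = e * fz /\
  p ^+ 2 * (fxx + fx) + 2 * p * q * fxy + q ^+ 2 * (fyy + fy) - 2 * e * (p * fxz + q * fyz)
    + e ^+ 2 * (fzz + fz) = v * fz.
Proof.
have [[Ex Ey Ez] [[Exx Eyy Ezz] [Exy Exz Eyz]]] := gp_partials HF.
rewrite /moment_eqs => -[H1 H2]; split; apply/eqP; rewrite -subr_eq0; apply/eqP.
  rewrite -[RHS]H1 /fx /fy /fz Ex Ey Ez !big_distrr /= -big_split -sumrB /=.
  by apply: eq_bigr => m _; ring.
rewrite -[RHS]H2 /fx /fy /fz /fxx /fyy /fzz /fxy /fxz /fyz Ex Ey Ez Exx Eyy Ezz Exy Exz Eyz.
rewrite -!big_split /= !big_distrr /= -!big_split /= big_distrr /= -sumrB -big_split -sumrB /=.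
by apply: eq_bigr => m _; ring.
Qed.

Variables E1 E2 V1 V2 Cc : R.
Hypotheses (H10 : moment_eqs 1 0 E1 V1) (H01 : moment_eqs 0 1 E2 V2)
  (H11 : moment_eqs 1 1 (E1 + E2) (V1 + 2 * Cc + V2)) (fz0 : fz != 0).

Lemma mean_formulas : fx / fz = E1 /\ fy / fz = E2.
Proof.
have [a _] := moment_eqsE H10; have [b _] := moment_eqsE H01.
by split; [have -> : fx = E1 * fz by rewrite -a; ring | have -> : fy = E2 * fz by rewrite -b; ring];
  rewrite mulfK.
Qed.

Lemma variance_formulas :
  [/\ (fx ^+ 2 * (fzz + fz) + fz ^+ 2 * (fxx + fx) - 2 * fx * fz * fxz) / fz ^+ 3 = V1,
      (fy ^+ 2 * (fzz + fz) + fz ^+ 2 * (fyy + fy) - 2 * fy * fz * fyz) / fz ^+ 3 = V2 &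
      (fx * fy * (fzz + fz) + fz ^+ 2 * fxy - fy * fz * fxz - fx * fz * fyz) / fz ^+ 3 = Cc].
Proof.
have [a a'] := moment_eqsE H10; have [b b'] := moment_eqsE H01; have [_ c'] := moment_eqsE H11.
have ex : fx = E1 * fz by rewrite -a; ring.
have ey : fy = E2 * fz by rewrite -b; ring.
have A : (fxx + fx) - 2 * E1 * fxz + E1 ^+ 2 * (fzz + fz) = V1 * fz by rewrite -a'; ring.
have B : (fyy + fy) - 2 * E2 * fyz + E2 ^+ 2 * (fzz + fz) = V2 * fz by rewrite -b'; ring.
have C : fxy - E2 * fxz - E1 * fyz + E1 * E2 * (fzz + fz) = Cc * fz.
  have : 2 * (Cc * fz) = 2 * (fxy - E2 * fxz - E1 * fyz + E1 * E2 * (fzz + fz)).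
    have -> : 2 * (Cc * fz) = (V1 + 2 * Cc + V2) * fz - V1 * fz - V2 * fz by ring.
    by rewrite -c' -A -B; ring.
  by move/(mulfI _) => -> //; rewrite pnatr_eq0.
have z3 : fz ^+ 3 != 0 by rewrite expf_neq0.
split; apply: (mulIf z3); rewrite divfK //.
- rewrite (_ : V1 * fz ^+ 3 = fz ^+ 2 * (V1 * fz)); last by ring.
  by rewrite -A {1 3}ex; ring.
- rewrite (_ : V2 * fz ^+ 3 = fz ^+ 2 * (V2 * fz)); last by ring.
  by rewrite -B {1 3}ey; ring.
- rewrite (_ : Cc * fz ^+ 3 = fz ^+ 2 * (Cc * fz)); last by ring.
  by rewrite -C ex ey; ring.
Qed.

End Formulas.

(** * Finitely valued random variables *)

Section FiniteExpectation.
Context (R : realType) d (Om : measurableType d) (P : probability Om R).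
Variables (W : finType) (X : Om -> W) (pr : W -> R).
Hypothesis XP : forall w, measurable (X @^-1` [set w]) /\ P (X @^-1` [set w]) = (pr w)%:E.

Lemma expectation_finite (F : W -> R) : ('E_P[fun o => F (X o)] = (\sum_w pr w * F w)%:E)%E.
Proof.
rewrite unlock.
have E o : (F (X o))%:E = (\sum_(w <- index_enum W) (F w)%:E * (\1_(X @^-1` [set w]) o)%:E)%E.
  rewrite (bigD1_seq (X o)) ?mem_index_enum ?index_enum_uniq //=.
  rewrite indicE mem_set // mule1 big1 ?adde0 // => w wX.
  rewrite indicE memNset ?mule0 //= => E; by rewrite E eqxx in wX.
under eq_integral do rewrite E.
have ii w : P.-integrable setT (fun o => (F w)%:E * (\1_(X @^-1` [set w]) o)%:E)%E.
  apply: integrableZl => //; apply: integrable_indic => //; first by have [] := XP w.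
rewrite integral_sum //.
rewrite -sumEFin; apply: eq_bigr => w _.
have [mw pw] := XP w.
rewrite integralZl //; last first.
  exact: integrable_indic.
transitivity ((F w)%:E * (pr w)%:E)%E; last by rewrite -EFinM mulrC.
by congr (_ * _)%E; rewrite integral_indic // setIT; exact: pw.
Qed.

Lemma covariance_finite (F G : W -> R) :
  (covariance P (fun o => F (X o)) (fun o => G (X o)) =
   (\sum_w pr w * ((F w - \sum_u pr u * F u) * (G w - \sum_u pr u * G u)))%:E)%E.
Proof.
rewrite covariance.unlock !expectation_finite /=.
exact: (expectation_finite (fun w => (F w - \sum_u pr u * F u) * (G w - \sum_u pr u * G u))).
Qed.

End FiniteExpectation.

(** * Independence *)

Section Independence.
Context (R : realType) d (Om : measurableType d) (Q : probability Om R).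
Variables (U V : {RV Q >-> R}).
Hypothesis UV : independent_rv U V.

Lemma measurable_cos : measurable_fun [set: R] (@cos R).
Proof. by apply: continuous_measurable_fun; exact: continuous_cos. Qed.

Let integrable_cos_prob d' (T' : measurableType d') (P' : probability T' R) (f : T' -> R) :
  measurable_fun setT f -> P'.-integrable setT (fun x => (cos (f x))%:E).
Proof.
move=> mf; apply: (@le_integrable _ _ _ P' setT measurableT _ (EFin \o cst 1)).
- by apply/measurable_EFinP; apply: measurableT_comp mf; exact: measurable_cos.
- by move=> x _ /=; rewrite lee_fin normr1 cos_abs_le1.
- exact: finite_measure_integrable_cst.
Qed.

(** Independence says that the joint law and the product of the marginals agree on rectangles, hence
    everywhere, and then Fubini applies. *)
Lemma independent_integral_cos :
  (\int[Q]_o (cos (U o) * cos (V o))%:E = (\int[Q]_o (cos (U o))%:E) * (\int[Q]_o (cos (V o))%:E))%E.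
Proof.
have mW : measurable_fun setT (fun o => (U o, V o) : R * R).
  by apply: measurable_fun_pair; exact: measurable_funP.
pose W : {RV Q >-> (R * R)%type} :=
  HB.pack (fun o => (U o, V o) : R * R)
   (isMeasurableFun.Build _ _ _ _ _ mW).
pose m1 := distribution Q U; pose m2 := distribution Q V.
pose f (w : R * R) := (cos w.1 * cos w.2)%:E.
have mf : measurable_fun setT f.
  by apply/measurable_EFinP; apply: measurable_funM; apply: measurableT_comp => //; exact: measurable_cos.
have f1 w : `|cos w.1 * cos w.2| <= 1 :> R.
  by rewrite normrM -[leRHS]mul1r ler_pM ?cos_abs_le1.
have W12 A : measurable A -> (m1 \x m2)%E A = distribution Q W A.
  apply: product_measure_unique => A1 A2 mA1 mA2.
  exact: UV.
have -> : (\int[Q]_o (cos (U o) * cos (V o))%:E = \int[distribution Q W]_w f w)%E.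
  rewrite integral_distribution //.
  apply: (@le_integrable _ _ _ Q setT measurableT _ (EFin \o cst 1)).
  - by apply: measurableT_comp mf _; exact: measurable_funP.
  - by move=> x _ /=; rewrite lee_fin normr1; exact: (f1 (U x, V x)).
  - exact: finite_measure_integrable_cst.
rewrite (eq_measure_integral (m1 \x m2)%E); last by move=> A mA _; apply/esym; exact: W12.
have fi : (m1 \x m2)%E.-integrable setT f.
  apply/integrableP; split => //.
  apply: (@le_lt_trans _ _ (\int[m1 \x m2]_w cst 1%E w)%E).
    apply: ge0_le_integral => //.
    - by apply: measurableT_comp mf.
    - by move=> w _; rewrite lee_fin; exact: f1.
  rewrite integral_cst // mul1e.
  apply: (@le_lt_trans _ _ 1%E); last by rewrite ltry.
  rewrite le_eqVlt; apply/orP; left; apply/eqP.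
  exact: (etrans (W12 _ measurableT) (probability_setT _)).
rewrite -(integral12_prod_meas1 fi) /fubini_F /f /=.
have i2 : m2.-integrable setT (fun y => (cos y)%:E) by exact: integrable_cos_prob.
have i1 : m1.-integrable setT (fun y => (cos y)%:E) by exact: integrable_cos_prob.
have E2 : (\int[m2]_y (cos y)%:E = \int[Q]_o (cos (V o))%:E)%E.
  rewrite integral_distribution //; last exact: integrable_cos_prob.
  by apply/measurable_EFinP; exact: measurable_cos.
have E1 : (\int[m1]_y (cos y)%:E = \int[Q]_o (cos (U o))%:E)%E.
  rewrite integral_distribution //; last exact: integrable_cos_prob.
  by apply/measurable_EFinP; exact: measurable_cos.
rewrite -E1 -E2.
under eq_integral do (under eq_integral do rewrite EFinM).
under eq_integral do rewrite integralZl //.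
have fin2 : (\int[m2]_y (cos y)%:E)%E \is a fin_num by exact: integrable_fin_num i2.
rewrite -(fineK fin2).
by rewrite integralZr.
Qed.

End Independence.

Section ProductNormal.
Variables (R : realType) (s1 s2 : R).
Hypothesis s2_gt0 : 0 < s2.
Notation mu := (@lebesgue_measure R).

Lemma integral_rect_normal (A B : set R) : measurable A -> measurable B ->
  (\int[mu \x mu]_(w in A `*` B) (cond_normal_pdf 0 s1 s2 w)%:E =
   (\int[mu]_(x in A) (normal_pdf 0 s1 x)%:E) * (\int[mu]_(y in B) (normal_pdf 0 s2 y)%:E))%E.
Proof.
move=> mA mB; rewrite integral_mkcond fubini_tonelli1 /=; first last.
- by move=> w; apply: erestrict_ge0 => x _; rewrite lee_fin cond_normal_pdf_ge0.
- apply/(measurable_restrictT _ _).1; first exact: measurableX.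
  by apply: measurable_funTS; apply/measurable_EFinP; apply: measurable_cond_normal_pdf.
have iB : mu.-integrable B (fun y => (normal_pdf 0 s2 y)%:E).
  by apply: (integrableS measurableT) => //; exact: integrable_normal_pdf.
have iA : mu.-integrable A (fun y => (normal_pdf 0 s1 y)%:E).
  by apply: (integrableS measurableT) => //; exact: integrable_normal_pdf.
have inner x : fubini_F mu ((fun w => (cond_normal_pdf 0 s1 s2 w)%:E) \_ (A `*` B)) x =
   (((fun x => (normal_pdf 0 s1 x)%:E) \_ A) x * (\int[mu]_(y in B) (normal_pdf 0 s2 y)%:E))%E.
  rewrite /fubini_F [in RHS]patchE; case: ifPn => xA.
    rewrite -integralZl // [RHS]integral_mkcond; apply: eq_integral => y _.
    rewrite !patchE in_setX xA /=; case: ifP => // _.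
    by rewrite /cond_normal_pdf /= mul0r EFinM.
  rewrite mul0e integral0_eq // => y _.
  by rewrite patchE in_setX (negbTE xA).
transitivity (\int[mu]_x (((fun x => (normal_pdf 0 s1 x)%:E) \_ A) x * (\int[mu]_(y in B) (normal_pdf 0
    s2 y)%:E)))%E.
  by apply: eq_integral => x _; exact: inner.
have finB : (\int[mu]_(y in B) (normal_pdf 0 s2 y)%:E)%E \is a fin_num by exact: integrable_fin_num iB.
rewrite -(fineK finB) integralZr //.
  by rewrite -integral_mkcond.
by rewrite -integrable_mkcond.
Qed.

End ProductNormal.

(** * Regular covariance matrices *)

Section Mx22.
Variable R : realType.
Implicit Types a b c d : R.

Lemma ord2P (i : 'I_2) : i = ord0 \/ i = ord_max.
Proof. by case: i => [[|[|]]] // H; [left|right]; apply: val_inj. Qed.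

Lemma det_mx22 a b c d : \det (mx22 a b c d) = a * d - b * c.
Proof.
rewrite (expand_det_row _ ord0) !big_ord_recl big_ord0 /cofactor !det_mx11 !mxE /=.
by rewrite /bump /=; ring.
Qed.

Lemma mx22_unit a b c d : (mx22 a b c d \in unitmx) = (a * d - b * c != 0).
Proof. by rewrite unitmxE unitfE det_mx22. Qed.

Lemma quad2E (H : 'M[R]_2) (v : 'cV[R]_2) : (v^T *m H *m v) ord0 ord0 =
  H ord0 ord0 * v ord0 ord0 ^+ 2 + (H ord0 ord_max + H ord_max ord0) * (v ord0 ord0 * v ord_max ord0)
   + H ord_max ord_max * v ord_max ord0 ^+ 2.
Proof.
rewrite mxE big_ord_recl big_ord_recl big_ord0 !mxE !big_ord_recl !big_ord0 !mxE.
have -> : lift ord0 ord0 = ord_max :> 'I_2 by apply: val_inj.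
by ring.
Qed.

Lemma invmx_mx22 a b c d : a * d - b * c != 0 ->
  invmx (mx22 a b c d) = (a * d - b * c)^-1 *: mx22 d (- b) (- c) a.
Proof.
move=> D0.
have E : mx22 a b c d *m ((a * d - b * c)^-1 *: mx22 d (- b) (- c) a) = 1%:M.
  apply/matrixP => i j; rewrite mxE !big_ord_recl big_ord0.
  have -> : lift ord0 ord0 = ord_max :> 'I_2 by apply: val_inj.
  by case: (ord2P i) => ->; case: (ord2P j) => ->; rewrite !mxE /=; field.
by rewrite -[LHS]mulmx1 -E mulKmx // mx22_unit.
Qed.

End Mx22.

Section BinormalDensity.
Variables (R : realType) (v1 v2 c : R).
Hypotheses (v1_gt0 : 0 < v1) (det_gt0 : 0 < v1 * v2 - c * c).

Let s1 := Num.sqrt v1.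
Let s2 := Num.sqrt ((v1 * v2 - c * c) / v1).

Let s1_gt0 : 0 < s1. Proof. by rewrite sqrtr_gt0. Qed.
Let s2_gt0 : 0 < s2. Proof. by rewrite sqrtr_gt0 divr_gt0. Qed.
Let s1E : s1 ^+ 2 = v1. Proof. by rewrite sqr_sqrtr // ltW. Qed.
Let s2E : s2 ^+ 2 = (v1 * v2 - c * c) / v1. Proof. by rewrite sqr_sqrtr // divr_ge0 // ltW. Qed.

Lemma covariance_mx22 : covariance_mx (mx22 v1 c c v2).
Proof.
split.
  by apply/matrixP => i j; case: (ord2P i) => ->; case: (ord2P j) => ->; rewrite !mxE.
move=> u; rewrite quad2E !mxE /=.
set x := u ord0 ord0; set y := u ord_max ord0.
have -> : v1 * x ^+ 2 + (c + c) * (x * y) + v2 * y ^+ 2 =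
   ((v1 * x + c * y) ^+ 2 + (v1 * v2 - c * c) * y ^+ 2) / v1.
  by field; rewrite gt_eqF.
apply: divr_ge0; last exact: ltW.
by apply: addr_ge0; [exact: sqr_ge0 | apply: mulr_ge0; [exact: ltW | exact: sqr_ge0]].
Qed.

(** Completing the square: [v1] is the variance of the first coordinate, c / v1 the regression
    slope, and det / v1 the conditional variance of the second. *)
Lemma binormal_pdfE w : binormal_pdf (0, 0) (mx22 v1 c c v2) w = cond_normal_pdf (c / v1) s1 s2 w.
Proof.
have v1n : v1 != 0 by rewrite gt_eqF.
have dn : v1 * v2 - c * c != 0 by rewrite gt_eqF.
rewrite /binormal_pdf quad2E invmx_mx22 // det_mx22 !mxE /= !subr0.
rewrite /cond_normal_pdf !normal_pdfE ?gt_eqF // /normal_fun /normal_peak s1E s2E.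
rewrite [RHS]mulrACA -expRD [LHS]mulrC; congr (_ * expR _); last first.
  rewrite -[v1 *+ 2]mulr_natl -[(_ / v1) *+ 2]mulr_natl.
  by field; rewrite v1n dn.
rewrite -invfM; congr (_^-1); rewrite -sqrtrM; last by rewrite mulrn_wge0 // mulr_ge0 ?ltW // pi_gt0.
have -> : v1 * pi *+ 2 * ((v1 * v2 - c * c) / v1 * pi *+ 2) = (2 * pi) ^+ 2 * (v1 * v2 - c * c).
  by rewrite -[v1 * pi *+ 2]mulr_natl -[(_ / v1 * pi) *+ 2]mulr_natl; field.
rewrite sqrtrM ?sqr_ge0 // sqrtr_sqr ger0_norm // mulr_ge0 //; exact: pi_ge0.
Qed.

End BinormalDensity.

Section BinormalLine.
Context (R : realType) d (Om : measurableType d) (Q : probability Om R).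
Variables (U V : {RV Q >-> R}).
Hypothesis UV : nondegenerate_binormal U V.
Notation mu := (@lebesgue_measure R).

Lemma measurable_binormal_pdf (m : R * R) (H : 'M[R]_2) :
  measurable_fun [set: R * R] (binormal_pdf m H).
Proof.
have -> : binormal_pdf m H = (fun w => expR (- (invmx H ord0 ord0 * (w.1 - m.1) ^+ 2 +
  (invmx H ord0 ord_max + invmx H ord_max ord0) * ((w.1 - m.1) * (w.2 - m.2)) +
  invmx H ord_max ord_max * (w.2 - m.2) ^+ 2) / 2) / (2 * pi * Num.sqrt (\det H))).
  by apply/funext => w; rewrite /binormal_pdf quad2E !mxE.
apply: measurable_funM => //; apply: measurableT_comp => //.
apply: measurable_funM => //; apply: measurableT_comp => //.
have m1 : measurable_fun [set: R * R] (fun w => w.1 - m.1) by apply: measurable_funB.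
have m2 : measurable_fun [set: R * R] (fun w => w.2 - m.2) by apply: measurable_funB.
apply: measurable_funD; first apply: measurable_funD.
- by apply: measurable_funM => //; apply: measurable_funX.
- by apply: measurable_funM => //; apply: measurable_funM.
- by apply: measurable_funM => //; apply: measurable_funX.
Qed.

(** As [V] has coefficient 1, each vertical section of the line is a single point, so the line is a
    null set for the plane Lebesgue measure. *)
Lemma binormal_line_null (s : R) : Q [set o | s * U o + V o = 0] = 0%E.
Proof.
have [m [H [_ _ HB]]] := UV.
have mf : measurable_fun [set: R * R] (fun w : R * R => s * w.1 + w.2).
  by apply: measurable_funD => //; apply: measurable_funM.
pose B : set (R * R) := (fun w => s * w.1 + w.2) @^-1` [set 0].
have mB : measurable B.
  by rewrite /B -[X in measurable X]setTI; apply: mf => //; exact: measurable_set1.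
have -> : Q [set o | s * U o + V o = 0] = Q [set o | B (U o, V o)] by [].
rewrite HB //; apply: null_set_integral.
- exact: mB.
- by apply: measurable_funTS; apply/measurable_EFinP; exact: measurable_binormal_pdf.
rewrite /= /product_measure1 /=.
rewrite integral0_eq // => x _ /=.
have -> : xsection B x = [set - (s * x)].
  apply/seteqP; split => y; rewrite /xsection /= inE /B /=.
    by move=> /eqP; rewrite addrC addr_eq0 => /eqP.
  by move=> ->; rewrite addrN.
exact: lebesgue_measure_set1.
Qed.

End BinormalLine.

(** * Moments of input and output *)

Section TransducerMoments.
Variables (R : realType) (T : transducer R) (a : tr_state T -> R).
Hypotheses (Tcomplete : complete_transducer T) (Tdet : deterministic T).
Hypothesis Taper : finally_aperiodic T.
Hypothesis K2 : (2 <= #|` tr_in T|)%N.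
Variables (t0 : tr_state T) (t0f : t0 \in final_states T).
Notation letter := (tr_letter T).
Notation nx := (@tnext R T).
Notation init := (tr_init T).

Let L_gt0 : (0 < #|letter|)%N.
Proof. by rewrite card_letter; apply: leq_trans K2. Qed.

Definition in_mean : R := avg (fun l : letter => val l).
Definition in_var : R := avg (fun l : letter => (val l - in_mean) ^+ 2).

(** Variance 0 would make all letters equal, against K >= 2. This allows the later divisions by
    [v1]. *)
Lemma in_var_gt0 : 0 < in_var.
Proof.
rewrite lt_neqAle andbC; apply/andP; split.
  by rewrite -(avg_cst L_gt0 0); apply: avg_le => l; exact: sqr_ge0.
apply/eqP => V0.
have H (l : letter) : val l = in_mean.
  have : - (val l - in_mean) ^+ 2 = 0.
    apply: (avg_max L_gt0 (f := fun l : letter => - (val l - in_mean) ^+ 2)) => [l'|].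
      by rewrite oppr_le0 sqr_ge0.
    have -> : avg (fun l : letter => - (val l - in_mean) ^+ 2) = - in_var.
      by rewrite -[RHS]mulN1r -avgZ; apply: eq_avg => l'; rewrite mulN1r.
    by rewrite -V0 oppr0.
  by move/eqP; rewrite oppr_eq0 sqrf_eq0 subr_eq0 => /eqP.
move: K2; rewrite -card_letter => /card_gt1P [l [l' [_ _ /eqP ll']]].
by apply: ll'; apply: val_inj; rewrite /= !H.
Qed.

Lemma in_varE : in_var = avg (fun l : letter => val l ^+ 2) - in_mean ^+ 2.
Proof.
rewrite /in_var (eq_avg (g := fun l : letter => val l ^+ 2 + ((- 2 * in_mean) * val l + in_mean ^+ 2)));
    last first.
  by move=> l; ring.
by rewrite avgD avgD avgZ avg_cst // -/in_mean; ring.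
Qed.

Variables (E2 : R) (h2 : 'I_(tr_size T).+1 -> R).
Let psi1 (i : 'I_(tr_size T).+1) (l : letter) : R := val l - in_mean.
Let psi2 i l : R := out_label i l - E2 + h2 (nx i l) - h2 i.
Hypothesis psi2_mean : forall i, avg (psi2 i) = 0.
Variables (Cc V2 : R) (hc hv : 'I_(tr_size T).+1 -> R).
Hypothesis psi12_var : forall i, avg (fun l => psi1 i l * psi2 i l) =
  Cc + hc i - avg (fun l => hc (nx i l)).
Hypothesis psi2_var : forall i, avg (fun l => psi2 i l ^+ 2) =
  V2 + hv i - avg (fun l => hv (nx i l)).

Definition mixed_var p q : R := p ^+ 2 * in_var + 2 * p * q * Cc + q ^+ 2 * V2.

Let theta p q i (l : letter) : R := p * in_label i l + q * @out_label R T i l.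
Let e_ p q : R := p * in_mean + q * E2.
Let h_ q i : R := q * h2 i.
Let h'_ p q i : R := 2 * p * q * hc i + q ^+ 2 * hv i.

Let psiE p q i l : theta p q i l - e_ p q + h_ q (nx i l) - h_ q i = p * psi1 i l + q * psi2 i l.
Proof. by rewrite /theta /e_ /h_ /psi1 /psi2 /in_label; ring. Qed.

Let psi1_mean i : avg (psi1 i) = 0.
Proof. by rewrite /psi1 avgB avg_cst // subrr. Qed.

Let psi_mean p q i : avg (fun l => theta p q i l - e_ p q + h_ q (nx i l) - h_ q i) = 0.
Proof.
by under eq_fun do rewrite psiE; rewrite avgD !avgZ psi1_mean psi2_mean !mulr0 addr0.
Qed.

Let psi_var p q i : avg (fun l => (theta p q i l - e_ p q + h_ q (nx i l) - h_ q i) ^+ 2) =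
  mixed_var p q + h'_ p q i - avg (fun l => h'_ p q (nx i l)).
Proof.
rewrite (eq_avg (g := fun l => p ^+ 2 * psi1 i l ^+ 2 + ((2 * p * q) * (psi1 i l * psi2 i l) + q ^+ 2 *
    psi2 i l ^+ 2))); last first.
  by move=> l; rewrite psiE; ring.
rewrite avgD avgD !avgZ psi12_var psi2_var /h'_ avgD !avgZ /mixed_var -/in_var.
by rewrite /psi1 -/in_var; ring.
Qed.

Definition in_dev k (w : seq letter) : R := wsum nx (@in_label R T) init w - in_mean * k%:R.
Definition out_dev k (w : seq letter) : R :=
  wsum nx (@out_label R T) init w + a (wend nx init w) - E2 * k%:R.

Let devE p q k w : dev nx (theta p q) (e_ p q) (fun i => q * a i) k init w =
  p * in_dev k w + q * out_dev k w.
Proof. by rewrite /dev /theta wsumD !wsumZ /in_dev /out_dev /e_; ring. Qed.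

Lemma mixed_mean p q : exists2 C : R, 0 <= C &
  forall k, `|wavg k (fun w => p * in_dev k w + q * out_dev k w)| <= C.
Proof.
have [C C0 HC] := dev_mean L_gt0 (psi_mean p q) (fun i => q * a i).
by exists C => // k; under eq_fun do rewrite -devE; exact: HC.
Qed.

Lemma mixed_sqr p q : exists2 C : R, 0 <= C &
  forall k, `|wavg k (fun w => (p * in_dev k w + q * out_dev k w) ^+ 2) - k%:R * mixed_var p q| <= C.
Proof.
have [m m0 reach] := uniform_reach (final_reach Tcomplete Tdet t0f)
  (fun d => @final_aperiodic_words R T Tcomplete Tdet t0 d Taper t0f).
have [C C0 HC] := dev_sqr L_gt0 (psi_mean p q) (psi_var p q) (fun i => q * a i) m0 reach.
by exists C => // k; under eq_fun do rewrite -devE; exact: HC.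
Qed.

Lemma mixed_cos p q th :
  wavg k (fun w => cos (th + (p * in_dev k w + q * out_dev k w) / Num.sqrt k%:R)) @[k --> \oo]
    --> expR (- (mixed_var p q / 2)) * cos th.
Proof.
have := dev_cos t0 L_gt0 (psi_mean p q) (psi_var p q) (fun i => q * a i) init (p := th).
by under eq_fun do (under eq_fun do rewrite devE).
Qed.

Lemma mixed_var_ge0 p q : 0 <= mixed_var p q.
Proof. exact: (chain_var_ge0 t0 L_gt0 (psi_var p q)). Qed.

Lemma in_devE k w : size w = k -> in_dev k w = wsum nx psi1 init w.
Proof.
move=> wk; rewrite /in_dev (wsum_telescope nx _ in_mean (fun=> 0)) wk.
have -> : (fun i l => in_label i l - in_mean + 0 - 0) = psi1.
  by apply/funext => i; apply/funext => l; rewrite addr0 subr0.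
by ring.
Qed.

Lemma in_dev_mean k : wavg k (in_dev k) = 0.
Proof. by rewrite (eq_wavg (@in_devE k)) wavg_wsum. Qed.

Lemma in_dev_sqr k : wavg k (fun w => in_dev k w ^+ 2) = k%:R * in_var.
Proof.
rewrite (eq_wavg (F' := fun w => wsum nx psi1 init w ^+ 2)); last by move=> w /in_devE ->.
rewrite (wavg_wsum_sqr (h' := fun=> 0) L_gt0 psi1_mean (v := in_var)).
  by rewrite wavg_cst // addr0 subr0.
by move=> i; rewrite avg_cst // addr0 subr0.
Qed.

(** The correctors satisfy their equations on all states. The final component is closed, so their
    restrictions along [enum_val] satisfy them for the chain that defines [char_fun]. *)
Lemma char_fun_moment_eqs l p q : gp l (char_fun T) ->
  moment_eqs l p q (p * in_mean + q * E2) (mixed_var p q).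
Proof.
rewrite (char_funE Tcomplete Tdet t0f) => H.
have M := @chain_char_moments R letter _ (fnext t0f) (enum_rank_in t0f t0) L_gt0
  (fun l => val l) (fun i l => out_label (enum_val i) l) p q (e_ p q) (mixed_var p q)
  (fun i => h_ q (enum_val i)) (fun i => h'_ p q (enum_val i)).
have [||_ m1 m2] := M _ _ l H; last by split.
- move=> i; rewrite -[RHS](psi_mean p q (enum_val i)); apply: eq_avg => l'.
  by rewrite fnextE.
- move=> i; have := psi_var p q (enum_val i).
  rewrite (eq_avg (g := fun l => (p * val l + q * out_label (enum_val i) l - e_ p q +
      h_ q (enum_val (fnext t0f i l)) - h_ q (enum_val i)) ^+ 2)); last first.
    by move=> l'; rewrite fnextE.
  move=> ->; congr (_ - _); apply: eq_avg => l'; by rewrite fnextE.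
Qed.

Lemma char_fun_z_neq0 l : gp l (char_fun T) -> Dz (char_fun T) 1 1 1 != 0.
Proof.
move=> H; have [[_ _ ->] _] := gp_partials H; move: H.
rewrite (char_funE Tcomplete Tdet t0f); apply: chain_char_z_neq0 => //.
exact: fnext_reach.
Qed.

End TransducerMoments.

Section Existence.
Variables (R : realType) (T : transducer R).
Hypotheses (Tcomplete : complete_transducer T) (Tdet : deterministic T).
Hypothesis K2 : (2 <= #|` tr_in T|)%N.
Variables (t0 : tr_state T) (t0f : t0 \in final_states T).
Notation nx := (@tnext R T).

Lemma transducer_poisson : exists E2 h2 Cc V2 hc hv,
  let psi2 i l : R := out_label i l - E2 + h2 (nx i l) - h2 i in
  [/\ forall i, avg (psi2 i) = 0,
      forall i, avg (fun l => (val l - @in_mean R T) * psi2 i l) = Cc + hc i - avg (fun l => hc (nx i l)) &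
      forall i, avg (fun l => psi2 i l ^+ 2) = V2 + hv i - avg (fun l => hv (nx i l))].
Proof.
have L_gt0 : (0 < #|tr_letter T|)%N by rewrite card_letter; apply: leq_trans K2.
have poisson := @poisson_solvable R _ _ nx t0 L_gt0 (final_reach Tcomplete Tdet t0f).
have [E2 [h2 H2]] := poisson (fun i => avg (fun l => out_label i l)).
pose psi2 i l : R := out_label i l - E2 + h2 (nx i l) - h2 i.
have [Cc [hc Hc]] := poisson (fun i => avg (fun l => (val l - @in_mean R T) * psi2 i l)).
have [V2 [hv Hv]] := poisson (fun i => avg (fun l => psi2 i l ^+ 2)).
exists E2, h2, Cc, V2, hc, hv; split => // i.
by rewrite avgB avgD avgB !avg_cst // H2; ring.
Qed.

End Existence.

(** * Limit laws *)

Lemma measurable_fstR (R : realType) : @measurable_fun _ _ (measurableTypeR R * measurableTypeR R)%type R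
  setT (fun w => w.1).
Proof. move=> mD B mB; exact: (@measurable_fst _ _ (measurableTypeR R) (measurableTypeR R) mD B mB). Qed.

Lemma measurable_sndR (R : realType) : @measurable_fun _ _ (measurableTypeR R * measurableTypeR R)%type R
  setT (fun w => w.2).
Proof. move=> mD B mB; exact: (@measurable_snd _ _ (measurableTypeR R) (measurableTypeR R) mD B mB). Qed.

Section Laws.
Context (R : realType) (L : finType).
Hypothesis L_gt0 : (0 < #|L|)%N.
Context (d : nat -> measure_display) (Om : forall n, measurableType (d n))
  (P : forall n, probability (Om n) R) (X : forall n, Om n -> n.-tuple L).
Hypothesis Xunif : forall n (w : n.-tuple L),
  measurable (@X n @^-1` [set w]) /\ P n (@X n @^-1` [set w]) = ((#|L|%:R ^+ n)^-1)%:E.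
Variables (D1 D2 : nat -> seq L -> R) (v1 v2 c : R).
Let V s t : R := s ^+ 2 * v1 + 2 * s * t * c + t ^+ 2 * v2.
Hypothesis v1_gt0 : 0 < v1.
Hypothesis V_ge0 : forall s t, 0 <= V s t.
Hypothesis V_sqr : forall s t, exists2 C : R, 0 <= C &
  forall k, `|wavg k (fun w => (s * D1 k w + t * D2 k w) ^+ 2) - k%:R * V s t| <= C.
Hypothesis V_cos : forall s t th,
  wavg k (fun w => cos (th + (s * D1 k w + t * D2 k w) / Num.sqrt k%:R)) @[k --> \oo]
    --> expR (- (V s t / 2)) * cos th.

Let z n (w : seq L) : R * R := (D1 n w / Num.sqrt n%:R, D2 n w / Num.sqrt n%:R).
Let Z n (o : Om n) : R * R := z n (rev (X o)).

Lemma expectation_words n (F : seq L -> R) :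
  ('E_(P n)[fun o => F (rev (X o))] = (wavg n F)%:E)%E.
Proof.
have := expectation_finite (@Xunif n) (fun w => F (rev w)) => ->.
by rewrite -wavg_rev wavg_tuple -big_distrr.
Qed.

Lemma covariance_words n (F H : seq L -> R) :
  (covariance (P n) (fun o => F (rev (X o))) (fun o => H (rev (X o))) =
   (wavg n (fun w => (F w - wavg n F) * (H w - wavg n H)))%:E)%E.
Proof.
rewrite (covariance_finite (@Xunif n) (fun w => F (rev w)) (fun w => H (rev w))).
have E (f : seq L -> R) : \sum_(w : n.-tuple L) (#|L|%:R ^+ n)^-1 * f (rev w) = wavg n f.
  by rewrite -big_distrr /= -(wavg_tuple n (fun w => f (rev w))) wavg_rev.
by rewrite !E (E (fun w => (F w - wavg n F) * (H w - wavg n H))).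
Qed.

Let z_sqr n s t w : (s * (z n w).1 + t * (z n w).2) ^+ 2 = n%:R^-1 * (s * D1 n w + t * D2 n w) ^+ 2.
Proof.
rewrite /z /= -[in RHS](@sqr_sqrtr _ n%:R) ?ler0n // -exprVn -exprMn; congr (_ ^+ 2); ring.
Qed.

Let z_sqr_bounded s t : exists2 C : R, 0 <= C &
  forall n, wavg n (fun w => (s * (z n w).1 + t * (z n w).2) ^+ 2) <= V s t + C * n%:R^-1.
Proof.
have [C C0 HC] := V_sqr s t; exists C => // n.
under eq_fun do rewrite z_sqr; rewrite wavgZ.
(* For n = 0 the inverse of 0 is 0, and the claim reduces to [V s t] being nonnegative. *)
case: n => [|n]; first by rewrite invr0 mul0r mulr0 addr0.
have n0 : 0 < n.+1%:R :> R by rewrite ltr0n.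
have := HC n.+1; rewrite ler_norml => /andP[_]; rewrite lerBlDl => H.
rewrite mulrC ler_pdivrMr // mulrDl divfK ?gt_eqF //.
by rewrite [V s t * _]mulrC.
Qed.

Lemma laws_cvg (d' : measure_display) (Om' : measurableType d') (Q : probability Om' R)
    (W : Om' -> R * R) :
  measurable_fun setT (fun o => (W o).1) -> measurable_fun setT (fun o => (W o).2) ->
  (forall th s t, \int[Q]_o cos (th + s * (W o).1 + t * (W o).2) = expR (- (V s t / 2)) * cos th) ->
  cvg_in_distribution P Z Q W.
Proof.
move=> mW1 mW2 HW g cg [M [_ HM]].
have gB w : `|g w| <= M + 1 by apply: (HM (M + 1)) => //; rewrite ltrDl.
pose p n (w : n.-tuple L) : R := (#|L|%:R ^+ n)^-1.
pose zz n (w : n.-tuple L) : R * R := z n (rev w).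
have sumE n (F : seq L -> R) : \sum_(w : n.-tuple L) p n w * F (rev w) = wavg n F.
  by rewrite -big_distrr /= -(wavg_tuple n (fun w => F (rev w))) wavg_rev.
have p0 n w : 0 <= p n w by rewrite invr_ge0 exprn_ge0.
have p1 n : \sum_w p n w = 1.
  by rewrite -(wavg_cst L_gt0 n 1) -sumE; apply: eq_bigr => w _; rewrite mulr1.
have [C1 C10 H1] := z_sqr_bounded 1 0; have [C2 C20 H2] := z_sqr_bounded 0 1.
have pC n : \sum_w p n w * ((zz n w).1 ^+ 2 + (zz n w).2 ^+ 2) <= (V 1 0 + C1) + (V 0 1 + C2).
  rewrite (sumE n (fun w => (z n w).1 ^+ 2 + (z n w).2 ^+ 2)) wavgD.
  have inv1 : (n%:R : R)^-1 <= 1 by case: n => [|n]; rewrite ?invr0 // invf_le1 ?ltr0n // ler1n.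
  apply: lerD.
    rewrite (eq_wavg (F' := fun w => (1 * (z n w).1 + 0 * (z n w).2) ^+ 2)); last first.
      by move=> w _; congr (_ ^+ 2); ring.
    by apply: (le_trans (H1 n)); rewrite lerD2l ler_piMr.
  rewrite (eq_wavg (F' := fun w => (0 * (z n w).1 + 1 * (z n w).2) ^+ 2)); last first.
    by move=> w _; congr (_ ^+ 2); ring.
  by apply: (le_trans (H2 n)); rewrite lerD2l ler_piMr.
have cf th s t : (\sum_w p n w * cos (th + s * (zz n w).1 + t * (zz n w).2)) @[n --> \oo] -->
    \int[Q]_o cos (th + s * (W o).1 + t * (W o).2).
  rewrite HW; have := @V_cos s t th; apply: cvg_trans; apply: near_eq_cvg; apply: nearW => n.
  rewrite (sumE n (fun w => cos (th + s * (z n w).1 + t * (z n w).2))).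
  by apply: eq_wavg => w _; congr cos; rewrite /z /=; ring.
have [ig cv] := levy_cvg p0 p1 pC mW1 mW2 cf cg gB.
have -> : ('E_Q[fun o => g (W o)] = (\int[Q]_o g (W o))%R%:E)%E.
  by rewrite unlock /Rintegral fineK //; exact: integrable_fin_num ig.
apply/fine_cvgP; split.
  by apply: nearW => n; rewrite (@expectation_words n (fun w => g (z n w))).
move: cv; apply: cvg_trans; apply: near_eq_cvg; apply: nearW => n /=.
by rewrite (@expectation_words n (fun w => g (z n w))) /= -sumE.
Qed.

Section Limit.
Context (d' : measure_display) (Om' : measurableType d') (Q : probability Om' R).
Variables U U' : {RV Q >-> R}.
Hypothesis UU' : cvg_in_distribution P Z Q (fun o => (U o, U' o)).

Let continuous_lin (s t : R) : continuous (fun w : R * R => s * w.1 + t * w.2).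
Proof.
move=> w; apply: cvgD; apply: cvgM; try exact: cvg_cst; [exact: cvg_fst|exact: cvg_snd].
Qed.

Lemma laws_limit_cos (th s t : R) :
  ('E_Q[fun o => (cos (th + s * U o + t * U' o))%R] = (expR (- (V s t / 2)) * cos th)%R%:E)%E.
Proof.
pose g (w : R * R) := cos (th + (s * w.1 + t * w.2)).
have cg : continuous g.
  move=> w; apply: continuous_comp; last exact: continuous_cos.
  by apply: cvgD; [exact: cvg_cst | exact: continuous_lin].
have gb : bounded_fun g.
  exists 1; split; first exact: num_real.
  by move=> M M1 w _; apply: le_trans (ltW M1); exact: cos_abs_le1.
have H := UU' cg gb.
have H' : ('E_(P n)[fun o => g (Z o)])%E @[n --> \oo] --> (expR (- (V s t / 2)) * cos th)%:E.
  apply/fine_cvgP; split.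
    by apply: nearW => n; rewrite (@expectation_words n (fun w => g (z n w))).
  have := @V_cos s t th; apply: cvg_trans; apply: near_eq_cvg; apply: nearW => n /=.
  rewrite (@expectation_words n (fun w => g (z n w))) /=.
  by apply: eq_wavg => w _; congr cos; rewrite /z /=; ring.
have E := cvg_unique (@ereal_hausdorff R) H H'.
rewrite -E; congr ('E_Q[_])%E; apply/funext => o; rewrite /g /=; congr cos; ring.
Qed.

(** The second moments of s z1 + z2 tend to 0, but the square is no bounded test function. Its
    substitute y^2 / (1 + y^2) is bounded, lies below y^2, and vanishes only at y = 0. *)
Lemma laws_limit_degenerate (s : R) : V s 1 = 0 -> Q [set o | s * U o + U' o <> 0] = 0%E.
Proof.
move=> V0; pose y (w : R * R) := s * w.1 + 1 * w.2.
pose g (w : R * R) := y w ^+ 2 / (1 + y w ^+ 2).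
have den w : 0 < 1 + y w ^+ 2 by rewrite ltr_pwDl // sqr_ge0.
have g0 w : 0 <= g w by rewrite divr_ge0 ?sqr_ge0 // ltW.
have g1 w : g w <= 1 by rewrite ler_pdivrMr // mul1r lerDr.
have gy w : g w <= y w ^+ 2 by rewrite ler_pdivrMr // ler_peMr ?sqr_ge0 // lerDl sqr_ge0.
have cy2 : continuous (fun w => y w ^+ 2).
  have -> : (fun w => y w ^+ 2) = (fun w => y w * y w) by apply/funext => w; rewrite expr2.
  by move=> w; apply: cvgM; exact: continuous_lin.
have cg : continuous g.
  move=> w; apply: cvgM; first exact: cy2.
  apply: cvgV; first by rewrite gt_eqF.
  by apply: cvgD; [exact: cvg_cst|exact: cy2].
have gb : bounded_fun g.
  exists 1; split; first exact: num_real.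
  by move=> M M1 w _; apply: le_trans (ltW M1); rewrite ger0_norm.
have H := UU' cg gb.
have [C C0 HC] := z_sqr_bounded s 1.
have H' : ('E_(P n)[fun o => g (Z o)])%E @[n --> \oo] --> 0%:E.
  apply/fine_cvgP; split.
    by apply: nearW => n; rewrite (@expectation_words n (fun w => g (z n w))).
  apply/cvgrPdist_le => e e0; near=> n => /=.
  rewrite (@expectation_words n (fun w => g (z n w))) /= sub0r normrN.
  have G0 : 0 <= wavg n (fun w => g (z n w)).
    by rewrite -(wavg_cst L_gt0 n 0); apply: wavg_le => w _.
  rewrite ger0_norm //.
  have n0 : (0 : R) < n%:R by near: n; exact: nbhs_infty_gtr.
  have nC : C / e < n%:R by near: n; exact: nbhs_infty_gtr.
  apply: (@le_trans _ _ (C * n%:R^-1)).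
    rewrite -[leRHS]add0r -V0; apply: le_trans (HC n).
    by apply: wavg_le => w _; exact: gy.
  by rewrite ler_pdivrMr // mulrC -ler_pdivrMr // ltW.
have E := cvg_unique (@ereal_hausdorff R) H H'.
have mg : measurable_fun setT (fun o => g (U o, U' o)).
  have my : measurable_fun setT (fun o => y (U o, U' o)).
    by apply: measurable_funD; apply: measurable_funM => //; exact: measurable_funP.
  apply: measurable_funM; first exact: measurable_funX.
  apply: (@measurableT_comp _ _ _ _ _ _ (fun x : R => (1 + x ^+ 2)^-1) _ (fun o => y (U o, U' o))) => //.
  apply: continuous_measurable_fun => x; apply: cvgV.
    by rewrite gt_eqF // ltr_pwDl // sqr_ge0.
  by apply: cvgD; [exact: cvg_cst|exact: exprn_continuous].
have : (\int[Q]_o `|(g (U o, U' o))%:E| = 0)%E.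
  transitivity ('E_Q[fun o => g (U o, U' o)])%E; last exact: E.
  rewrite unlock; apply: eq_integral => o _.
  by rewrite /= ger0_norm.
move=> /(ae_eq_integral_abs Q measurableT _).1.
have mgE : measurable_fun setT (fun o => (g (U o, U' o))%:E) by apply/measurable_EFinP.
move=> /(_ mgE) [N [mN N0 HN]].
apply/eqP; rewrite eq_le measure_ge0 andbT -N0 le_measure ?inE //.
  rewrite (_ : [set o | _] = (fun o => g (U o, U' o)) @^-1` (~` [set 0])).
    rewrite -[X in measurable X]setTI; apply: mg => //; apply: measurableC; exact: measurable_set1.
  apply/seteqP; split => o /=.
    move=> h /eqP; rewrite mulf_eq0 invr_eq0 (gt_eqF (den _)) orbF sqrf_eq0 /y /= mul1r => /eqP; exact: h.
  by move=> h h0; apply: h; rewrite /g /y /= mul1r h0 expr0n /= mul0r.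
move=> o h; apply: HN => /= /(_ I) [].
move=> /eqP; rewrite mulf_eq0 invr_eq0 (gt_eqF (den _)) orbF sqrf_eq0 /y /= mul1r => /eqP; exact: h.
Unshelve. all: by end_near. Qed.

End Limit.

Lemma laws_normal_iff : asymptotically_jointly_normal P Z <-> mx22 v1 c c v2 \in unitmx.
Proof.
rewrite mx22_unit; split.
  move=> [d' [Om' [Q [U [U' [bin cvgZ]]]]]]; apply/eqP => D0.
  (* This [s] minimizes V s 1, with minimum det / v1. For a singular matrix the limit lives on the
     corresponding line, which a regular normal law does not charge. *)
  have V0 : V (- c / v1) 1 = 0.
    have -> : V (- c / v1) 1 = (v1 * v2 - c * c) / v1 by rewrite /V; field; rewrite gt_eqF.
    by rewrite D0 mul0r.
  have N1 := laws_limit_degenerate cvgZ V0.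
  have N2 := binormal_line_null bin (- c / v1).
  have my : measurable_fun setT (fun o => - c / v1 * U o + U' o).
    by apply: measurable_funD => //; apply: measurable_funM => //; exact: measurable_funP.
  have : Q setT = 0%E.
    rewrite (_ : setT = [set o | - c / v1 * U o + U' o <> 0] `|` [set o | - c / v1 * U o + U' o = 0]).
      have mB : measurable [set o | - c / v1 * U o + U' o = 0].
        by rewrite -[X in measurable X]setTI; apply: (my measurableT [set 0]); exact: measurable_set1.
      have mA : measurable [set o | - c / v1 * U o + U' o <> 0].
        exact: (measurableC mB).
      by rewrite measureU0.
    by apply/seteqP; split => // o _; case: (pselect (- c / v1 * U o + U' o = 0)); [right|left].
  by rewrite probability_setT => /eqP; rewrite onee_eq0.
move=> Dn0.
have D0 : 0 < v1 * v2 - c * c.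
  (* The determinant is nonnegative as [v1] times a value of the nonnegative form [V]. *)
  rewrite lt_neqAle eq_sym Dn0 /=; have := V_ge0 (- c / v1) 1.
  have -> : V (- c / v1) 1 = (v1 * v2 - c * c) / v1 by rewrite /V; field; rewrite gt_eqF.
  by rewrite pmulr_lge0 // invr_gt0.
pose s1 := Num.sqrt v1; pose s2 := Num.sqrt ((v1 * v2 - c * c) / v1).
have s10 : 0 < s1 by rewrite sqrtr_gt0.
have s20 : 0 < s2 by rewrite sqrtr_gt0 divr_gt0.
have [Q [QE Qcos]] := cond_normal_probability (c / v1) s10 s20.
pose U : {RV Q >-> R} := HB.pack (fun w : measurableTypeR R * measurableTypeR R => w.1 : R)
    (isMeasurableFun.Build _ _ _ _ _ (@measurable_fstR R)).
pose U' : {RV Q >-> R} := HB.pack (fun w : measurableTypeR R * measurableTypeR R => w.2 : R)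
    (isMeasurableFun.Build _ _ _ _ _ (@measurable_sndR R)).
exists _, _, Q, U, U'; split.
  exists (0, 0), (mx22 v1 c c v2); split.
  - exact: covariance_mx22.
  - by rewrite mx22_unit.
  - move=> B mB; rewrite (_ : [set o | _] = B); last by apply/seteqP; split => -[].
    rewrite QE //; apply: eq_integral => w _.
    by rewrite binormal_pdfE.
apply: laws_cvg => //.
move=> th s t; have := Qcos th s t; rewrite unlock /Rintegral /= => ->.
rewrite /= /s1 /s2 !sqr_sqrtr; [|exact: ltW (divr_gt0 _ _)|exact: ltW].
congr (expR _ * _); rewrite /V; field; by rewrite gt_eqF.
Qed.

Lemma laws_independent_iff : asymptotically_independent P Z <-> c = 0.
Proof.
split.
  move=> [d' [Om' [Q [U [U' [ind cvgZ]]]]]].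
  have Hc th s t := laws_limit_cos cvgZ th s t.
  have := independent_integral_cos ind.
  have E1 : (\int[Q]_o (cos (U o))%:E = (expR (- (v1 / 2)))%:E)%E.
    have := Hc 0 1 0; rewrite unlock cos0 mulr1 (_ : V 1 0 = v1); last by rewrite /V; ring.
    by move=> <-; apply: eq_integral => o _; congr (cos _)%:E; ring.
  have E2 : (\int[Q]_o (cos (U' o))%:E = (expR (- (v2 / 2)))%:E)%E.
    have := Hc 0 0 1; rewrite unlock cos0 mulr1 (_ : V 0 1 = v2); last by rewrite /V; ring.
    by move=> <-; apply: eq_integral => o _; congr (cos _)%:E; ring.
  rewrite E1 E2.
  have icos t : Q.-integrable setT (fun o => (cos (0 + 1 * U o + t * U' o))%:E).
    apply: (@integrable_bounded_prob R _ _ Q (fun o => cos (0 + 1 * U o + t * U' o)) 1); last by move=>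
        o; exact: cos_abs_le1.
    apply: measurableT_comp; first exact: measurable_cos.
    by apply: measurable_funD; [apply: measurable_funD => //|]; apply: measurable_funM => //; exact:
        measurable_funP.
  (* The product of cosines is half the sum of the cosines of U + U' and U - U', whose expectations
     are known in the directions (1, 1) and (1, -1). *)
  have -> : (\int[Q]_o (cos (U o) * cos (U' o))%:E =
      (2^-1 * (expR (- (V 1 1 / 2)) + expR (- (V 1 (-1) / 2))))%R%:E)%E.
    have h1 := Hc 0 1 1; have h2 := Hc 0 1 (-1); rewrite unlock cos0 mulr1 in h1; rewrite unlock cos0 mulr1 in h2.
    rewrite EFinM EFinD -h1 -h2 -integralD // -integralZl //; last exact: integrableD.
    apply: eq_integral => o _; rewrite -EFinD -EFinM; congr EFin.
    have -> : 0 + 1 * U o + 1 * U' o = U o + U' o by ring.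
    have -> : 0 + 1 * U o + -1 * U' o = U o - U' o by ring.
    by rewrite cosD cosB; field.
  rewrite -EFinM => -[].
  have -> : - (V 1 1 / 2) = - (v1 / 2) + - (v2 / 2) - c by rewrite /V; field.
  have -> : - (V 1 (-1) / 2) = - (v1 / 2) + - (v2 / 2) + c by rewrite /V; field.
  rewrite !expRD => H.
  have e0 : 0 < expR (- (v1 / 2)) * expR (- (v2 / 2)) by rewrite mulr_gt0 ?expR_gt0.
  (* Factorization leaves cosh c = 1, which forces c = 0. *)
  have : expR (- c) + expR c = 2.
    by apply: (mulfI (lt0r_neq0 e0)); rewrite -[RHS]mulrC -[X in 2 * X]H; field.
  rewrite expRN => H2.
  have ec : expR c = 1.
    have := expR_gt0 c => ec0.
    have : (expR c - 1) ^+ 2 = 0.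
      have -> : (expR c - 1) ^+ 2 = expR c * ((expR c)^-1 + expR c - 2) by field; rewrite gt_eqF.
      by rewrite H2 subrr mulr0.
    by move=> /eqP; rewrite sqrf_eq0 subr_eq0 => /eqP.
  by apply: expR_inj; rewrite ec expR0.
move=> c0.
pose s1 := Num.sqrt v1; pose t2 := Num.sqrt v2.
have s10 : 0 < s1 by rewrite sqrtr_gt0.
have v2_ge0 : 0 <= v2 by have := V_ge0 0 1; rewrite /V expr0n /= !mulr0 !mul0r !add0r expr1n mul1r.
(* The variance [v2] may be 0 here. The second coordinate is therefore a standard normal variable
   multiplied by [t2], which is constant in the degenerate case. *)
have [Q [QE Qcos]] := cond_normal_probability 0 s10 (ltr01 : 0 < (1 : R)).
pose U : {RV Q >-> R} := HB.pack (fun w : measurableTypeR R * measurableTypeR R => w.1 : R)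
    (isMeasurableFun.Build _ _ _ _ _ (@measurable_fstR R)).
have mU' : @measurable_fun _ _ (measurableTypeR R * measurableTypeR R)%type R setT (fun w => t2 * w.2).
  by apply: measurable_funM => //; exact: measurable_sndR.
pose U' : {RV Q >-> R} := HB.pack (fun w : measurableTypeR R * measurableTypeR R => t2 * w.2 : R)
    (isMeasurableFun.Build _ _ _ _ _ mU').
exists _, _, Q, U, U'; split.
  move=> A B mA mB.
  pose B' : set R := (fun x => t2 * x) @^-1` B.
  have mB' : measurable B'.
    by rewrite /B' -[X in measurable X]setTI; apply: (measurable_funM (measurable_cst t2) (@measurable_id _ _ _)).
  have rect (A1 A2 : set R) : measurable A1 -> measurable A2 -> Q (A1 `*` A2) =
     ((\int[lebesgue_measure]_(x in A1) (normal_pdf 0 s1 x)%:E) *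
      (\int[lebesgue_measure]_(x in A2) (normal_pdf 0 1 x)%:E))%E.
    move=> m1 m2; rewrite QE; last exact: measurableX.
    exact: integral_rect_normal.
  have -> : U @^-1` A `&` U' @^-1` B = A `*` B' by [].
  have -> : U @^-1` A = A `*` setT by apply/seteqP; split => w /=; [|case].
  have -> : U' @^-1` B = setT `*` B' by apply/seteqP; split => w /=; [|case].
  by rewrite !rect // !integral_normal_pdf mule1 mul1e.
apply: laws_cvg => //.
move=> th s t; have := Qcos th s (t * t2); rewrite unlock => H.
transitivity (fine (\int[Q]_w (cos (th + s * w.1 + t * t2 * w.2))%:E)%E).
  congr fine; apply: eq_integral => w _; congr (cos _)%:E; rewrite /=; ring.
rewrite H /=; congr (expR _ * _).
by rewrite mulr0 addr0 exprMn /s1 /t2 !sqr_sqrtr ?(ltW v1_gt0) // /V c0; field.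
Qed.

End Laws.

Lemma eq_upto_O1_bounded (R : realType) (u : nat -> \bar R) (v r : nat -> R) (C : R) :
  (forall n, u n = (v n + r n)%:E) -> (forall n, `|r n| <= C) -> eq_upto_O1 u v.
Proof.
move=> ur rC; exists r => //; apply/eqOP; near=> k; apply: nearW => n.
rewrite normr1 mulr1; apply: (le_trans (rC n)).
by near: k; apply: nbhs_pinfty_ge; exact: num_real.
Unshelve. all: by end_near. Qed.

Lemma wavg_centered (R : realType) (L : finType) (L_gt0 : (0 < #|L|)%N) k (D D' : seq L -> R) c c' :
  wavg k (fun w => (D w + c - wavg k (fun w => D w + c)) * (D' w + c' - wavg k (fun w => D' w + c'))) =
  wavg k (fun w => D w * D' w) - wavg k D * wavg k D'.
Proof.
rewrite !wavgD !wavg_cst //.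
rewrite (eq_wavg (F' := fun w => D w * D' w + ((- wavg k D') * D w + ((- wavg k D) * D' w + wavg k D *
    wavg k D')))); last first.
  by move=> w _; ring.
by rewrite wavgD wavgD wavgD !wavgZ wavg_cst //; ring.
Qed.

Theorem theorem3p9 (R : realType) (T : transducer R) (a : tr_state T -> R)
    (Tcomplete : complete_transducer T) (Tsubseq : subsequential a)
    (Tconn : finally_connected T) (Taper : finally_aperiodic T)
    (K2 : (2 <= #|` tr_in T|)%N)
    (d : nat -> measure_display) (Om : forall n : nat, measurableType (d n))
    (P : forall n : nat, probability (Om n) R)
    (X : forall n : nat, Om n -> n.-tuple (tr_letter T))
    (Xunif : uniform_words P X) :
  let K : R := #|` tr_in T|%:R in
  let Input (n : nat) (o : Om n) : R := input_sum (X n o) in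
  let Output (n : nat) (o : Om n) : R := output_sum a (X n o) in
  let f := char_fun T in
  let fx := Dx f 1 1 1 in
  let fy := Dy f 1 1 1 in
  let fz := Dz f 1 1 1 in
  let fxx := Dx (Dx f) 1 1 1 in
  let fyy := Dy (Dy f) 1 1 1 in
  let fzz := Dz (Dz f) 1 1 1 in
  let fxy := Dy (Dx f) 1 1 1 in
  let fxz := Dz (Dx f) 1 1 1 in
  let fyz := Dz (Dy f) 1 1 1 in
  let e1 := fx / fz in
  let e2 := fy / fz in
  let v1 := (fx ^+ 2 * (fzz + fz) + fz ^+ 2 * (fxx + fx)
             - 2 * fx * fz * fxz) / fz ^+ 3 in
  let v2 := (fy ^+ 2 * (fzz + fz) + fz ^+ 2 * (fyy + fy)
             - 2 * fy * fz * fyz) / fz ^+ 3 in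
  let c := (fx * fy * (fzz + fz) + fz ^+ 2 * fxy
            - fy * fz * fxz - fx * fz * fyz) / fz ^+ 3 in
  let Omega := standardized e1 e2 Input Output in
  fz != 0
  /\ (forall n : nat, ('E_(P n)[Input n] = (e1 * n%:R)%:E)%E)
  /\ eq_upto_O1 (fun n => 'E_(P n)[Output n])%E (fun n => e2 * n%:R)
  /\ (forall n : nat, ('V_(P n)[Input n] = (v1 * n%:R)%:E)%E)
  /\ eq_upto_O1 (fun n => 'V_(P n)[Output n])%E (fun n => v2 * n%:R)
  /\ eq_upto_O1 (fun n => covariance (P n) (Input n) (Output n))
       (fun n => c * n%:R)
  /\ e1 = K^-1 * \sum_(eps : tr_letter T) val eps
  /\ v1 = K^-1 * (\sum_(eps : tr_letter T) val eps ^+ 2)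
          - (K^-1 * \sum_(eps : tr_letter T) val eps) ^+ 2
  /\ (asymptotically_jointly_normal P Omega <-> mx22 v1 c c v2 \in unitmx)
  /\ (asymptotically_independent P Omega <->
        fx * fy * (fzz + fz) + fz ^+ 2 * fxy - fy * fz * fxz - fx * fz * fyz
        = 0)
  /\ (asymptotically_independent P Omega <->
        e1 * fy * (fzz + fz) + fz * fxy - fy * fxz - e1 * fz * fyz = 0).
Proof.
have Tdet := Tsubseq.1.
have [t0 t0f] := Tconn.
have L_gt0 : (0 < #|tr_letter T|)%N by rewrite card_letter; apply: leq_trans K2.
have [E2 [h2 [Cc [V2 [hc [hv [H1 H2 H3]]]]]]] := transducer_poisson Tcomplete Tdet K2 t0f.
have [l Hl] : isgp (char_fun T).
  rewrite (char_funE Tcomplete Tdet t0f); exact: isgp_chain_char.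
have mom p q : moment_eqs l p q (p * in_mean T + q * E2) (mixed_var T Cc V2 p q).
  exact: (char_fun_moment_eqs Tcomplete Tdet K2 t0f H1 H2 H3).
have V10 : mixed_var T Cc V2 1 0 = in_var T by rewrite /mixed_var; ring.
have V01 : mixed_var T Cc V2 0 1 = V2 by rewrite /mixed_var; ring.
have V11 : mixed_var T Cc V2 1 1 = in_var T + 2 * Cc + V2 by rewrite /mixed_var; ring.
have m10 : moment_eqs l 1 0 (in_mean T) (in_var T).
  by have := mom 1 0; rewrite V10 mul1r mul0r addr0.
have m01 : moment_eqs l 0 1 E2 V2 by have := mom 0 1; rewrite V01 mul1r mul0r add0r.
have m11 : moment_eqs l 1 1 (in_mean T + E2) (in_var T + 2 * Cc + V2).
  by have := mom 1 1; rewrite V11 !mul1r.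
have fz0 := char_fun_z_neq0 Tcomplete Tdet K2 t0f Hl.
have [e1E e2E] := mean_formulas Hl m10 m01 fz0.
have [v1E v2E cE] := variance_formulas Hl m10 m01 m11 fz0.
move=> K Input Output f fx fy fz fxx fyy fzz fxy fxz fyz e1 e2 v1 v2 c Omega.
have {}e1E : e1 = in_mean T by exact: e1E.
have {}e2E : e2 = E2 by exact: e2E.
have {}v1E : v1 = in_var T by exact: v1E.
have {}v2E : v2 = V2 by exact: v2E.
have {}cE : c = Cc by exact: cE.
have {}fz0 : fz != 0 by exact: fz0.
have Xunif' n (w : n.-tuple (tr_letter T)) : measurable (@X n @^-1` [set w]) /\
    P n (@X n @^-1` [set w]) = ((#|tr_letter T|%:R ^+ n)^-1)%:E.
  by rewrite card_letter; exact: Xunif.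
pose D1 := in_dev (T := T); pose D2 := out_dev a E2.
have InE n : Input n = (fun o => D1 n (rev (X n o)) + in_mean T * n%:R).
  by apply/funext => o; rewrite /Input /D1 /in_dev subrK; exact: input_sumE.
have OutE n : Output n = (fun o => D2 n (rev (X n o)) + E2 * n%:R).
  by apply/funext => o; rewrite /Output /D2 /out_dev subrK; exact: output_sumE.
have ex n F := expectation_words Xunif' n F.
have cov n F H := covariance_words Xunif' n F H.
have D1mean n : wavg n (D1 n) = 0 by exact: in_dev_mean.
have D1sqr n : wavg n (fun w => D1 n w ^+ 2) = n%:R * in_var T by exact: in_dev_sqr.
have [M M0 HM] := mixed_mean a K2 H1 0 1.
have [S S0 HS] := mixed_sqr a Tcomplete Tdet Taper K2 t0f H1 H2 H3 0 1.
have [S' S'0 HS'] := mixed_sqr a Tcomplete Tdet Taper K2 t0f H1 H2 H3 1 1.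
have D2mean n : `|wavg n (D2 n)| <= M.
  have := HM n; rewrite (eq_wavg (F' := D2 n)) // => w _; rewrite /D2; ring.
have D2sqr n : `|wavg n (fun w => D2 n w * D2 n w) - n%:R * V2| <= S.
  have := HS n; rewrite V01 (eq_wavg (F' := fun w => D2 n w * D2 n w)) // => w _; rewrite /D2; ring.
have D12sqr n : `|wavg n (fun w => (D1 n w + D2 n w) ^+ 2) - n%:R * (in_var T + 2 * Cc + V2)| <= S'.
  have := HS' n; rewrite V11 (eq_wavg (F' := fun w => (D1 n w + D2 n w) ^+ 2)) // => w _.
  by rewrite /D1 /D2 !mul1r.
have OmegaE : Omega = (fun n o => (D1 n (rev (X n o)) / Num.sqrt n%:R, D2 n (rev (X n o)) / Num.sqrt n%:R)).
  (* The probability space depends on [n], so extensionality has to be dependent. *)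
  apply: functional_extensionality_dep => n; apply/funext => o.
  by rewrite /Omega /standardized InE OutE e1E e2E !addrK.
have Vcos s t th := @mixed_cos R T a K2 t0 E2 h2 H1 Cc V2 hc hv H2 H3 s t th.
have Vsqr s t := mixed_sqr a Tcomplete Tdet Taper K2 t0f H1 H2 H3 s t.
have Vge0 s t := mixed_var_ge0 K2 t0 H2 H3 s t.
have normal_iff := laws_normal_iff L_gt0 Xunif' (in_var_gt0 K2) Vge0 Vsqr Vcos.
have indep_iff := laws_independent_iff L_gt0 Xunif' (in_var_gt0 K2) Vge0 Vsqr Vcos.
have cnum : c = 0 <-> fx * fy * (fzz + fz) + fz ^+ 2 * fxy - fy * fz * fxz - fx * fz * fyz = 0.
  rewrite /c; split => [/eqP|->]; last by rewrite mul0r.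
  by rewrite mulf_eq0 invr_eq0 expf_eq0 (negbTE fz0) andbF orbF => /eqP.
split; first exact: fz0.
split=> [n|]; first by rewrite InE (ex n (fun w => D1 n w + in_mean T * n%:R)) wavgD D1mean wavg_cst // add0r e1E.
split.
  apply: (@eq_upto_O1_bounded _ _ _ (fun n => wavg n (D2 n)) M) => // n.
  by rewrite OutE (ex n (fun w => D2 n w + E2 * n%:R)) wavgD wavg_cst // e2E addrC.
split=> [n|].
  rewrite /variance InE (cov n (fun w => D1 n w + in_mean T * n%:R) (fun w => D1 n w + in_mean T * n%:R)).
  by rewrite wavg_centered // D1mean mul0r subr0 v1E mulrC -(D1sqr n).
split.
  apply: (@eq_upto_O1_bounded _ _ _ (fun n => (wavg n (fun w => D2 n w * D2 n w) - n%:R * V2) - wavg n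
      (D2 n) ^+ 2) (S + M ^+ 2)) => n.
    rewrite /variance OutE (cov n (fun w => D2 n w + E2 * n%:R) (fun w => D2 n w + E2 * n%:R)).
    by rewrite wavg_centered // v2E; congr EFin; ring.
  apply: (le_trans (ler_normB _ _)); apply: lerD => //.
  by rewrite normrX lerXn2r ?nnegrE.
split.
  (* Polarization: half of the square of D1 + D2 minus those of D1 and D2. The square of D1 has the
     exact mean [n%:R * in_var T] and leaves no error; the product of means vanishes with the mean
     of D1. *)
  apply: (@eq_upto_O1_bounded _ _ _ (fun n => ((wavg n (fun w => (D1 n w + D2 n w) ^+ 2) - n%:R *
      (in_var T + 2 * Cc + V2)) -
     (wavg n (fun w => D2 n w * D2 n w) - n%:R * V2)) / 2) ((S' + S) / 2)) => n.
    rewrite InE OutE (cov n (fun w => D1 n w + in_mean T * n%:R) (fun w => D2 n w + E2 * n%:R)).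
    rewrite wavg_centered // D1mean mul0r subr0 cE; congr EFin.
    rewrite (eq_wavg (F := fun w => (D1 n w + D2 n w) ^+ 2) (F' := fun w => D1 n w ^+ 2 + (2 * (D1 n w *
        D2 n w) + D2 n w * D2 n w))); last first.
      by move=> w _; ring.
    by rewrite wavgD wavgD wavgZ D1sqr; field.
  rewrite normrM normfV (normr_nat R 2) ler_pM2r ?invr_gt0 //.
  by apply: (le_trans (ler_normB _ _)); apply: lerD.
split; first by rewrite e1E /in_mean /avg card_letter.
split; first by rewrite v1E in_varE // /in_mean /avg card_letter.
split; first by rewrite OmegaE v1E v2E cE; exact: normal_iff.
have ind : asymptotically_independent P Omega <-> c = 0 by rewrite OmegaE cE; exact: indep_iff.
split; first exact: (iff_trans ind cnum).
apply: (iff_trans ind); apply: (iff_trans cnum).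
(* Both criteria differ by the nonzero factor f_z, since f_x = e1 f_z. *)
have -> : fx * fy * (fzz + fz) + fz ^+ 2 * fxy - fy * fz * fxz - fx * fz * fyz =
   fz * (e1 * fy * (fzz + fz) + fz * fxy - fy * fxz - e1 * fz * fyz) by rewrite /e1; field.
split => [/eqP|->]; last by rewrite mulr0.
by rewrite mulf_eq0 (negbTE fz0) => /eqP.
Qed.
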